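(* Let $\Omega\subset\mathbb{R}^N$ be a bounded strictly convex domain having an interior tangent ball at every point of $\partial\Omega$, and $j\in\{1,\dots,N\}$. Let $g$ be such that the viscosity solution $z$ of $\lambda_j(D^2z)=0$ in $\Omega$, $z=g$ on $\partial\Omega$, belongs to $C^1(\overline\Omega)$, and let $u_0\in C^1(\overline\Omega)$ with $u_0|_{\partial\Omega}=g$. Let $\mu_1>0$, $\psi_1$, $\varphi_1=-\psi_1$ be as follows: $\psi_1\in C(\overline\Omega)$, $\psi_1>0$ in $\Omega$, $\psi_1=0$ on $\partial\Omega$, $-\lambda_N(D^2\psi_1)=\mu_1\psi_1$ in $\Omega$ (so $-\lambda_1(D^2\varphi_1)=\mu_1\varphi_1$). Let $u$ be the viscosity solution of $u_t-\lambda_j(D^2u)=0$ in $\Omega\times(0,\infty)$, $u=g$ on $\partial\Omega\times(0,\infty)$, $u(\cdot,0)=u_0$. Then there exist constants $C_1,C_2>0$ depending on $u_0$ such that for all $x\in\Omega$, $t>0$, \[ z(x)+C_1e^{-\mu_1t}\varphi_1(x)\le u(x,t)\le z(x)+C_2e^{-\mu_1t}\psi_1(x). \]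
   Context: $\lambda_j(A)$ is the $j$-th smallest eigenvalue of a symmetric matrix $A$, $\lambda_j(A)=\inf_{\dim S=j}\sup_{v\in S,|v|=1}\langle Av,v\rangle$. All equations are in the viscosity sense, solutions continuous up to the boundary. *)

(* Defs.v *)
From mathcomp Require Import all_boot.
From Stdlib Require Import Reals ClassicalEpsilon.
Set Implicit Arguments. Unset Strict Implicit. Unset Printing Implicit Defensive.
Open Scope R_scope.

Definition vec (N : nat) := 'I_N -> R.
Definition mat (N : nat) := 'I_N -> 'I_N -> R.

Definition dot {N : nat} (x y : vec N) : R := \big[Rplus/0]_(i < N) (x i * y i).
Definition vnorm {N : nat} (x : vec N) : R := sqrt (dot x x).
Definition vsub {N : nat} (x y : vec N) : vec N := fun i => x i - y i.
Definition vcomb {N : nat} (a b : R) (x y : vec N) : vec N := fun i => a * x i + b * y i.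
Definition mulv {N : nat} (A : mat N) (v : vec N) : vec N := fun i => dot (A i) v.
Definition quad {N : nat} (A : mat N) (v : vec N) : R := dot (mulv A v) v.
Definition symmetric {N : nat} (A : mat N) : Prop := forall i k, A i k = A k i.

Definition lcomb {N j : nat} (b : 'I_j -> vec N) (c : vec j) : vec N :=
  fun i => \big[Rplus/0]_(k < j) (c k * b k i).
(* b is linearly independent; its span is then a j-dimensional subspace,
   and every j-dimensional subspace arises this way. *)
Definition lin_indep {N j : nat} (b : 'I_j -> vec N) : Prop :=
  forall c : vec j, (forall i, lcomb b c i = 0) -> forall k, c k = 0.

Definition is_glb (E : R -> Prop) (m : R) : Prop :=
  (forall x, E x -> m <= x) /\ (forall m', (forall x, E x -> m' <= x) -> m' <= m).

Definition rayleigh_sup {N j : nat} (A : mat N) (b : 'I_j -> vec N) (s : R) : Prop :=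
  is_lub (fun r => exists c : vec j, vnorm (lcomb b c) = 1 /\ r = quad A (lcomb b c)) s.

Definition is_lambda {N : nat} (j : nat) (A : mat N) (l : R) : Prop :=
  is_glb (fun s => exists b : 'I_j -> vec N, lin_indep b /\ rayleigh_sup A b s) l.

Definition lambda {N : nat} (j : nat) (A : mat N) : R :=
  epsilon (inhabits 0) (is_lambda j A).

Definition vopen_set {N : nat} (O : vec N -> Prop) : Prop :=
  forall x, O x -> exists r, 0 < r /\ forall y, vnorm (vsub y x) < r -> O y.
Definition vbounded {N : nat} (O : vec N -> Prop) : Prop :=
  exists M, forall x, O x -> vnorm x <= M.
Definition vclos {N : nat} (O : vec N -> Prop) (x : vec N) : Prop :=
  forall eps, 0 < eps -> exists y, O y /\ vnorm (vsub y x) < eps.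
Definition vboundary {N : nat} (O : vec N -> Prop) (x : vec N) : Prop :=
  vclos O x /\ ~ O x.
Definition strictly_convex {N : nat} (O : vec N -> Prop) : Prop :=
  forall x y, vclos O x -> vclos O y -> x <> y ->
    forall t, 0 < t < 1 -> O (vcomb (1 - t) t x y).
Definition interior_ball_condition {N : nat} (O : vec N -> Prop) : Prop :=
  forall x0, vboundary O x0 -> exists (c : vec N) (r : R),
    0 < r /\ vnorm (vsub x0 c) = r /\ forall y, vnorm (vsub y c) < r -> O y.

Definition cont_on {N : nat} (S : vec N -> Prop) (f : vec N -> R) : Prop :=
  forall x, S x -> forall eps, 0 < eps -> exists del, 0 < del /\
    forall y, S y -> vnorm (vsub y x) < del -> Rabs (f y - f x) < eps.

Definition C1_closure {N : nat} (O : vec N -> Prop) (u : vec N -> R) : Prop :=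
  cont_on (vclos O) u /\
  exists Du : vec N -> vec N,
    (forall k, cont_on (vclos O) (fun x => Du x k)) /\
    forall x, O x -> forall eps, 0 < eps -> exists del, 0 < del /\
      forall y, vnorm (vsub y x) < del ->
        Rabs (u y - u x - dot (Du x) (vsub y x)) <= eps * vnorm (vsub y x).

Definition superjet {N : nat} (O : vec N -> Prop) (u : vec N -> R) (x : vec N)
  (p : vec N) (X : mat N) : Prop :=
  symmetric X /\ forall eps, 0 < eps -> exists del, 0 < del /\
    forall y, O y -> vnorm (vsub y x) < del ->
      u y <= u x + dot p (vsub y x) + / 2 * quad X (vsub y x)
             + eps * (vnorm (vsub y x)) ^ 2.
Definition subjet {N : nat} (O : vec N -> Prop) (u : vec N -> R) (x : vec N)
  (p : vec N) (X : mat N) : Prop :=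
  symmetric X /\ forall eps, 0 < eps -> exists del, 0 < del /\
    forall y, O y -> vnorm (vsub y x) < del ->
      u y >= u x + dot p (vsub y x) + / 2 * quad X (vsub y x)
             - eps * (vnorm (vsub y x)) ^ 2.

(* viscosity solution in O of F(x, u, D^2u) = 0 with F degenerate elliptic
   convention (sub: F <= 0 on superjets, super: F >= 0 on subjets) *)
Definition visc_sol {N : nat} (O : vec N -> Prop) (F : vec N -> R -> mat N -> R)
  (u : vec N -> R) : Prop :=
  (forall x p X, O x -> superjet O u x p X -> F x (u x) X <= 0) /\
  (forall x p X, O x -> subjet O u x p X -> F x (u x) X >= 0).

Definition psuperjet {N : nat} (O : vec N -> Prop) (u : vec N -> R -> R)
  (x : vec N) (t : R) (a : R) (p : vec N) (X : mat N) : Prop :=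
  symmetric X /\ forall eps, 0 < eps -> exists del, 0 < del /\
    forall y s, O y -> 0 < s -> vnorm (vsub y x) < del -> Rabs (s - t) < del ->
      u y s <= u x t + a * (s - t) + dot p (vsub y x) + / 2 * quad X (vsub y x)
               + eps * ((vnorm (vsub y x)) ^ 2 + Rabs (s - t)).
Definition psubjet {N : nat} (O : vec N -> Prop) (u : vec N -> R -> R)
  (x : vec N) (t : R) (a : R) (p : vec N) (X : mat N) : Prop :=
  symmetric X /\ forall eps, 0 < eps -> exists del, 0 < del /\
    forall y s, O y -> 0 < s -> vnorm (vsub y x) < del -> Rabs (s - t) < del ->
      u y s >= u x t + a * (s - t) + dot p (vsub y x) + / 2 * quad X (vsub y x)
               - eps * ((vnorm (vsub y x)) ^ 2 + Rabs (s - t)).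

Definition visc_sol_heat_lambda {N : nat} (j : nat) (O : vec N -> Prop)
  (u : vec N -> R -> R) : Prop :=
  (forall x t a p X, O x -> 0 < t -> psuperjet O u x t a p X -> a - lambda j X <= 0) /\
  (forall x t a p X, O x -> 0 < t -> psubjet O u x t a p X -> a - lambda j X >= 0).

Definition cont_on_cyl {N : nat} (O : vec N -> Prop) (u : vec N -> R -> R) : Prop :=
  forall x t, vclos O x -> 0 <= t -> forall eps, 0 < eps -> exists del, 0 < del /\
    forall y s, vclos O y -> 0 <= s -> vnorm (vsub y x) < del -> Rabs (s - t) < del ->
      Rabs (u y s - u x t) < eps.

(* Main.v *)
Require Import Defs.
From Stdlib Require Import Reals Lra Psatz Classical ClassicalEpsilon FunctionalExtensionality.
From HB Require Import structures.
From mathcomp Require Import all_boot ssralg matrix mxalgebra Rstruct zify.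
Set Implicit Arguments. Unset Strict Implicit. Unset Printing Implicit Defensive.
Open Scope R_scope.

(** It suffices to prove the upper bound for a degenerate elliptic [F]; the two claims are the
    cases [F = lambda_j] and [F X = - lambda_j (- X)], the latter applied to [-u], [-z], [-u0].
    The function [psi1] is concave, with curvature at most [- mu1 psi1] in every direction, so it
    has second-order contact from above everywhere. Hence [C exp (- mu1 t) psi1] can be absorbed
    into test functions, and along rays concavity gives [|u0 - z| <= C psi1] on the closure.
    What remains is a comparison of [u - C exp (- mu1 t) psi1 - pen t], a strict subsolution, with
    the supersolution [z]. Their sup- and inf-convolutions are semiconvex, and one needs a point near
    the maximum of the difference where both are almost quadratic. Alexandrov's theorem and
    Jensen's lemma are replaced by a counting argument at a single small scale:
    - perturbing by the [P^N] linear functions with slopes on a grid of mesh [1/P] produces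
      maximum points lying in distinct cells of a grid of mesh comparable to [1/P];
    - normalized second differences [b >= 1] at a coarse scale are averages of those at a finer scale,
      so [sum 1/b] is monotone in the scale and the deviations from the average are summable;
    - therefore some maximum point and some scale have nearly constant second differences, that is,
      the function is nearly quadratic there, which suffices to move the touching paraboloid. *)

(** * Sums, dot products and quadratic forms *)

(** Semiconvexity bounds second differences from below only, so away from contact points nothing
    controls their sums or squares. Their reciprocals, once normalized to [b >= 1], lie in [(0, 1]];
    and since [1/x] is convex, averaging can only decrease their sum, the loss being an explicit
    variance. At a contact point the two functions squeeze each other between parabolas, so [b] is
    bounded there and a small loss means nearly equal second differences. The count closes because
    [P ^ N] contact points, losing [g] at each of [J] scales, are charged against about
    [N^2 (Q P) ^ N] units with [Q] independent of [J] and [P]: the powers of [P] cancel, so [J] can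
    be fixed before [P]. Since [z] does not depend on time, time is maximized away in the
    convolution of the penalized [u], and an elliptic comparison in [N] variables remains. The
    penalty [pen] supplies the strictness and also excludes the final time. *)

Lemma RplusA : associative Rplus. Proof. by move=> x y z; ring. Qed.
Lemma RplusC : commutative Rplus. Proof. by move=> x y; ring. Qed.
Lemma Rplus0 : left_id 0 Rplus. Proof. by move=> x; ring. Qed.
HB.instance Definition _ := Monoid.isComLaw.Build R 0 Rplus RplusA RplusC Rplus0.

Lemma Rabs_bounds x a : Rabs x <= a -> - a <= x <= a.
Proof. by split_Rabs; lra. Qed.

Section Sums.
Variable I : finType.
Implicit Types (F G : I -> R) (P : pred I).

Lemma sumD P F G : \big[Rplus/0]_(i | P i) (F i + G i) =
  \big[Rplus/0]_(i | P i) F i + \big[Rplus/0]_(i | P i) G i.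
Proof. exact: big_split. Qed.

Lemma sumZ P c F : \big[Rplus/0]_(i | P i) (c * F i) = c * \big[Rplus/0]_(i | P i) F i.
Proof. by elim/big_rec2: _ => [|i x y _ ->]; ring. Qed.

Lemma sum_le P F G : (forall i, P i -> F i <= G i) ->
  \big[Rplus/0]_(i | P i) F i <= \big[Rplus/0]_(i | P i) G i.
Proof. by move=> h; elim/big_rec2: _ => [|i x y /h]; lra. Qed.

Lemma sum_ge0 P F : (forall i, P i -> 0 <= F i) -> 0 <= \big[Rplus/0]_(i | P i) F i.
Proof. by move=> h; elim/big_rec: _ => [|i x /h]; lra. Qed.

Lemma sum_const c : \big[Rplus/0]_(i : I) c = INR #|I| * c.
Proof.
rewrite big_const; elim: #|I| => [|n IH] /=; first lra.
by rewrite IH -/(INR n.+1) S_INR; lra.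
Qed.

Lemma sum_abs F : Rabs (\big[Rplus/0]_i F i) <= \big[Rplus/0]_i Rabs (F i).
Proof.
elim/big_rec2: _ => [|i x y _ h]; first by rewrite Rabs_R0; lra.
by apply: Rle_trans (Rabs_triang _ _) _; lra.
Qed.

Lemma sum_single (F : I -> R) j : (forall i, i != j -> F i = 0) -> \big[Rplus/0]_i F i = F j.
Proof.
move=> h; rewrite (bigD1 j) //= big1; first by rewrite Rplus_0_r.
by move=> i /h.
Qed.

Lemma term_le_sum F j : (forall i, 0 <= F i) -> F j <= \big[Rplus/0]_i F i.
Proof.
move=> h; rewrite (bigD1 j) //=.
have := @sum_ge0 (fun i => i != j) F (fun i _ => h i); lra.
Qed.
End Sums.

Lemma sum_inj_le (I J : finType) (h : I -> J) (G : J -> R) : injective h ->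
  (forall j, 0 <= G j) -> \big[Rplus/0]_(i : I) G (h i) <= \big[Rplus/0]_(j : J) G j.
Proof.
move=> hi G0.
have -> : \big[Rplus/0]_(i : I) G (h i) = \big[Rplus/0]_(j in [set h x | x in [set: I]]) G j.
  rewrite big_imset; last by move=> x y _ _; apply: hi.
  by apply: eq_bigl => i; rewrite inE.
rewrite [X in _ <= X](bigID (mem [set h x | x in [set: I]])) /=.
have := @sum_ge0 J (fun j => j \notin [set h x | x in [set: I]]) G (fun j _ => G0 j); lra.
Qed.

Definition vadd {N} (x y : vec N) : vec N := fun i => x i + y i.
Definition vscale {N} (a : R) (x : vec N) : vec N := fun i => a * x i.
Definition vzero {N} : vec N := fun=> 0.
Definition unitv {N} (p : 'I_N) : vec N := fun i => if i == p then 1 else 0.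

Lemma unitvv N (q : 'I_N) : unitv q q = 1.
Proof. by rewrite /unitv eqxx. Qed.

Ltac vext := let i := fresh "i" in apply: functional_extensionality => i;
  rewrite /vadd /vscale /vsub /vcomb /vzero.

Section Dot.
Variable N : nat.
Implicit Types (x y w : vec N) (A B : mat N).

Lemma dotC x y : dot x y = dot y x.
Proof. by apply: eq_bigr => i _; ring. Qed.
Lemma dotDl x y w : dot (vadd x y) w = dot x w + dot y w.
Proof. by rewrite /dot -sumD; apply: eq_bigr => i _; rewrite /vadd; ring. Qed.
Lemma dotDr x y w : dot w (vadd x y) = dot w x + dot w y.
Proof. by rewrite dotC dotDl !(dotC w). Qed.
Lemma dotZl a x w : dot (vscale a x) w = a * dot x w.
Proof. by rewrite /dot -sumZ; apply: eq_bigr => i _; rewrite /vscale; ring. Qed.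
Lemma dotZr a x w : dot w (vscale a x) = a * dot w x.
Proof. by rewrite dotC dotZl (dotC w). Qed.
Lemma vsubE x y : vsub x y = vadd x (vscale (-1) y).
Proof. by vext; ring. Qed.
Lemma dot0l x : dot vzero x = 0.
Proof. by rewrite /dot big1 // => i _; rewrite /vzero; ring. Qed.
Lemma dot0r x : dot x vzero = 0.
Proof. by rewrite dotC dot0l. Qed.
Lemma dotBl x y w : dot (vsub x y) w = dot x w - dot y w.
Proof. by rewrite vsubE dotDl dotZl; ring. Qed.
Lemma dotBr x y w : dot w (vsub x y) = dot w x - dot w y.
Proof. by rewrite dotC dotBl !(dotC w). Qed.
Lemma dot_unitl p x : dot (unitv p) x = x p.
Proof.
rewrite /dot (@sum_single _ _ p) /unitv ?eqxx ?Rmult_1_l // => i /negbTE ->; ring.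
Qed.
Lemma dot_unitr p x : dot x (unitv p) = x p.
Proof. by rewrite dotC dot_unitl. Qed.
Lemma dot_ge0 x : 0 <= dot x x.
Proof. by apply: sum_ge0 => i _; nra. Qed.
Lemma coord_sqr_le x p : x p * x p <= dot x x.
Proof. by apply: (@term_le_sum _ (fun i => x i * x i)) => i; nra. Qed.
Lemma vnorm_ge0 x : 0 <= vnorm x.
Proof. exact: sqrt_pos. Qed.
Lemma vnorm_sqr x : vnorm x * vnorm x = dot x x.
Proof. exact: sqrt_sqrt (dot_ge0 x). Qed.
Lemma vnorm_pow2 x : vnorm x ^ 2 = dot x x.
Proof. by rewrite -vnorm_sqr; ring. Qed.
Lemma vnorm_le x c : 0 <= c -> dot x x <= c * c -> vnorm x <= c.
Proof. by move=> c0 h; have := vnorm_sqr x; have := vnorm_ge0 x; nra. Qed.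
Lemma vnorm_lt x c : 0 < c -> dot x x < c * c -> vnorm x < c.
Proof. by move=> c0 h; have := vnorm_sqr x; have := vnorm_ge0 x; nra. Qed.
Lemma coord_le_vnorm x p : Rabs (x p) <= vnorm x.
Proof.
have h := coord_sqr_le x p; rewrite -vnorm_sqr in h; have := vnorm_ge0 x.
by split_Rabs; nra.
Qed.
Lemma dot_sup_le x c : (forall i, Rabs (x i) <= c) -> dot x x <= INR N * (c * c).
Proof.
move=> h; rewrite -[N in INR N]card_ord -sum_const; apply: sum_le => i _.
by have := h i; split_Rabs; nra.
Qed.
Lemma dot_abs_le x y a b : (forall i, Rabs (x i) <= a) -> (forall i, Rabs (y i) <= b) ->
  Rabs (dot x y) <= INR N * (a * b).
Proof.
move=> hx hy; apply: Rle_trans (sum_abs _) _.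
rewrite -[N in INR N]card_ord -sum_const; apply: sum_le => i _.
by rewrite Rabs_mult; apply: Rmult_le_compat; auto using Rabs_pos.
Qed.

Lemma cauchy_schwarz x y : dot x y * dot x y <= dot x x * dot y y.
Proof.
have h t : 0 <= dot x x + 2 * t * dot x y + t * t * dot y y.
  have := dot_ge0 (vadd x (vscale t y)).
  by rewrite !dotDl !dotDr !dotZl !dotZr (dotC y x); lra.
have [y0|y0] := Req_dec (dot y y) 0.
  have [->|d0] := Req_dec (dot x y) 0; first by have := dot_ge0 x; nra.
  have := h (- (dot x x + 1) / (2 * dot x y)); rewrite y0.
  have -> : 2 * (- (dot x x + 1) / (2 * dot x y)) * dot x y = - (dot x x + 1) by field.
  lra.
have yp : 0 < dot y y by have := dot_ge0 y; lra.
have := h (- dot x y / dot y y).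
have -> : dot x x + 2 * (- dot x y / dot y y) * dot x y +
  - dot x y / dot y y * (- dot x y / dot y y) * dot y y =
  (dot x x * dot y y - dot x y * dot x y) / dot y y by field.
move=> h'; have : 0 <= (dot x x * dot y y - dot x y * dot x y) / dot y y * dot y y by nra.
by rewrite /Rdiv Rmult_assoc Rinv_l; lra.
Qed.

Lemma dot_le_vnorm x y : Rabs (dot x y) <= vnorm x * vnorm y.
Proof.
have := cauchy_schwarz x y; rewrite -!vnorm_sqr.
have := vnorm_ge0 x; have := vnorm_ge0 y => a b h.
have : 0 <= vnorm x * vnorm y by nra.
by split_Rabs; nra.
Qed.

Lemma vnormD x y : vnorm (vadd x y) <= vnorm x + vnorm y.
Proof.
apply: vnorm_le; first by have := vnorm_ge0 x; have := vnorm_ge0 y; lra.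
rewrite !dotDl !dotDr -!vnorm_sqr (dotC y x).
have := dot_le_vnorm x y; split_Rabs; lra.
Qed.

Lemma vnormZ a x : vnorm (vscale a x) = Rabs a * vnorm x.
Proof.
rewrite /vnorm dotZl dotZr -Rmult_assoc sqrt_mult_alt; last by nra.
by rewrite -/(Rsqr a) sqrt_Rsqr_abs.
Qed.

Lemma vnorm_subC x y : vnorm (vsub x y) = vnorm (vsub y x).
Proof. by rewrite /vnorm !dotBl !dotBr (dotC x y); f_equal; ring. Qed.

Lemma vnorm_sub_tri x y w : vnorm (vsub x w) <= vnorm (vsub x y) + vnorm (vsub y w).
Proof.
have -> : vsub x w = vadd (vsub x y) (vsub y w) by vext; ring.
exact: vnormD.
Qed.

Lemma vsubxx x : vsub x x = vzero. Proof. by vext; ring. Qed.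
Lemma vnorm0 : vnorm (@vzero N) = 0.
Proof. by rewrite /vnorm dot0l sqrt_0. Qed.
Lemma vsub_addl x y : vsub (vadd x y) x = y. Proof. by vext; ring. Qed.
Lemma vadd_subK x y : vadd x (vsub y x) = y. Proof. by vext; ring. Qed.
Lemma vadd0 x : vadd x vzero = x. Proof. by vext; ring. Qed.

Lemma dot_eq0 x : dot x x = 0 -> x = vzero.
Proof.
move=> h; apply: functional_extensionality => i; rewrite /vzero.
have := coord_sqr_le x i; rewrite h; nra.
Qed.

Lemma mulvDr A x y : mulv A (vadd x y) = vadd (mulv A x) (mulv A y).
Proof. by apply: functional_extensionality => i; rewrite /mulv dotDr. Qed.
Lemma mulvZr A a x : mulv A (vscale a x) = vscale a (mulv A x).
Proof. by apply: functional_extensionality => i; rewrite /mulv dotZr. Qed.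
Lemma mulv_sym A x y : Defs.symmetric A -> dot (mulv A x) y = dot x (mulv A y).
Proof.
move=> h; rewrite /dot /mulv /dot.
have -> : \big[Rplus/0]_(i < N) ((\big[Rplus/0]_(k < N) (A i k * x k)) * y i) =
  \big[Rplus/0]_(i < N) \big[Rplus/0]_(k < N) (A i k * x k * y i).
  apply: eq_bigr => i _; rewrite Rmult_comm -sumZ; apply: eq_bigr => k _; ring.
rewrite exchange_big /=; apply: eq_bigr => i _; rewrite -sumZ; apply: eq_bigr => k _.
by rewrite (h k i); ring.
Qed.
Lemma quadD A x y : Defs.symmetric A ->
  quad A (vadd x y) = quad A x + 2 * dot (mulv A x) y + quad A y.
Proof.
move=> h; rewrite /quad mulvDr !dotDl !dotDr (mulv_sym y x h) (dotC y); ring.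
Qed.
Lemma quadZ A a x : quad A (vscale a x) = a * a * quad A x.
Proof. by rewrite /quad mulvZr dotZl dotZr; ring. Qed.
Lemma quad0 A : quad A vzero = 0.
Proof. by rewrite /quad dot0r. Qed.
End Dot.

(** General enough for every explicit Hessian below: isotropic perturbations of a given matrix, and
    rank-one corrections along a chord. *)
Definition mcomb {N} (a : R) (A : mat N) (b c : R) (w : vec N) : mat N :=
  fun i k => a * A i k + b * (if i == k then 1 else 0) + c * (w i * w k).

Lemma mcomb_sym {N} a (A : mat N) b c w : Defs.symmetric A -> Defs.symmetric (mcomb a A b c w).
Proof. by move=> h i k; rewrite /mcomb h eq_sym; ring. Qed.

Lemma quad_mcomb {N} a (A : mat N) b c w x :
  quad (mcomb a A b c w) x = a * quad A x + b * dot x x + c * (dot w x * dot w x).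
Proof.
rewrite /quad.
have -> : mulv (mcomb a A b c w) x =
  vadd (vadd (vscale a (mulv A x)) (vscale b x)) (vscale (c * dot w x) w).
  apply: functional_extensionality => i; rewrite /mulv /vadd /vscale.
  have -> : mcomb a A b c w i = vadd (vadd (vscale a (A i)) (vscale b (unitv i))) (vscale (c * w i) w).
    by apply: functional_extensionality => k; rewrite /mcomb /vadd /vscale /unitv (eq_sym k); ring.
  by rewrite !dotDl !dotZl dot_unitl; ring.
by rewrite !dotDl !dotZl; ring.
Qed.

Definition mzero {N} : mat N := fun _ _ => 0.
Lemma mzero_sym {N} : Defs.symmetric (@mzero N). Proof. by []. Qed.
Lemma quad_mzero {N} (x : vec N) : quad mzero x = 0.
Proof.
rewrite /quad; have -> : mulv mzero x = vzero; last exact: dot0l.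
by apply: functional_extensionality => i; exact: (dot0l x).
Qed.

(** * Compactness *)

Lemma inv_INR_lt e : 0 < e -> exists n0 : nat, forall n, (n0 <= n)%N -> / INR n.+1 < e.
Proof.
move=> e0; have [n0 h] := INR_unbounded (/ e); exists n0 => n /leP/le_INR hn.
rewrite -(Rinv_inv e); apply: Rinv_lt_contravar; last by rewrite S_INR; lra.
by have := Rinv_0_lt_compat _ e0; rewrite S_INR => h1; apply: Rmult_lt_0_compat; have := pos_INR n; lra.
Qed.

Definition incr (s : nat -> nat) := forall n, (s n < s n.+1)%N.

Lemma incr_ge s n : incr s -> (n <= s n)%N.
Proof. by move=> h; elim: n => // n /leq_ltn_trans; apply. Qed.

Lemma incr_lt s a b : incr s -> (a < b)%N -> (s a < s b)%N.
Proof.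
move=> h; elim: b => // b IH; rewrite ltnS leq_eqVlt => /orP[/eqP->//|/IH h'].
exact: ltn_trans h' (h b).
Qed.

Lemma incr_comp s r : incr s -> incr r -> incr (s \o r).
Proof. by move=> hs hr n /=; apply: incr_lt. Qed.

Lemma bounded_subseq (x : nat -> R) M : (forall n, Rabs (x n) <= M) ->
  exists s l, incr s /\ forall e, 0 < e -> exists n0, forall n, (n0 <= n)%N -> Rabs (x (s n) - l) < e.
Proof.
move=> hM; have [l hl] := @Bolzano_Weierstrass x (fun c => - M <= c <= M) (compact_P3 (- M) M)
  (fun n => ltac:(have := hM n; split_Rabs; lra)).
have step (k n : nat) : {p : nat | (k < p)%N /\ Rabs (x p - l) < / INR n.+1}.
  apply: constructive_indefinite_description.
  have pos : 0 < / INR n.+1 by apply: Rinv_0_lt_compat; apply: lt_0_INR; apply/ltP.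
  have [p [/leP hp1 hp2]] := hl (disc l (mkposreal _ pos)) k.+1
    (ex_intro _ (mkposreal _ pos) (fun _ h => h)).
  by exists p.
pose s := fix s n := match n with 0%N => sval (step 0%N 0%N) | n.+1 => sval (step (s n) n.+1) end.
exists s, l; split; first by move=> n /=; case: (step _ _) => p [].
have hs n : Rabs (x (s n) - l) < / INR n.+1 by case: n => [|n] /=; case: (step _ _) => p [].
move=> e /inv_INR_lt [n0 h]; exists n0 => n /h h'; exact: Rlt_trans (hs n) h'.
Qed.

Definition vlim {N} (x : nat -> vec N) (l : vec N) :=
  forall e, 0 < e -> exists n0, forall n, (n0 <= n)%N -> vnorm (vsub (x n) l) < e.

Lemma bounded_subseq_vec N (x : nat -> vec N) M : (forall n, vnorm (x n) <= M) ->
  exists s l, incr s /\ vlim (x \o s) l.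
Proof.
move=> hM.
have H (r : seq 'I_N) : exists s l, incr s /\ forall i, i \in r -> forall e, 0 < e ->
    exists n0, forall n, (n0 <= n)%N -> Rabs (x (s n) i - l i) < e.
  elim: r => [|i r [s [l [hs hl]]]]; first by exists id, vzero; split.
  have [s' [c [hs' hc]]] := @bounded_subseq (fun n => x (s n) i) M
     (fun n => Rle_trans _ _ _ (coord_le_vnorm _ _) (hM _)).
  exists (s \o s'), (fun k => if k == i then c else l k); split; first exact: incr_comp.
  move=> k; rewrite inE; case: eqP => [-> _ e /hc //|_ /= /hl h e /h [n0 hn0]].
  exists n0 => n hn; apply: hn0; exact: leq_trans hn (incr_ge _ hs').
have [s [l [hs hl]]] := H (enum 'I_N); exists s, l; split=> // e e0.
have d0 : 0 < e / (INR N + 1) by apply: Rdiv_lt_0_compat; have := pos_INR N; lra.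
have [n0 hn0] : exists n0, forall i, i \in enum 'I_N -> forall n, (n0 <= n)%N ->
    Rabs (x (s n) i - l i) < e / (INR N + 1).
  elim: (enum 'I_N) (hl) => [|i r IH] h; first by exists 0%N.
  have [n1 h1] := IH (fun k hk => h k (mem_behead (s := i :: r) hk)).
  have [n2 h2] := h i (mem_head _ _) _ d0.
  exists (maxn n1 n2) => k; rewrite inE => /orP[/eqP ->|hk] n; rewrite geq_max => /andP[a b]; auto.
exists n0 => n hn; apply: vnorm_lt => //.
apply: Rle_lt_trans (dot_sup_le (c := e / (INR N + 1)) _) _.
  by move=> i; apply: Rlt_le; apply: hn0 => //; rewrite mem_enum.
have N0 := pos_INR N.
have E : e / (INR N + 1) * (INR N + 1) = e by field; lra.
nra.
Qed.

Section Extreme.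
Variables (T : Type) (S : T -> Prop) (conv : (nat -> T) -> T -> Prop).
Hypothesis compactS : forall x : nat -> T, (forall n, S (x n)) ->
  exists s l, incr s /\ S l /\ conv (x \o s) l.

(** Stated over an abstract sequentially compact set with its own notion of convergence, to serve
    both closed bounded sets of vectors and the space-time cylinder. *)
Lemma usc_max (f : T -> R) : (exists x, S x) ->
  (forall x l, (forall n, S (x n)) -> S l -> conv x l -> forall e, 0 < e ->
     exists n0, forall n, (n0 <= n)%N -> f (x n) < f l + e) ->
  exists l, S l /\ forall x, S x -> f x <= f l.
Proof.
move=> [x0 hx0] hf.
have hb : bound (fun r => exists x, S x /\ r = f x).
  apply: NNPP => nb.
  have H n : exists x, S x /\ INR n < f x.
    apply: NNPP => h; apply: nb; exists (INR n) => r [x [hx ->]].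
    by apply: Rnot_lt_le => h'; apply: h; exists x.
  have [s [l [hs [hl hc]]]] := compactS (fun n => proj1 (proj2_sig (constructive_indefinite_description _ (H n)))).
  have [n0 hn] := hf _ _ (fun n => proj1 (proj2_sig (constructive_indefinite_description _ (H (s n))))) hl hc 1 Rlt_0_1.
  have [n1 h1] := INR_unbounded (f l + 1).
  have := hn _ (leq_maxl n0 n1) => /=; case: (constructive_indefinite_description _ _) => x /= [_ hx].
  have := le_INR _ _ (leP (leq_trans (leq_maxr n0 n1) (incr_ge _ hs))); lra.
have [M [hM1 hM2]] := completeness _ hb (ex_intro _ _ (ex_intro _ _ (conj hx0 erefl))).
have H (n : nat) : exists x, S x /\ M - / INR n.+1 < f x.
  have p : 0 < / INR n.+1 by apply: Rinv_0_lt_compat; apply: lt_0_INR; apply/ltP.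
  apply: NNPP => h; have : M <= M - / INR n.+1; last lra.
  apply: hM2 => r [x [hx ->]]; apply: Rnot_lt_le => h'; apply: h; by exists x.
have [s [l [hs [hl hc]]]] := compactS (fun n => proj1 (proj2_sig (constructive_indefinite_description _ (H n)))).
exists l; split=> // x hx; apply: le_epsilon => e e0.
have e2 : 0 < e / 2 by lra.
have [n0 hn] := hf _ _ (fun n => proj1 (proj2_sig (constructive_indefinite_description _ (H (s n))))) hl hc _ e2.
have [n1 h1] := inv_INR_lt e2.
have := hn _ (leq_maxl n0 n1); rewrite /comp.
case: (constructive_indefinite_description _ _) => y; rewrite /proj1_sig => -[_ hy].
have := h1 _ (leq_trans (leq_maxr n0 n1) (incr_ge _ hs)).
have := hM1 (f x) (ex_intro _ _ (conj hx erefl)); lra.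
Qed.
End Extreme.

Definition vclosed {N} (S : vec N -> Prop) := forall x l, (forall n, S (x n)) -> vlim x l -> S l.

Lemma compact_vec N (S : vec N -> Prop) M : vclosed S -> (forall x, S x -> vnorm x <= M) ->
  forall x : nat -> vec N, (forall n, S (x n)) -> exists s l, incr s /\ S l /\ vlim (x \o s) l.
Proof.
move=> hc hb x hx; have [s [l [hs hl]]] := bounded_subseq_vec (fun n => hb _ (hx n)).
exists s, l; split=> //; split=> //; exact: (hc _ _ (fun n => hx (s n)) hl).
Qed.

Lemma cont_max N (S : vec N -> Prop) M f : vclosed S -> (forall x, S x -> vnorm x <= M) ->
  (exists x, S x) -> cont_on S f -> exists l, S l /\ forall x, S x -> f x <= f l.
Proof.
move=> hc hb h0 hf; apply: (usc_max (compact_vec hc hb)) => // x l hx hl hlim e e0.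
have [d [d0 hd]] := hf l hl e e0; have [n0 hn0] := hlim d d0.
by exists n0 => n /hn0 /(hd _ (hx n)) /Rabs_def2 [h _]; lra.
Qed.

Lemma vclosed_vclos N (O : vec N -> Prop) : vclosed (vclos O).
Proof.
move=> x l hx hl e e0; have e2 : 0 < e / 2 by lra.
have [n0 /(_ n0 (leqnn _)) h0] := hl _ e2; have [y [hy hyx]] := hx n0 _ e2.
by exists y; split=> //; have := vnorm_sub_tri y (x n0) l; lra.
Qed.

Lemma vclos_self N (O : vec N -> Prop) x : O x -> vclos O x.
Proof. by move=> h e e0; exists x; split=> //; rewrite vsubxx vnorm0. Qed.

Lemma vclos_bound N (O : vec N -> Prop) M : (forall x, O x -> vnorm x <= M) ->
  forall x, vclos O x -> vnorm x <= M.
Proof.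
move=> h x hx; apply: le_epsilon => e e0; have [y [hy hyx]] := hx e e0.
have := vnormD y (vsub x y); rewrite vadd_subK; have := h y hy; rewrite vnorm_subC in hyx; lra.
Qed.

(** * Second differences and the energy bound *)

Definition mean (I : finType) (F : I -> R) : R := / INR #|I| * \big[Rplus/0]_(i : I) F i.

Section Mean.
Variable I : finType.
Hypothesis I0 : (0 < #|I|)%N.
Implicit Types F G : I -> R.

Lemma cardR_gt0 : 0 < INR #|I|.
Proof. by apply: lt_0_INR; apply/ltP. Qed.

Lemma mean_const c : mean (fun _ : I => c) = c.
Proof. by rewrite /mean sum_const; field; have := cardR_gt0; lra. Qed.
Lemma meanD F G : mean (fun i => F i + G i) = mean F + mean G.
Proof. by rewrite /mean sumD; ring. Qed.
Lemma meanZ c F : mean (fun i => c * F i) = c * mean F.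
Proof. by rewrite /mean sumZ; ring. Qed.
Lemma mean_le F G : (forall i, F i <= G i) -> mean F <= mean G.
Proof.
move=> h; apply: Rmult_le_compat_l; last exact: sum_le.
by apply: Rlt_le; apply: Rinv_0_lt_compat; exact: cardR_gt0.
Qed.
Lemma mean_ext F G : F =1 G -> mean F = mean G.
Proof. by move=> h; congr (_ * _); apply: eq_bigr => i _; apply: h. Qed.
Lemma mean_abs F c : (forall i, Rabs (F i) <= c) -> Rabs (mean F) <= c.
Proof.
move=> h; apply: Rabs_le; rewrite -{1}(mean_const (- c)) -{2}(mean_const c).
by split; apply: mean_le => i; have := h i; split_Rabs; lra.
Qed.

(** Jensen's inequality for [1/x] with its defect in closed form: a weighted variance, from
    [(F - B)^2 / (F B^2) = 1/F + F/B^2 - 2/B]. A small defect therefore forces the values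
    together. *)
Lemma inv_mean_gap F : (forall i, 1 <= F i) ->
  mean (fun i => / F i) - / mean F =
  mean (fun i => (F i - mean F) * (F i - mean F) / (F i * (mean F * mean F))).
Proof.
move=> h; set B := mean F.
have B1 : 1 <= B by rewrite -(mean_const 1); apply: mean_le.
have -> : mean (fun i => (F i - B) * (F i - B) / (F i * (B * B))) =
   mean (fun i => / F i + (/ (B * B) * F i + - (2 / B))).
  by apply: mean_ext => i; field; have := h i; lra.
by rewrite !meanD meanZ mean_const -/B; field; lra.
Qed.

Lemma inv_mean_gap_ge0 F : (forall i, 1 <= F i) -> 0 <= mean (fun i => / F i) - / mean F.
Proof.
move=> h; rewrite (inv_mean_gap h) -(mean_const 0); apply: mean_le => i.
have B1 : 1 <= mean F by rewrite -(mean_const 1); apply: mean_le.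
cbv beta; rewrite /Rdiv; apply: Rmult_le_pos; first exact: Rle_0_sqr.
apply: Rlt_le; apply: Rinv_0_lt_compat.
by have := h i => hi; apply: Rmult_lt_0_compat; nra.
Qed.

(** One term of the variance is at most [#|I| * g], so [(F i - B)^2 <= #|I| g F i B^2], where [B] is
    the mean. The smallness of [g] excludes [F i > 2 B], as the left side would then be at least
    [(F i)^2 / 4] and the right side at most [F i B / 2]. Once [F i <= 2 B], the right side is cubic
    in [Bm]. *)
Lemma gap_small_close F g Bm i : (forall i, 1 <= F i) -> mean F <= Bm ->
  mean (fun i => / F i) - / mean F <= g -> 2 * (INR #|I| * g) * Bm < 1 ->
  (F i - mean F) * (F i - mean F) <= 2 * (INR #|I| * g) * (Bm * (Bm * Bm)).
Proof.
move=> h hB hg hs; have g0' := inv_mean_gap_ge0 h; rewrite (inv_mean_gap h) in hg g0'.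
set B := mean F in hg hB g0' *.
have B1 : 1 <= B by rewrite -(mean_const 1); apply: mean_le.
set G := (fun i => (F i - B) * (F i - B) / (F i * (B * B))) in hg g0'.
have c0 := cardR_gt0; have g0 : 0 <= g by lra.
have pos k : 0 < F k * (B * B) by have := h k => hk; apply: Rmult_lt_0_compat; nra.
have G0 k : 0 <= G k.
  by rewrite /G /Rdiv; apply: Rmult_le_pos; [exact: Rle_0_sqr|apply: Rlt_le; apply: Rinv_0_lt_compat].
have hG : G i <= INR #|I| * g.
  have E : INR #|I| * mean G = \big[Rplus/0]_k G k by rewrite /mean; field; lra.
  by apply: Rle_trans (term_le_sum i G0) _; rewrite -E; nra.
set c := INR #|I| * g in hG hs *.
have hd : (F i - B) * (F i - B) <= c * (F i * (B * B)).
  have -> : (F i - B) * (F i - B) = G i * (F i * (B * B)).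
    by rewrite /G; field; have := h i; lra.
  by apply: Rmult_le_compat_r => //; apply: Rlt_le.
have cp : 0 <= c by rewrite /c; nra.
have cB : 2 * c * B < 1 by nra.
have F2 : F i <= 2 * B.
  apply: Rnot_lt_le => hlt.
  have h1 : F i * F i / 4 <= (F i - B) * (F i - B) by nra.
  have h2 : c * (F i * (B * B)) <= F i * B / 2.
    have -> : c * (F i * (B * B)) = (2 * c * B) * (F i * B) / 2 by field.
    have : 0 < F i * B by nra.
    nra.
  by nra.
apply: Rle_trans hd _.
have h3 : F i * (B * B) <= 2 * (Bm * (Bm * Bm)).
  have h4 : B * B <= Bm * Bm by nra.
  have -> : 2 * (Bm * (Bm * Bm)) = (2 * Bm) * (Bm * Bm) by ring.
  by apply: Rmult_le_compat => //; [have := h i; lra | nra | lra].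
by nra.
Qed.
End Mean.

(** * Loss of reciprocal energy from one scale to the next *)

Section Energy.
Variables (N : nat) (V I T : finType) (b : V -> nat -> ('I_N -> nat) -> R)
  (sh : V -> nat -> I -> 'I_N -> nat) (L : nat -> nat) (J : nat)
  (h : forall n, T -> {ffun 'I_N -> 'I_(L n.+1)}) (g : R).
Let pt n (x : {ffun 'I_N -> 'I_(L n)}) : 'I_N -> nat := fun q => x q.
Let shift v n (x : 'I_N -> nat) i : 'I_N -> nat := fun q => (x q + sh v n i q)%N.
Hypothesis I0 : (0 < #|I|)%N.
Hypothesis b1 : forall v n x, 1 <= b v n x.
Hypothesis bS : forall v n x, b v n.+1 x = mean (fun i => b v n (shift v n x i)).
Hypothesis LS : forall v n i q, (n < J)%N -> (L n.+1 + sh v n i q <= L n)%N.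
Hypothesis hinj : forall n, (n < J)%N -> injective (@h n).
Hypothesis hgap : forall n t, (n < J)%N -> exists v,
  g <= mean (fun i => / b v n (shift v n (pt (h n t)) i)) - / b v n.+1 (pt (h n t)).

Let Ev v n := \big[Rplus/0]_(x : {ffun 'I_N -> 'I_(L n)}) / b v n (pt x).
Let gap v n (x : {ffun 'I_N -> 'I_(L n.+1)}) :=
  mean (fun i => / b v n (shift v n (pt x) i)) - / b v n.+1 (pt x).

Let invb_ge0 v n x : 0 <= / b v n x.
Proof. by apply: Rlt_le; apply: Rinv_0_lt_compat; have := b1 v n x; lra. Qed.

Let gap_ge0 v n x : 0 <= @gap v n x.
Proof. by rewrite /gap bS; apply: inv_mean_gap_ge0 => // i; apply: b1. Qed.

(** For a fixed shift [i], translation embeds the grid of side [L n.+1] into the one of side [L n],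
    so the translated sum is at most the full sum; averaging over [i] keeps the bound. [LS] is the
    margin that keeps translated points inside. *)
Let Ev_step v n : (n < J)%N -> Ev v n.+1 + \big[Rplus/0]_(x : {ffun 'I_N -> 'I_(L n.+1)}) gap v x <= Ev v n.
Proof.
move=> nJ; rewrite -sumD.
have -> : \big[Rplus/0]_(x : {ffun 'I_N -> 'I_(L n.+1)}) (/ b v n.+1 (pt x) + gap v x) =
  mean (fun i => \big[Rplus/0]_(x : {ffun 'I_N -> 'I_(L n.+1)}) / b v n (shift v n (pt x) i)).
  rewrite /mean exchange_big /= -sumZ; apply: eq_bigr => x _.
  rewrite /gap /mean. exact: Rplus_minus.
rewrite -[X in _ <= X](mean_const I0); apply: mean_le => // i.
have lt q (x : {ffun 'I_N -> 'I_(L n.+1)}) : (x q + sh v n i q < L n)%N.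
  by apply: leq_trans (LS v i q nJ); rewrite ltn_add2r.
pose k (x : {ffun 'I_N -> 'I_(L n.+1)}) : {ffun 'I_N -> 'I_(L n)} := [ffun q => Ordinal (lt q x)].
have kinj : injective k.
  move=> x y /ffunP e; apply/ffunP => q; apply: val_inj.
  by have /(congr1 val) := e q; rewrite !ffunE /= => /addIn.
have -> : \big[Rplus/0]_(x : {ffun 'I_N -> 'I_(L n.+1)}) / b v n (shift v n (pt x) i) =
  \big[Rplus/0]_(x : {ffun 'I_N -> 'I_(L n.+1)}) / b v n (pt (k x)).
  apply: eq_bigr => x _; congr (/ b v n _).
  by apply: functional_extensionality => q; rewrite /pt /shift ffunE.
exact: (sum_inj_le kinj (fun x => invb_ge0 v n (pt x))).
Qed.

(** [V] indexes directions and [T] contact points. Each of the [J] steps loses at least [g] per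
    contact point, because [h n] puts them at distinct grid points and all other gaps are
    nonnegative; the initial energy is at most one per direction and grid point. *)
Lemma energy_bound : INR J * (g * INR #|T|) <= INR #|V| * INR (L 0%N ^ N)%N.
Proof.
pose E n := \big[Rplus/0]_(v : V) Ev v n.
have E0 n : 0 <= E n by apply: sum_ge0 => v _; apply: sum_ge0 => x _; apply: invb_ge0.
have ES n : (n < J)%N -> E n.+1 + g * INR #|T| <= E n.
  move=> nJ; apply: Rle_trans (_ : E n.+1 + \big[Rplus/0]_(v : V) \big[Rplus/0]_(x : {ffun 'I_N -> 'I_(L n.+1)}) gap v x <= _); last first.
    by rewrite /E -sumD; apply: sum_le => v _; apply: Ev_step.
  apply: Rplus_le_compat_l; rewrite exchange_big /=.
  apply: Rle_trans (_ : _ <= \big[Rplus/0]_(t : T) \big[Rplus/0]_(v : V) gap v (h n t)) _; last first.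
    apply: (sum_inj_le (hinj nJ) (G := fun x => \big[Rplus/0]_(v : V) gap v x)) => x.
    by apply: sum_ge0 => v _; apply: gap_ge0.
  rewrite Rmult_comm -sum_const; apply: sum_le => t _.
  have [v hv] := hgap t nJ.
  by apply: Rle_trans hv _; apply: (term_le_sum (F := fun v => gap v (h n t))) => v'; apply: gap_ge0.
have H n : (n <= J)%N -> E n + INR n * (g * INR #|T|) <= E 0%N.
  elim: n => [|n IH] hn; first by rewrite /=; lra.
  by have := IH (ltnW hn); have := ES n hn; rewrite S_INR; lra.
have := H J (leqnn _); have := E0 J.
have : E 0%N <= INR #|V| * INR (L 0%N ^ N)%N; last lra.
rewrite -sum_const; apply: sum_le => v _.
have -> : INR (L 0%N ^ N)%N = \big[Rplus/0]_(x : {ffun 'I_N -> 'I_(L 0%N)}) 1.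
  by rewrite sum_const card_ffun !card_ord; ring.
apply: sum_le => x _; rewrite -Rinv_1; apply: Rinv_le_contravar; [lra|exact: b1].
Qed.
End Energy.

(** * Discrete Taylor expansion *)

Definition nvec {N} (i : 'I_N -> nat) : vec N := fun k => INR (i k).
Definition incv {N} (p : 'I_N) (i : 'I_N -> nat) : 'I_N -> nat := fun k => (i k + (k == p))%N.
(** Stands for [e_p + e_q], except that [p = q] gives [e_p] and not [2 e_p]. A quadratic form is
    determined by its values on these directions. *)
Definition dirn {N} (p q : 'I_N) : 'I_N -> nat := fun k => ((k == p) || (k == q) : nat).

Lemma nvec_incv N (p : 'I_N) i : nvec (incv p i) = vadd (nvec i) (unitv p).
Proof.
apply: functional_extensionality => k; rewrite /nvec /incv /vadd /unitv plus_INR.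
by case: (k == p).
Qed.

Lemma sum_incv N (p : 'I_N) i : (\sum_k incv p i k = (\sum_k i k).+1)%N.
Proof.
rewrite /incv big_split /= [X in (_ + X)%N](bigD1 p) //= eqxx
  [X in (_ + (_ + X))%N]big1; first by rewrite addn0 addn1.
by move=> k /negbTE ->.
Qed.

(** Induction on the coordinate sum: a coordinate above 1 can be lowered without leaving the box.
    The walk starts at the corner with all coordinates 1, not 0, because the mixed differences it
    serves step back once from the current point. *)
Lemma box_ind N (P : ('I_N -> nat) -> Prop) (M : nat) : P (fun=> 1%N) ->
  (forall i p, (forall k, (1 <= i k)%N /\ (incv p i k <= M)%N) -> P i -> P (incv p i)) ->
  forall i, (forall k, (1 <= i k <= M)%N) -> P i.
Proof.
move=> h1 hS i hi.
have [n hn] : exists n, (\sum_k i k <= n)%N by exists (\sum_k i k)%N.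
elim: n i hi hn => [|n IH] i hi hn.
  suff -> : i = fun=> 1%N by [].
  apply: functional_extensionality => k; have := hi k.
  by move: hn; rewrite (bigD1 k) //=; lia.
have [h|] := boolP [forall k, i k == 1%N].
  suff -> : i = fun=> 1%N by [].
  by apply: functional_extensionality => k; apply/eqP; move/forallP: h; apply.
rewrite negb_forall => /existsP [p hp].
pose i' k := (i k - (k == p))%N.
have Ei : i = incv p i'.
  apply: functional_extensionality => k; rewrite /incv /i'; have := hi k.
  by case: eqP => //= _; lia.
have hi' k : (1 <= i' k <= M)%N.
  by rewrite /i'; have := hi k; case: eqP => [->|_] /=; move: (hi p) hp; lia.
rewrite Ei; apply: hS => [k|]; first by rewrite -Ei; move: (hi' k) (hi k); lia.
apply: IH => //; move: hn; rewrite (bigD1 p) //= [X in _ -> (X <= _)%N](bigD1 p) //=.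
have -> : (\sum_(k < N | k != p) i' k = \sum_(k < N | k != p) i k)%N.
  by apply: eq_bigr => k /negbTE e; rewrite /i' e subn0.
rewrite {1}/i' eqxx /=; have := hi p; move: hp.
by set t := (\sum_(_ < _ | _) _)%N; lia.
Qed.

Section DiscreteTaylor.
Variables (N M : nat) (H : ('I_N -> nat) -> R) (al : mat N) (e a del : R).
Hypothesis al_sym : Defs.symmetric al.
Hypothesis al_bound : forall p q, Rabs (al p q) <= a.
Hypothesis second_diff : forall p q i, (forall k, (i k + 2 <= M)%N) ->
  Rabs (H i - 2 * H (fun k => i k + dirn p q k)%N
        + H (fun k => i k + 2 * dirn p q k)%N - al p q) <= e.
Hypothesis first_diff : forall p, Rabs (H (incv p (fun=> 1%N)) - H (fun=> 1%N)) <= del.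
Hypothesis e0 : 0 <= e.

(** Polarization: [al p q] plays the value of the quadratic form at [dirn p q], and its matrix is
    recovered from these values. *)
Definition polar_mx : mat N :=
  fun p q => if p == q then al p p else / 2 * (al p q - al p p - al q q).

Lemma polar_mx_sym : Defs.symmetric polar_mx.
Proof.
move=> p q; rewrite /polar_mx eq_sym; case: eqP => [->//|_].
by rewrite al_sym; ring.
Qed.

Lemma polar_mx_bound p q : Rabs (polar_mx p q) <= 2 * a.
Proof using al_bound.
clear second_diff first_diff e0.
rewrite /polar_mx; case: eqP => _; have := al_bound p p; have := al_bound p q;
  have := al_bound q q; split_Rabs; lra.
Qed.

Let D p (G : ('I_N -> nat) -> R) i := G (incv p i) - G i.

(** For [p != q] and [i = i' + e_q], twice the mixed difference at [i] is the second difference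
    along [e_p + e_q] at [i'], minus the one along [e_q] at [i'], minus the one along [e_p] at
    [i' + 2 e_q]. Each carries an error [e]. *)
Lemma mixed_diff p q i : (forall k, (1 <= i k)%N /\ (i k + 4 <= M)%N) ->
  Rabs (D q (D p H) i - polar_mx p q) <= 2 * e.
Proof.
move=> hi; rewrite /D /polar_mx; case: eqP => [<-|npq].
  have := @second_diff p p i (fun k => ltac:(have := hi k; lia)).
  have -> : (fun k => i k + dirn p p k)%N = incv p i.
    by apply: functional_extensionality => k; rewrite /dirn orbb.
  have -> : (fun k => i k + 2 * dirn p p k)%N = incv p (incv p i).
    by apply: functional_extensionality => k; rewrite /dirn /incv orbb; lia.
  by split_Rabs; lra.
have /negbTE npq1 : p != q by apply/eqP.
pose i' k := (i k - (k == q))%N.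
have Ei : i = incv q i'.
  apply: functional_extensionality => k; rewrite /incv /i'; have := hi k.
  by case: (k == q); lia.
have b0 : forall k, (i' k + 2 <= M)%N by move=> k; rewrite /i'; have := hi k; lia.
have b2 : forall k, (incv q (incv q i') k + 2 <= M)%N.
  by move=> k; rewrite -Ei /incv; have := hi k; case: (k == q); lia.
have := @second_diff p q i' b0; have := @second_diff q q i' b0; have := second_diff p p b2.
have -> : (fun k => incv q (incv q i') k + dirn p p k)%N = incv p (incv q i).
  by apply: functional_extensionality => k; rewrite /dirn orbb -Ei.
have -> : (fun k => incv q (incv q i') k + 2 * dirn p p k)%N =
    (fun k => i' k + 2 * dirn p q k)%N.
  apply: functional_extensionality => k; rewrite /dirn orbb /incv.
  by case: (k =P p) => [->|_]; [rewrite npq1 /=; lia|case: (k =P q) => _ /=; lia].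
have -> : (fun k => i' k + dirn q q k)%N = i.
  by rewrite Ei; apply: functional_extensionality => k; rewrite /dirn orbb.
have -> : (fun k => i' k + 2 * dirn q q k)%N = incv q (incv q i').
  by apply: functional_extensionality => k; rewrite /dirn orbb /incv; lia.
have -> : (fun k => i' k + dirn p q k)%N = incv p i.
  rewrite Ei; apply: functional_extensionality => k; rewrite /dirn /incv.
  by case: (k =P p) => [->|_]; [rewrite npq1 /=; lia|case: (k =P q) => _ /=; lia].
rewrite -Ei.
by split_Rabs; lra.
Qed.

Let one : 'I_N -> nat := fun=> 1%N.
(** Fitted so that the polynomial and [H] have the same first differences at the corner; [c0] then
    matches the value there. *)
Let dlin : vec N := fun p => D p H one - mulv polar_mx (nvec one) p - / 2 * polar_mx p p.
Let pol (w : vec N) := dot dlin w + / 2 * quad polar_mx w.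
Let c0 := H one - pol (nvec one).

Let pol_incv p i : pol (nvec (incv p i)) - pol (nvec i) =
  dlin p + mulv polar_mx (nvec i) p + / 2 * polar_mx p p.
Proof.
rewrite /pol nvec_incv quadD; last exact: polar_mx_sym.
by rewrite dotDr !dot_unitr /quad dot_unitr /mulv dot_unitr; field.
Qed.

(** Two walks from the corner: errors [2 e] in the mixed differences add up to [2 e] times the
    coordinate sum in the first differences, and then to [2 e] times its square in the values. *)
Lemma discrete_taylor : exists (c : R) (d : vec N),
  (forall p, Rabs (d p) <= del + INR N * (2 * a) + a) /\
  forall i, (forall k, (1 <= i k)%N /\ (i k + 4 <= M)%N) ->
    Rabs (H i - (c + dot d (nvec i) + / 2 * quad polar_mx (nvec i))) <=
    2 * e * (INR (\sum_k i k) * INR (\sum_k i k)).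
Proof.
exists c0, dlin; split=> [p|i hi].
  have h1 : Rabs (mulv polar_mx (nvec one) p) <= INR N * (2 * a * 1).
    apply: dot_abs_le => k; first exact: polar_mx_bound.
    by rewrite /nvec /= Rabs_R1; lra.
  have h2 := polar_mx_bound p p; have h3 := first_diff p.
  by rewrite /dlin /D; move: h1 h2 h3; rewrite -/one; split_Rabs; lra.
have -> : c0 + dot dlin (nvec i) + / 2 * quad polar_mx (nvec i) = c0 + pol (nvec i).
  by rewrite /pol; ring.
have step1 p : forall j, (forall k, (1 <= j k <= M - 4)%N) ->
    Rabs (D p H j - (dlin p + mulv polar_mx (nvec j) p + / 2 * polar_mx p p)) <=
    2 * e * INR (\sum_k j k).
  apply: box_ind => [|j q hj IH].
    have -> : D p H one - (dlin p + mulv polar_mx (nvec one) p + / 2 * polar_mx p p) = 0.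
      by rewrite /dlin; ring.
    by rewrite Rabs_R0; apply: Rmult_le_pos; [lra|exact: pos_INR].
  have hj' k : (1 <= j k)%N /\ (j k + 4 <= M)%N by have := hj k; rewrite /incv; lia.
  have := mixed_diff p q hj'; rewrite {1}/D sum_incv S_INR.
  have -> : mulv polar_mx (nvec (incv q j)) p = mulv polar_mx (nvec j) p + polar_mx p q.
    by rewrite nvec_incv /mulv dotDr dot_unitr.
  by move: IH; split_Rabs; lra.
have step2 : forall j, (forall k, (1 <= j k <= M - 4)%N) ->
    Rabs (H j - (c0 + pol (nvec j))) <= 2 * e * (INR (\sum_k j k) * INR (\sum_k j k)).
  apply: box_ind => [|j p hj IH].
    have -> : H (fun=> 1%N) - (c0 + pol (nvec (fun=> 1%N))) = 0 by rewrite /c0 /one; ring.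
    by rewrite Rabs_R0; apply: Rmult_le_pos; [lra|apply: Rmult_le_pos; exact: pos_INR].
  have hj' k : (1 <= j k <= M - 4)%N by have := hj k; rewrite /incv; lia.
  have := step1 p j hj'; have := pol_incv p j; rewrite {1}/D sum_incv S_INR.
  have := pos_INR (\sum_k j k); move: IH; set S := INR _ => IH S0 h1 h2.
  have : 2 * e * (S * S) + 2 * e * S <= 2 * e * ((S + 1) * (S + 1)) by nra.
  by move: IH h1 h2; split_Rabs; lra.
by apply: step2 => k; have := hi k; lia.
Qed.
End DiscreteTaylor.

(** * Averages of semiconvex functions *)

(** Equivalent to convexity of [f + Lam / 2 |x|^2]; the form by supporting parabolas is the one that
    sup-convolutions deliver directly. *)
Definition semiconvex {N} (Lam : R) (f : vec N -> R) : Prop :=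
  forall x, exists p, forall h, f x + dot p h - Lam / 2 * dot h h <= f (vadd x h).

(** Based at an end of the segment and not at its midpoint, which keeps all grid offsets
    nonnegative. *)
Definition sdiff {N} (w : vec N) (F : vec N -> R) (x : vec N) : R :=
  F x - 2 * F (vadd x w) + F (vadd x (vscale 2 w)).

Definition avg_of {N} (s : R) (k K : vec N -> R) : Prop :=
  exists (I : finType) (t : I -> vec N), (0 < #|I|)%N /\
    (forall i q, 0 <= t i q <= s) /\ forall x, K x = mean (fun i => k (vadd x (t i))).

Definition box_avg {N} (m : nat) (s : R) (K : vec N -> R) (x : vec N) : R :=
  mean (fun i : {ffun 'I_N -> 'I_m} => K (vadd x (vscale s (nvec (fun q => i q))))).

(** By base-[m] digits this is the average of [k] over a uniform grid of mesh [s] with [m ^ n]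
    points per side; the recursive form makes the passage to the next scale a single average. *)
Fixpoint iter_avg {N} (m : nat) (s : R) (k : vec N -> R) (n : nat) : vec N -> R :=
  match n with
  | 0%N => k
  | n'.+1 => box_avg m (INR (m ^ n') * s) (iter_avg m s k n')
  end.

Lemma mean_pair (I J : finType) (F : I -> J -> R) :
  mean (fun i => mean (fun j => F i j)) = mean (fun p : I * J => F p.1 p.2).
Proof.
by rewrite /mean sumZ pair_bigA /= card_prod mult_INR Rinv_mult Rmult_assoc.
Qed.

Lemma card_ffun_gt0 N m : (0 < m)%N -> (0 < #|{ffun 'I_N -> 'I_m}|)%N.
Proof. by move=> m0; rewrite card_ffun !card_ord expn_gt0 m0. Qed.

Lemma avg_of_box N m s (k K : vec N -> R) : (0 < m)%N -> 0 <= s ->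
  avg_of s k K -> avg_of (INR m * s) k (box_avg m s K).
Proof.
move=> m0 s0 [I [t [I0 [ht hK]]]].
exists ({ffun 'I_N -> 'I_m} * I)%type.
exists (fun p : {ffun 'I_N -> 'I_m} * I =>
  vadd (vscale s (nvec (fun q => p.1 q))) (t p.2)); split.
  by rewrite card_prod muln_gt0 card_ffun_gt0.
split=> [[i j] q|x] /=.
  rewrite /vadd /vscale /nvec; have := ht j q.
  have := le_INR _ _ (leP (ltn_ord (i q))); rewrite S_INR.
  have := pos_INR (i q); move: (INR (i q)) (INR m) (t j q) => u v w h1 h2 [h3 h4].
  by split; nra.
rewrite /box_avg -(mean_pair (fun (i : {ffun 'I_N -> 'I_m}) j =>
  k (vadd x (vadd (vscale s (nvec (fun q => i q))) (t j))))).
apply: mean_ext => i; rewrite hK; apply: mean_ext => j; congr k; vext; ring.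
Qed.

Lemma avg_of_iter N m s (k : vec N -> R) n : (0 < m)%N -> 0 <= s ->
  avg_of (INR (m ^ n) * s) k (iter_avg m s k n).
Proof.
move=> m0 s0; elim: n => [|n IH] /=.
  exists unit, (fun _ => vzero); split; first by rewrite card_unit.
  split=> [_ q|x]; first by rewrite /vzero; lra.
  by rewrite mean_const ?card_unit // vadd0.
rewrite expnS mult_INR Rmult_assoc; apply: avg_of_box => //.
by apply: Rmult_le_pos => //; apply: pos_INR.
Qed.

Lemma sdiff_mean N (I : finType) (t : I -> vec N) (k K : vec N -> R) w x :
  (forall x, K x = mean (fun i => k (vadd x (t i)))) ->
  sdiff w K x = mean (fun i => sdiff w k (vadd x (t i))).
Proof.
move=> hK; rewrite /sdiff.
have -> : mean (fun i => k (vadd x (t i)) - 2 * k (vadd (vadd x (t i)) w)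
     + k (vadd (vadd x (t i)) (vscale 2 w))) =
   mean (fun i => (k (vadd x (t i)) + -2 * k (vadd (vadd x (t i)) w))
     + k (vadd (vadd x (t i)) (vscale 2 w))) by apply: mean_ext => i; ring.
rewrite !meanD meanZ !hK.
have E v i : vadd (vadd x v) (t i) = vadd (vadd x (t i)) v by vext; ring.
rewrite (mean_ext (fun i => f_equal k (E w i))) (mean_ext (fun i => f_equal k (E (vscale 2 w) i))).
ring.
Qed.

Lemma sdiff_semiconvex N Lam (k : vec N -> R) w x : semiconvex Lam k ->
  - (Lam * dot w w) <= sdiff w k x.
Proof.
move=> h; have [p hp] := h (vadd x w).
have := hp w; have := hp (vscale (-1) w); rewrite /sdiff.
have -> : vadd (vadd x w) (vscale (-1) w) = x by vext; ring.
have -> : vadd (vadd x w) w = vadd x (vscale 2 w) by vext; ring.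
rewrite !dotZl !dotZr; lra.
Qed.

Lemma sdiff_avg_ge N Lam s (k K : vec N -> R) w x : semiconvex Lam k -> avg_of s k K ->
  - (Lam * dot w w) <= sdiff w K x.
Proof.
move=> h [I [t [I0 [_ hK]]]]; rewrite (sdiff_mean _ _ hK) -(mean_const I0 (- _)).
by apply: mean_le => // i; apply: sdiff_semiconvex.
Qed.

Lemma fdiff_telescope N (F : vec N -> R) w x m :
  F (vadd x (vscale (INR m) w)) - F x =
  \big[Rplus/0]_(a < m) (F (vadd (vadd x (vscale (INR a) w)) w) - F (vadd x (vscale (INR a) w))).
Proof.
elim: m => [|m IH].
  rewrite big_ord0; have -> : vadd x (vscale (INR 0) w) = x by vext => /=; ring.
  ring.
rewrite big_ord_recr /= -IH.
have -> : vadd x (vscale (INR m.+1) w) = vadd (vadd x (vscale (INR m) w)) w.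
  by vext; rewrite S_INR; ring.
ring.
Qed.

Lemma sdiff_telescope N (F : vec N -> R) w x m :
  sdiff (vscale (INR m) w) F x =
  \big[Rplus/0]_(a < m) \big[Rplus/0]_(b < m) sdiff w F (vadd x (vscale (INR (a + b)) w)).
Proof.
pose G y := F (vadd y (vscale (INR m) w)) - F y.
have -> : sdiff (vscale (INR m) w) F x = G (vadd x (vscale (INR m) w)) - G x.
  rewrite /sdiff /G; have -> : vadd (vadd x (vscale (INR m) w)) (vscale (INR m) w) =
    vadd x (vscale 2 (vscale (INR m) w)) by vext; ring.
  ring.
rewrite fdiff_telescope; apply: eq_bigr => a _; rewrite /G.
rewrite !fdiff_telescope.
transitivity (\big[Rplus/0]_(b < m)
  ((F (vadd (vadd (vadd (vadd x (vscale (INR a) w)) w) (vscale (INR b) w)) w) -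
    F (vadd (vadd (vadd x (vscale (INR a) w)) w) (vscale (INR b) w))) +
   -1 * (F (vadd (vadd (vadd x (vscale (INR a) w)) (vscale (INR b) w)) w) -
      F (vadd (vadd x (vscale (INR a) w)) (vscale (INR b) w))))).
  symmetry; rewrite sumD sumZ; set S1 := bigop _ _ _; set S2 := bigop _ _ _.
  by change (S1 + -1 * S2 = S1 - S2); ring.
apply: eq_bigr => b _; rewrite /sdiff plus_INR.
have -> : vadd (vadd x (vscale (INR a) w)) (vscale (INR b) w) =
  vadd x (vscale (INR a + INR b) w) by vext; ring.
have -> : vadd (vadd (vadd x (vscale (INR a) w)) w) (vscale (INR b) w) =
  vadd (vadd x (vscale (INR a + INR b) w)) w by vext; ring.
have -> : vadd (vadd (vadd x (vscale (INR a + INR b) w)) w) w =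
  vadd (vadd x (vscale (INR a + INR b) w)) (vscale 2 w) by vext; ring.
ring.
Qed.

(** The added constant compensates the worst case allowed by semiconvexity, so that the result is at
    least 1 and its reciprocal at most 1. *)
Definition ndiff {N} (Lam : R) (K : vec N -> R) (s : R) (v : 'I_N -> nat) (x : vec N) : R :=
  1 + Lam * dot (nvec v) (nvec v) + sdiff (vscale s (nvec v)) K x / (s * s).

Lemma ndiff_ge1 N Lam s s' (k K : vec N -> R) v x : 0 < s -> semiconvex Lam k -> avg_of s' k K ->
  1 <= ndiff Lam K s v x.
Proof.
move=> s0 hk hK; rewrite /ndiff.
have := sdiff_avg_ge (vscale s (nvec v)) x hk hK; rewrite dotZl dotZr => h.
have : - (Lam * (s * (s * dot (nvec v) (nvec v)))) / (s * s) <=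
   sdiff (vscale s (nvec v)) K x / (s * s).
  by apply: Rmult_le_compat_r => //; apply: Rlt_le; apply: Rinv_0_lt_compat; nra.
have -> : - (Lam * (s * (s * dot (nvec v) (nvec v)))) / (s * s) =
  - (Lam * dot (nvec v) (nvec v)) by field; lra.
lra.
Qed.

(** Two averages combine: the box average commutes with second differences, and a second difference
    of step [m s] telescopes into [m^2] of step [s]. Division by the squared step turns that sum
    into a mean, so the relation between scales is exact. *)
Lemma ndiff_step N Lam (K : vec N -> R) s m v x : 0 < s -> (0 < m)%N ->
  ndiff Lam (box_avg m s K) (INR m * s) v x =
  mean (fun p : {ffun 'I_N -> 'I_m} * ('I_m * 'I_m) =>
    ndiff Lam K s v (vadd x (vscale s (nvec (fun q => p.1 q + (p.2.1 + p.2.2) * v q)%N)))).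
Proof.
move=> s0 m0; have mR : 0 < INR m by apply: lt_0_INR; apply/ltP.
have I0 : (0 < #|{: 'I_m * 'I_m}|)%N by rewrite card_prod !card_ord muln_gt0 m0.
have I1 := card_ffun_gt0 N m0.
set c := 1 + Lam * dot (nvec v) (nvec v).
rewrite -(mean_pair (fun (i : {ffun 'I_N -> 'I_m}) (p : 'I_m * 'I_m) =>
   ndiff Lam K s v (vadd x (vscale s (nvec (fun q => i q + (p.1 + p.2) * v q)%N))))).
rewrite {1}/ndiff -/c (sdiff_mean (k := K)
   (t := fun i : {ffun 'I_N -> 'I_m} => vscale s (nvec (fun q => i q)))) //.
have -> : forall S, c + mean S / (INR m * s * (INR m * s)) =
   mean (fun i : {ffun 'I_N -> 'I_m} => c + / (INR m * s * (INR m * s)) * S i).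
  by move=> S; rewrite meanD meanZ mean_const // /Rdiv; ring.
apply: mean_ext => i; rewrite /ndiff -/c meanD mean_const //; congr (c + _).
have -> : vscale (INR m * s) (nvec v) = vscale (INR m) (vscale s (nvec v)) by vext; ring.
rewrite sdiff_telescope pair_bigA /=.
have -> : forall S : 'I_m * 'I_m -> R, mean (fun p => S p / (s * s)) = / (s * s) * mean S.
  by move=> S; rewrite -meanZ; apply: mean_ext => p; rewrite /Rdiv; ring.
rewrite /mean card_prod card_ord mult_INR.
set S1 := bigop _ _ _; set S2 := bigop _ _ _.
have -> : S1 = S2; last by field; lra.
apply: eq_bigr => p _; congr sdiff.
by vext; rewrite /nvec /vscale !plus_INR mult_INR plus_INR; ring.
Qed.

Lemma nat_floor r : 0 <= r -> exists n : nat, INR n <= r < INR n + 1.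
Proof.
move=> r0; have [n0 hn0] := INR_unbounded r.
elim: n0 hn0 => [|n IH] h; first by rewrite /= in h; lra.
by have [/IH //|h'] := Rlt_le_dec r (INR n); exists n; rewrite S_INR in h; lra.
Qed.

(** * Quadratic approximation around a point of two-sided control *)

Definition in_cube {N} (x0 : vec N) (c : R) (y : vec N) := forall q, Rabs (y q - x0 q) <= c.

Section LocalEstimates.
Variables (N : nat) (Lam : R) (k : vec N -> R) (x0 : vec N) (r : R).
Hypotheses (Lam0 : 0 < Lam) (r0 : 0 < r) (hk : semiconvex Lam k).
Hypothesis k_small : forall h, Rabs (k (vadd x0 h)) <= Lam / 2 * dot h h.
Local Notation n0 := (INR N).
Local Notation near := (in_cube x0).

Lemma near_bound c y : near c y -> Rabs (k y) <= Lam / 2 * (n0 * (c * c)).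
Proof.
move=> h; have := k_small (vsub y x0); rewrite vadd_subK => h1.
apply: Rle_trans h1 _; apply: Rmult_le_compat_l; first lra.
exact: dot_sup_le.
Qed.

Lemma coord_dim_ge1 (q : 'I_N) : 1 <= n0.
Proof. by apply: (le_INR 1); apply/leP; apply: leq_ltn_trans (ltn_ord q). Qed.

(** The slope of the supporting parabola at [y], tested at distance [r] along each axis, is limited
    by the quadratic bound on [k] over the cube of half-side [5 r]. The constant 30 adds 26 from
    this slope and 4 from the semiconvexity term, where [t <= 8 r]. *)
Lemma lipschitz_lower y y' t : near (4 * r) y -> (forall q, Rabs (y' q - y q) <= t) -> t <= 8 * r ->
  k y - 30 * (n0 * n0) * Lam * r * t <= k y'.
Proof.
move=> hy ht t8; have [p hp] := hk y.
have hpq q : Rabs (p q) <= 26 * n0 * Lam * r.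
  have n1 := coord_dim_ge1 q.
  have hy5 a : Rabs a <= r -> Rabs (k (vadd y (vscale a (unitv q)))) <= Lam / 2 * (n0 * ((5 * r) * (5 * r))).
    move=> ha; apply: near_bound => i; rewrite /vadd /vscale /unitv.
    by have := hy i; case: (i == q); split_Rabs; lra.
  have hy0 := near_bound hy.
  have h1 := hp (vscale r (unitv q)); have h2 := hp (vscale (- r) (unitv q)).
  have a1 : Rabs r <= r by split_Rabs; lra.
  have a2 : Rabs (- r) <= r by split_Rabs; lra.
  have h3 := hy5 _ a1; have h4 := hy5 _ a2.
  rewrite !dotZr !dotZl !dot_unitr unitvv in h1.
  rewrite !dotZr !dotZl !dot_unitr unitvv in h2.
  set K := Lam * (r * r); have K0 : 0 < K by apply: Rmult_lt_0_compat; nra.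
  have e3 : Lam / 2 * (n0 * (5 * r * (5 * r))) = 25 / 2 * (n0 * K) by rewrite /K; field.
  have e4 : Lam / 2 * (n0 * (4 * r * (4 * r))) = 8 * (n0 * K) by rewrite /K; field.
  rewrite e3 in h3 h4; rewrite e4 in hy0.
  have e5 : Lam / 2 * (r * (r * 1)) = K / 2 by rewrite /K; field.
  have e6 : Lam / 2 * (- r * (- r * 1)) = K / 2 by rewrite /K; field.
  rewrite e5 in h1; rewrite e6 in h2.
  have nK : K <= n0 * K by nra.
  have e7 : 26 * n0 * Lam * r * r = 26 * (n0 * K) by rewrite /K; ring.
  have up : r * p q <= 26 * (n0 * K) by move: h3 hy0; split_Rabs; lra.
  have lo : - (r * p q) <= 26 * (n0 * K) by move: h4 hy0; split_Rabs; lra.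
  apply: (Rmult_le_reg_r r) => //; rewrite e7.
  by split_Rabs; lra.
have := hp (vsub y' y); rewrite vadd_subK => h.
have h1 : Rabs (dot p (vsub y' y)) <= _ := dot_abs_le hpq ht.
have h2 := dot_sup_le ht.
case: (posnP N) => [z|/ltP/lt_INR n1].
  have n00 : n0 = 0 by rewrite z.
  move: h1 h2 h; rewrite n00; have := dot_ge0 (vsub y' y).
  move: (dot p _) (dot (vsub y' y) _) => u v.
  by split_Rabs; nra.
have n1' : 1 <= n0 by apply: (le_INR 1); apply/leP; case: (N) n1 => //= /Rlt_irrefl.
have t0 : 0 <= t.
  by have [q _|] := pickP [pred q : 'I_N | true]; [have := ht q; split_Rabs; lra
    |move=> h0; case: (N) n1 h0 => [/Rlt_irrefl //|n _ h0]; have := h0 ord0].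
set Z := Lam * r * t; have Z0 : 0 <= Z by repeat apply: Rmult_le_pos; lra.
have e1 : n0 * (26 * n0 * Lam * r * t) = 26 * (n0 * n0 * Z) by rewrite /Z; ring.
rewrite e1 in h1.
have e2 : 30 * (n0 * n0) * Lam * r * t = 30 * (n0 * n0 * Z) by rewrite /Z; ring.
rewrite e2.
have h3 : Lam / 2 * dot (vsub y' y) (vsub y' y) <= 4 * (n0 * n0 * Z).
  apply: Rle_trans (_ : Lam / 2 * (n0 * (t * t)) <= _); first by apply: Rmult_le_compat_l; [lra|exact: h2].
  have -> : Lam / 2 * (n0 * (t * t)) = n0 * (Lam * t * t / 2) by field.
  have -> : 4 * (n0 * n0 * Z) = n0 * (n0 * (4 * Z)) by ring.
  apply: Rmult_le_compat_l; first lra.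
  have h4 : Lam * t * t / 2 <= 4 * Z.
    rewrite /Z; have : Lam * t * t <= Lam * t * (8 * r) by apply: Rmult_le_compat_l => //; nra.
    lra.
  nra.
have h4 := Rle_abs (- dot p (vsub y' y)); rewrite Rabs_Ropp in h4.
lra.
Qed.

Lemma lipschitz_near y y' t : near (4 * r) y -> near (4 * r) y' ->
  (forall q, Rabs (y' q - y q) <= t) -> t <= 8 * r ->
  Rabs (k y' - k y) <= 30 * (n0 * n0) * Lam * r * t.
Proof.
move=> hy hy' ht t8; have := lipschitz_lower hy ht t8.
have ht' q : Rabs (y q - y' q) <= t by rewrite Rabs_minus_sym.
have := lipschitz_lower hy' ht' t8; split_Rabs; lra.
Qed.

Section Avg.
Variables (s : R) (K : vec N -> R).
Hypotheses (s0 : 0 < s) (sr : s <= r) (hK : avg_of s k K).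

Lemma avg_close y : near (3 * r) y -> Rabs (K y - k y) <= 30 * (n0 * n0) * Lam * r * s.
Proof.
case: hK => I [t [I0 [ht ->]]] hy.
have -> : mean (fun i => k (vadd y (t i))) - k y = mean (fun i => k (vadd y (t i)) + -1 * k y).
  by rewrite meanD mean_const //; ring.
apply: mean_abs => // i; have -> : forall a b, a + -1 * b = a - b by move=> a b; ring.
apply: lipschitz_near; try lra; move=> q; have := ht i q; have := hy q; rewrite /vadd; split_Rabs; lra.
Qed.

Lemma avg_lipschitz y p : near (2 * r) y ->
  Rabs (K (vadd y (vscale s (unitv p))) - K y) <= 30 * (n0 * n0) * Lam * r * s.
Proof.
case: hK => I [t [I0 [ht hKe]]] hy; rewrite !hKe.
have -> : forall F G : I -> R, mean F - mean G = mean (fun i => F i + -1 * G i).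
  by move=> F G; rewrite meanD meanZ; ring.
apply: mean_abs => // i; have -> : forall a b, a + -1 * b = a - b by move=> a b; ring.
apply: lipschitz_near; try lra; move=> q; have := ht i q; have := hy q; rewrite /vadd /vscale /unitv;
  case: (q == p); split_Rabs; lra.
Qed.
End Avg.

(** The upper half is the point: semiconvexity alone does not bound second differences from above,
    and here [k_small] does. *)
Lemma sdiff_avg_near (K : vec N -> R) s v x : 0 < s <= r -> avg_of s k K -> near r x ->
  (forall q, (v q <= 1)%N) ->
  Rabs (sdiff (vscale s (nvec v)) K x) <= 32 * (n0 * Lam) * (r * r).
Proof.
move=> [s0 sr] hK hx hv.
have hb y : near (3 * r) y -> Rabs (K y) <= 8 * (n0 * Lam) * (r * r).
  case: hK => I [t [I0 [ht ->]]] hy; apply: mean_abs => // i.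
  have -> : 8 * (n0 * Lam) * (r * r) = Lam / 2 * (n0 * ((4 * r) * (4 * r))) by field.
  by apply: near_bound => q; have := ht i q; have := hy q; rewrite /vadd; split_Rabs; lra.
have vq q : 0 <= INR (v q) <= 1.
  by split; [exact: pos_INR|apply: (le_INR _ 1); apply/leP].
have h0 : near (3 * r) x by move=> q; have := hx q; lra.
have h1 : near (3 * r) (vadd x (vscale s (nvec v))).
  by move=> q; have := hx q; have := vq q; rewrite /vadd /vscale /nvec; move: (INR _) => w; split_Rabs; nra.
have h2 : near (3 * r) (vadd x (vscale 2 (vscale s (nvec v)))).
  by move=> q; have := hx q; have := vq q; rewrite /vadd /vscale /nvec; move: (INR _) => w; split_Rabs; nra.
have := hb _ h0; have := hb _ h1; have := hb _ h2.
have -> : 32 * (n0 * Lam) * (r * r) = 4 * (8 * (n0 * Lam) * (r * r)) by ring.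
move: (8 * _ * _) => z; rewrite /sdiff; split_Rabs; lra.
Qed.
End LocalEstimates.

Lemma dirn_norm_le N (p q : 'I_N) : 0 <= dot (nvec (dirn p q)) (nvec (dirn p q)) <= INR N.
Proof.
split; first exact: dot_ge0.
have -> : INR N = INR N * (1 * 1) by ring.
apply: dot_sup_le => k; rewrite /nvec /dirn.
by case: (_ || _); rewrite /= ?Rabs_R0 ?Rabs_R1; lra.
Qed.

(** [discrete_taylor] is applied to [K / s^2] on the grid of mesh [s]. With [r = 2 m' s], passing
    from [K] to [k] and from a point to a nearby grid point costs a Lipschitz constant of order
    [Lam r] times [s], and rounding inside the polynomial costs a comparable amount. All this is of
    order [r^2 / m'], while [e1] enters at full size. *)
Lemma local_quadratic N Lam (k : vec N -> R) x0 s m' (K : vec N -> R) x (B : mat N) e1 Bm :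
  0 < Lam -> semiconvex Lam k -> (forall h, Rabs (k (vadd x0 h)) <= Lam / 2 * dot h h) ->
  0 < s -> (8 <= m')%N -> avg_of s k K ->
  (forall q, 0 <= x0 q - (x q + INR m' * s) <= s) ->
  Defs.symmetric B -> (forall p q, 1 <= B p q <= Bm) -> 0 <= e1 ->
  (forall p q (i : 'I_N -> nat), (forall q, (i q < 2 * m')%N) ->
     Rabs (ndiff Lam K s (dirn p q) (vadd x (vscale s (nvec i))) - B p q) <= e1) ->
  exists c d X, Defs.symmetric X /\ forall h, (forall q, Rabs (h q) <= INR m' * s / 2) ->
    Rabs (k (vadd x0 h) - (c + dot d h + / 2 * quad X h)) <=
    (((2 + INR N) * (30 * (INR N * INR N) * Lam)
      + 6 * (INR N * INR N) * (Bm + 1 + Lam * INR N)) / INR (2 * m')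
     + 2 * e1 * (INR N * INR N)) * ((INR (2 * m') * s) * (INR (2 * m') * s)).
Proof.
move=> Lam0 hk hks s0 m8 hK hx Bsym hB e10 hnd.
set n0 := INR N; have n00 : 0 <= n0 by apply: pos_INR.
have n0sq : n0 <= n0 * n0.
  rewrite /n0 -mult_INR; apply: le_INR; apply/leP; rewrite multE; nia.
set a := Bm + 1 + Lam * n0.
set m := (2 * m')%N; have mR : INR m = 2 * INR m' by rewrite /m mult_INR.
have m'R : 8 <= INR m' by have /leP/le_INR := m8; rewrite [INR 8]/=; lra.
set r := INR m * s.
have r0 : 0 < r by rewrite /r mR; apply: Rmult_lt_0_compat; lra.
have sr : s <= r by rewrite /r mR; nra.
set Lp := 30 * (n0 * n0) * Lam.
have Lp0 : 0 <= Lp by rewrite /Lp; nra.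
pose H (i : 'I_N -> nat) := K (vadd x (vscale s (nvec i))) / (s * s).
pose al : mat N := fun p q => B p q - 1 - Lam * dot (nvec (dirn p q)) (nvec (dirn p q)).
have dirC p q : dirn p q = dirn q p by apply: functional_extensionality => l; rewrite /dirn orbC.
have alsym : Defs.symmetric al by move=> p q; rewrite /al Bsym dirC.
have albd p q : Rabs (al p q) <= a.
  rewrite /al /a; have := hB p q; have [d0 d1] := dirn_norm_le p q.
  move: (dot _ _) d0 d1 => d d0 d1 hBpq.
  have : 0 <= Lam * d <= Lam * n0 by rewrite -/n0 in d1; split; nra.
  have : 0 <= Lam * n0 by nra.
  split_Rabs; lra.
have a0 : 0 <= a \/ N = 0%N.
  case: (posnP N) => [|Npos]; first by right.
  by left; have p := Ordinal Npos; apply: Rle_trans (albd p p); apply: Rabs_pos.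
have ss0 : 0 < s * s by nra.
have pt i w : vadd x (vscale s (nvec (fun k => i k + w k)%N)) =
    vadd (vadd x (vscale s (nvec i))) (vscale s (nvec w)).
  by vext; rewrite /nvec plus_INR; ring.
(* [discrete_taylor] is used with [M = m.+1]: the hypothesis holds for indices below [2 * m'], that
   is [i k + 2 <= m.+1]. *)
have sd p q i : (forall k, (i k + 2 <= m.+1)%N) ->
  Rabs (H i - 2 * H (fun k => i k + dirn p q k)%N
        + H (fun k => i k + 2 * dirn p q k)%N - al p q) <= e1.
  move=> hi; have hi' k0 : (i k0 < 2 * m')%N by have := hi k0; rewrite /m; lia.
  have := hnd p q i hi'; rewrite /ndiff /H /al !pt /sdiff.
  have -> : vscale s (nvec (fun k0 => 2 * dirn p q k0)%N) = vscale 2 (vscale s (nvec (dirn p q))).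
    by vext; rewrite /nvec mult_INR /=; ring.
  set u1 := K _; set u2 := K _; set u3 := K _; set d := dot _ _ => h.
  apply: Rle_trans h; apply: Req_le; congr Rabs; field; lra.
have near_x (i : 'I_N -> nat) : (forall q, (i q <= m)%N) ->
    forall q, Rabs (vadd x (vscale s (nvec i)) q - x0 q) <= r.
  move=> hi q; rewrite /vadd /vscale /nvec; have := hx q.
  have := pos_INR (i q); have := le_INR _ _ (leP (hi q)); rewrite /r mR.
  move: (INR (i q)) => w w1 w0 [h1 h2].
  have := Rmult_le_compat_l s _ _ (Rlt_le _ _ s0) w1; have := Rmult_le_pos _ _ (Rlt_le _ _ s0) w0.
  by split_Rabs; nra.
have fd p : Rabs (H (incv p (fun=> 1%N)) - H (fun=> 1%N)) <= Lp * INR m.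
  rewrite /H nvec_incv.
  have -> : vadd x (vscale s (vadd (nvec (fun=> 1%N)) (unitv p))) =
    vadd (vadd x (vscale s (nvec (fun=> 1%N)))) (vscale s (unitv p)) by vext; ring.
  have := avg_lipschitz Lam0 r0 hk hks s0 sr hK (y := vadd x (vscale s (nvec (fun=> 1%N)))) p.
  have h1 q : Rabs (vadd x (vscale s (nvec (fun=> 1%N))) q - x0 q) <= 2 * r.
    by apply: Rle_trans (_ : r <= _); [apply: near_x => ?; rewrite /m; lia|lra].
  move=> /(_ h1); rewrite -/n0 -/Lp; set u1 := K _; set u2 := K _.
  have -> : u1 / (s * s) - u2 / (s * s) = (u1 - u2) / (s * s) by field; lra.
  rewrite /Rdiv Rabs_mult (Rabs_pos_eq (/ _)); last by apply: Rlt_le; apply: Rinv_0_lt_compat.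
  move=> h; apply: (Rmult_le_reg_r (s * s)) => //.
  rewrite Rmult_assoc Rinv_l; last lra.
  by rewrite Rmult_1_r; apply: Rle_trans h _; rewrite /r; lra.
have [c [d [hd hT]]] := discrete_taylor alsym albd sd fd e10.
set P := polar_mx al in hT.
have Psym : Defs.symmetric P := polar_mx_sym alsym.
(* Grid coordinates of [x0] relative to [x]; the polynomial is recentred there. *)
pose io := vscale (/ s) (vsub x0 x).
exists (s * s * (c + dot d io + / 2 * quad P io)), (vscale s (vadd d (mulv P io))), P.
split=> // h hh.
pose io' := vadd io (vscale (/ s) h).
have -> : s * s * (c + dot d io + / 2 * quad P io) + dot (vscale s (vadd d (mulv P io))) h +
   / 2 * quad P h = s * s * (c + dot d io' + / 2 * quad P io').
  rewrite /io' quadD // quadZ !dotDr !dotZr dotZl dotDl; field; lra.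
(* Each coordinate of [x0] lies in [[m', m' + 1]] and [h] moves it by at most [m' / 2]; [8 <= m']
   keeps the result clear of both ends of the grid. *)
have io_rng q : 1 <= io' q /\ io' q < 2 * INR m' - 2.
  have -> : io' q = (x0 q - x q + h q) / s by rewrite /io' /io /vadd /vscale /vsub; field; lra.
  have := hx q; have := hh q => h1 h2.
  have h3 : (4 * s <= x0 q - x q + h q <= (3 / 2 * INR m' + 1) * s).
    by have [ha hb] := Rabs_bounds h1; split; nra.
  have E : (x0 q - x q + h q) = (x0 q - x q + h q) / s * s by field; lra.
  rewrite {}E in h3; move: (_ / s) h3 => w [h3 h4].
  have := Rmult_le_reg_r _ _ _ s0 h3; have := Rmult_le_reg_r _ _ _ s0 h4; lra.
have fl q : {n : nat | INR n <= io' q < INR n + 1}.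
  by apply: constructive_indefinite_description; apply: nat_floor; have := io_rng q; lra.
pose i q := sval (fl q).
have ifl q : INR (i q) <= io' q < INR (i q) + 1 by rewrite /i; case: (fl q).
have i_rng q : (1 <= i q)%N /\ (i q + 4 <= m.+1)%N.
  have := io_rng q; have := ifl q => h1 h2; split.
    by apply/ltP; apply: INR_lt; rewrite /=; lra.
  have : (i q < m - 2)%N.
    apply/ltP; apply: INR_lt; rewrite minus_INR; last by apply/leP; rewrite /m; lia.
    by rewrite mR /=; lra.
  by rewrite /m; lia.
have i_le q : (i q <= m)%N by have := i_rng q; lia.
pose y := vadd x (vscale s (nvec i)).
have hT' := hT i i_rng.
have near_y : forall q, Rabs (y q - x0 q) <= r := near_x i i_le.
have near_h q : Rabs (vadd x0 h q - x0 q) <= r.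
  by have := hh q; rewrite /vadd /r mR; split_Rabs; nra.
have Ex0 : vadd x0 h = vadd x (vscale s io').
  by rewrite /io' /io; vext; field; lra.
have yh q : Rabs (vadd x0 h q - y q) <= s.
  rewrite Ex0 /y /vadd /vscale /nvec; have := ifl q; move: (INR _) (io' q) => w v.
  by move=> [h1 h2]; split_Rabs; nra.
have L1 : Rabs (k (vadd x0 h) - k y) <= Lp * r * s.
  apply: (lipschitz_near Lam0 r0 hk hks) => //; try (move=> q; have := near_y q; have := near_h q; lra).
  lra.
have L2 : Rabs (K y - k y) <= Lp * r * s.
  apply: (avg_close Lam0 r0 hk hks sr hK) => q; have := near_y q; lra.
have L3 : Rabs (K y - s * s * (c + dot d (nvec i) + / 2 * quad P (nvec i))) <=
   2 * e1 * (n0 * n0) * (r * r).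
  have -> : K y = s * s * H i by rewrite /H -/y; field; lra.
  rewrite -Rmult_minus_distr_l Rabs_mult (Rabs_pos_eq (s * s)); last lra.
  apply: Rle_trans (_ : s * s * (2 * e1 * ((n0 * INR m) * (n0 * INR m))) <= _); last by rewrite /r; lra.
  apply: Rmult_le_compat_l; first lra.
  apply: Rle_trans hT' _; apply: Rmult_le_compat_l; first lra.
  have hS : INR (\sum_q i q) <= n0 * INR m.
    rewrite /n0 -mult_INR; apply: le_INR; apply/leP; rewrite multE.
    have : (\sum_q i q <= #|'I_N| * m)%N by rewrite -sum_nat_const; apply: leq_sum => q _.
    by rewrite card_ord.
  by have := pos_INR (\sum_q i q) => h1; apply: Rmult_le_compat.
pose de := vsub io' (nvec i).
have de1 q : Rabs (de q) <= 1.
  by rewrite /de /vsub /nvec; have := ifl q; split_Rabs; lra.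
have L4 : Rabs ((c + dot d io' + / 2 * quad P io') - (c + dot d (nvec i) + / 2 * quad P (nvec i)))
   <= INR m * (n0 * Lp + 6 * (n0 * n0) * a).
  have -> : io' = vadd (nvec i) de by rewrite /de vadd_subK.
  rewrite quadD // dotDr.
  have -> : c + (dot d (nvec i) + dot d de) +
     / 2 * (quad P (nvec i) + 2 * dot (mulv P (nvec i)) de + quad P de) -
     (c + dot d (nvec i) + / 2 * quad P (nvec i)) =
     dot d de + dot (mulv P (nvec i)) de + / 2 * dot (mulv P de) de by rewrite /quad; field.
  have a1 := dot_abs_le hd de1.
  have Pm q : Rabs (mulv P (nvec i) q) <= n0 * (2 * a * INR m).
    apply: dot_abs_le => l; first exact: (polar_mx_bound albd).
    by rewrite /nvec Rabs_pos_eq; [apply: le_INR; apply/leP; exact: i_le|exact: pos_INR].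
  have Pd q : Rabs (mulv P de q) <= n0 * (2 * a * 1).
    by apply: dot_abs_le => l; first exact: (polar_mx_bound albd).
  have a2 := dot_abs_le Pm de1; have a3 := dot_abs_le Pd de1.
  rewrite -/n0 in a1 a2 a3.
  have m1 : 1 <= INR m by rewrite mR; lra.
  have N0 : N = 0%N -> n0 = 0 by rewrite /n0 => ->.
  have nma : 0 <= n0 * a by case: a0 => [?|/N0 ->]; [exact: Rmult_le_pos|lra].
  have nna : n0 * a <= n0 * n0 * a.
    by case: a0 => [?|/N0 ->]; [exact: Rmult_le_compat_r|lra].
  apply: Rle_trans (_ : n0 * ((Lp * INR m + n0 * (2 * a) + a) * 1) + n0 * (n0 * (2 * a * INR m) * 1)
      + n0 * (n0 * (2 * a * 1) * 1) <= _).
    by have := Rabs_pos (dot (mulv P de) de); move: a1 a2 a3; split_Rabs; lra.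
  set w := n0 * n0 * a in nna *.
  have -> : n0 * ((Lp * INR m + n0 * (2 * a) + a) * 1) + n0 * (n0 * (2 * a * INR m) * 1)
      + n0 * (n0 * (2 * a * 1) * 1) = n0 * Lp * INR m + n0 * a + 4 * w + 2 * w * INR m.
    by rewrite /w; ring.
  have -> : 6 * (n0 * n0) * a = 6 * w by rewrite /w; ring.
  nra.
have Em : r * s = r * r / INR m by rewrite /r; field; rewrite mR; lra.
have L5 : s * s * (INR m * (n0 * Lp + 6 * (n0 * n0) * a)) =
   (n0 * Lp + 6 * (n0 * n0) * a) / INR m * (r * r).
  by rewrite /r; field; rewrite mR; lra.
have L6 : Rabs (s * s * (c + dot d io' + / 2 * quad P io') -
    s * s * (c + dot d (nvec i) + / 2 * quad P (nvec i))) <=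
   (n0 * Lp + 6 * (n0 * n0) * a) / INR m * (r * r).
  rewrite -L5 -Rmult_minus_distr_l Rabs_mult (Rabs_pos_eq (s * s)); last lra.
  by apply: Rmult_le_compat_l; lra.
apply: Rle_trans (_ : Lp * r * s + Lp * r * s + 2 * e1 * (n0 * n0) * (r * r) +
  (n0 * Lp + 6 * (n0 * n0) * a) / INR m * (r * r) <= _).
  by move: L1 L2 L3 L6; split_Rabs; lra.
have -> : Lp * r * s = Lp * (r * r / INR m) by rewrite Rmult_assoc Em.
apply: Req_le; rewrite /Lp /a; field; rewrite mR; lra.
Qed.

(** * Nearly quadratic contact points *)

Definition contact {N} (D : vec N -> R) (p x0 : vec N) : Prop :=
  forall x, D x - dot p x <= D x0 - dot p x0.

Lemma linear_le_square N (w : vec N) c : (forall h, dot w h <= c * dot h h) -> w = vzero.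
Proof.
move=> H; apply: dot_eq0; apply: Rle_antisym; last exact: dot_ge0.
pose t := / (2 * (Rabs c + 1)); have c0 := Rabs_pos c.
have t0 : 0 < t by apply: Rinv_0_lt_compat; lra.
have := H (vscale t w); rewrite dotZr dotZl dotZr => h.
have ct : c * t <= / 2.
  have : (Rabs c + 1) * t = / 2 by rewrite /t; field; lra.
  have := Rle_abs c; nra.
have := dot_ge0 w; move: (dot w w) h => W h W0.
have : t * W <= t * W / 2.
  apply: Rle_trans h _; have -> : c * (t * (t * W)) = (c * t) * (t * W) by ring.
  have -> : t * W / 2 = / 2 * (t * W) by field.
  by apply: Rmult_le_compat_r => //; nra.
nra.
Qed.

(** The parabolas supporting [f] and [k] from below at [x0] add up to one lying below a function
    whose slope there can only be [p], which fixes the sum of their slopes. Maximality then turns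
    the lower bound on [f] into an upper bound on [k]. *)
Lemma contact_two_sided N Lam (f k : vec N -> R) p x0 :
  semiconvex Lam f -> semiconvex Lam k -> contact (fun x => f x + k x) p x0 ->
  exists q, forall h, Rabs (k (vadd x0 h) - k x0 - dot q h) <= Lam / 2 * dot h h /\
    f (vadd x0 h) >= f x0 + dot p h - dot q h - Lam / 2 * dot h h.
Proof.
move=> hf hk hc; have [pf hpf] := hf x0; have [q hq] := hk x0; exists q.
have E : vadd (vadd pf q) (vscale (-1) p) = vzero.
  apply: (@linear_le_square _ _ Lam) => h; rewrite !dotDl dotZl.
  have := hpf h; have := hq h; have := hc (vadd x0 h); rewrite dotDr; lra.
move=> h; have Eh : dot pf h + dot q h - dot p h = 0.
  by have := f_equal (fun w => dot w h) E; rewrite /= !dotDl dotZl dot0l; lra.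
have := hpf h; have := hq h; have := hc (vadd x0 h); rewrite dotDr => a b c.
by split; [apply: Rabs_le; split|]; lra.
Qed.

Lemma contact_lower N Lam (f k : vec N -> R) p x0 :
  semiconvex Lam f -> semiconvex Lam k -> contact (fun x => f x + k x) p x0 ->
  forall h, f x0 + k x0 + dot p h - Lam * dot h h <= f (vadd x0 h) + k (vadd x0 h).
Proof.
move=> hf hk hc h; have [q hq] := contact_two_sided hf hk hc.
by have [/Rabs_bounds a b] := hq h; lra.
Qed.

(** At a contact point the sum lies between an affine function and the same function minus
    [Lam |h|^2]. Comparing two such pinchings at a point one step [s] away along an axis bounds the
    slope difference. Read backwards, well separated slopes cannot have contact points in one small
    cell. *)
Lemma contact_slope N Lam (f k : vec N -> R) p x p' x' s q :
  semiconvex Lam f -> semiconvex Lam k -> 0 < Lam -> 0 < s ->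
  contact (fun x => f x + k x) p x -> contact (fun x => f x + k x) p' x' ->
  (forall i, Rabs (x i - x' i) <= s) -> Rabs (p' q - p q) <= 4 * INR N * Lam * s.
Proof.
move=> hf hk L0 s0 hc hc' hxx.
have key a : Rabs a = s -> (p' q - p q) * a <= 4 * INR N * Lam * s * s.
  move=> ha; pose h := vscale a (unitv q).
  have [d Ed] : exists d, d = vsub x x' by exists (vsub x x').
  have Edp : dot p' d = dot p' x - dot p' x' by rewrite Ed dotBr.
  have := contact_lower hf hk hc' (vadd d h).
  have -> : vadd x' (vadd d h) = vadd x h by rewrite Ed; vext; ring.
  have := hc (vadd x h); have := hc' x; rewrite !dotDr.
  have h2 : dot (vadd d h) (vadd d h) <= INR N * ((2 * s) * (2 * s)).
    apply: dot_sup_le => i; rewrite Ed /vadd /vsub /h /vscale /unitv.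
    have [a1 a2] := Rabs_bounds (Req_le _ _ ha); have [b1 b2] := Rabs_bounds (hxx i).
    by apply: Rabs_le; case: (i == q); lra.
  have h3 := Rmult_le_compat_l _ _ _ (Rlt_le _ _ L0) h2.
  have Eh w : dot w h = a * w q by rewrite /h dotZr dot_unitr.
  rewrite !Eh; move: h3; rewrite !dotDl !dotDr !Eh (_ : vadd d h q = d q + h q) //; lra.
have k1 := key s (Rabs_pos_eq _ (Rlt_le _ _ s0)).
have k2 := key (- s) (ltac:(by rewrite Rabs_Ropp Rabs_pos_eq //; lra)).
apply: (Rmult_le_reg_r s) => //; split_Rabs; lra.
Qed.

Lemma avg_of_affine N s (k K : vec N -> R) c q x0 : avg_of s k K ->
  exists K', avg_of s (fun y => k y - c - dot q (vsub y x0)) K' /\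
    forall w x, sdiff w K' x = sdiff w K x.
Proof.
move=> [I [t [I0 [ht hK]]]]; pose k' y := k y - c - dot q (vsub y x0).
pose K' x := mean (fun i => k' (vadd x (t i))); exists K'; split; first by exists I, t.
move=> w x; rewrite (sdiff_mean w x hK) (@sdiff_mean _ I t k' K') //; apply: mean_ext => i.
by rewrite /sdiff /k' !vsubE !dotDr !dotZr; ring.
Qed.

Lemma semiconvex_affine N Lam (k : vec N -> R) c q x0 : semiconvex Lam k ->
  semiconvex Lam (fun y => k y - c - dot q (vsub y x0)).
Proof.
move=> h x; have [p hp] := h x; exists (vsub p q) => y; have := hp y.
by rewrite !vsubE !dotDl !dotDr !dotZl !dotZr; lra.
Qed.

(** After subtraction of the supporting affine function, the contact bound caps the normalized
    second differences by [Bm]: [1 + Lam N] from the normalization and [32 N Lam] from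
    [sdiff_avg_near]. A small gap then makes those at scale [s] equal up to [e1] to the one at scale
    [m s], as [local_quadratic] demands. *)
Lemma small_gap_quadratic N Lam (f k : vec N -> R) p x0 sg m' n x g e1 Bm eps :
  0 < Lam -> semiconvex Lam f -> semiconvex Lam k -> contact (fun x => f x + k x) p x0 ->
  0 < sg -> (8 <= m')%N ->
  let m := (2 * m')%N in let s := INR (m ^ n) * sg in
  let c := INR #|{: {ffun 'I_N -> 'I_m} * ('I_m * 'I_m)}| in
  (forall q, 0 <= x0 q - (x q + INR m' * s) <= s) ->
  Bm = 1 + Lam * INR N + 32 * (INR N * Lam) -> 0 <= e1 ->
  2 * (c * g) * Bm < 1 -> 2 * (c * g) * (Bm * (Bm * Bm)) <= e1 * e1 ->
  (forall p q : 'I_N,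
    mean (fun i : {ffun 'I_N -> 'I_m} * ('I_m * 'I_m) =>
      / ndiff Lam (iter_avg m sg k n) s (dirn p q)
         (vadd x (vscale s (nvec (fun l => i.1 l + (i.2.1 + i.2.2) * dirn p q l)%N)))) -
    / ndiff Lam (iter_avg m sg k n.+1) (INR m * s) (dirn p q) x <= g) ->
  32 * (((2 + INR N) * (30 * (INR N * INR N) * Lam)
      + 6 * (INR N * INR N) * (Bm + 1 + Lam * INR N)) / INR m
     + 2 * e1 * (INR N * INR N)) <= eps ->
  exists q X, Defs.symmetric X /\ forall h, (forall l, Rabs (h l) <= INR m' * s / 2) ->
    Rabs (k (vadd x0 h) - k x0 - dot q h - / 2 * quad X h) <=
    eps * ((INR m' * s / 2) * (INR m' * s / 2)).
Proof.
move=> L0 hf hk hc sg0 m8 m s c hx EBm e10 g1 g2 hg heps.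
have m0 : (0 < m)%N by rewrite /m; lia.
have mR : INR m = 2 * INR m' by rewrite /m mult_INR.
have m'R : 8 <= INR m' by have /leP/le_INR := m8; rewrite [INR 8]/=; lra.
have s0 : 0 < s.
  by apply: Rmult_lt_0_compat => //; apply: lt_0_INR; apply/ltP; rewrite expn_gt0 m0.
have s'0 : 0 < INR m * s by apply: Rmult_lt_0_compat; lra.
have I0 : (0 < #|{: {ffun 'I_N -> 'I_m} * ('I_m * 'I_m)}|)%N.
  by rewrite !card_prod !muln_gt0 card_ffun_gt0 // !card_ord m0.
have [q hq] := contact_two_sided hf hk hc.
pose k' y := k y - k x0 - dot q (vsub y x0).
have hk' : semiconvex Lam k' by apply: semiconvex_affine.
have hks h : Rabs (k' (vadd x0 h)) <= Lam / 2 * dot h h.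
  by rewrite /k' vsub_addl; have [] := hq h.
have avgK := avg_of_iter k n m0 (Rlt_le _ _ sg0).
have avgKS := avg_of_iter k n.+1 m0 (Rlt_le _ _ sg0).
rewrite -/s in avgK; have Es : INR (m ^ n.+1) * sg = INR m * s.
  by rewrite expnS mult_INR /s; ring.
rewrite Es in avgKS.
have [K [hK EK]] := avg_of_affine (k x0) q x0 avgK.
have [K' [hK' EK']] := avg_of_affine (k x0) q x0 avgKS.
pose B p' q' := ndiff Lam (iter_avg m sg k n.+1) (INR m * s) (dirn p' q') x.
have n00 := pos_INR N.
have hB p' q' : 1 <= B p' q' <= Bm.
  split; first exact: (ndiff_ge1 _ _ s'0 hk avgKS).
  rewrite /B /ndiff -EK' EBm.
  have near : forall l, Rabs (x l - x0 l) <= INR m * s.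
    by move=> l; have := hx l; rewrite mR; split_Rabs; nra.
  have := sdiff_avg_near L0 s'0 hks (v := dirn p' q') (conj s'0 (Rle_refl _)) hK' near.
  move=> /(_ (fun l => leq_b1 _)).
  have [d0 d1] := dirn_norm_le p' q'; have := Rmult_le_compat_l _ _ _ (Rlt_le _ _ L0) d1.
  set S := sdiff _ _ _; set w := INR m * s in s'0 *; set d := dot _ _ => d2 hS.
  have : S / (w * w) <= 32 * (INR N * Lam); last lra.
  have ww : 0 < w * w by nra.
  apply: (Rmult_le_reg_r (w * w)) => //.
  rewrite /Rdiv Rmult_assoc Rinv_l; last lra.
  by have := Rle_abs S; lra.
have close p' q' (i : 'I_N -> nat) : (forall l, (i l < m)%N) ->
   Rabs (ndiff Lam K s (dirn p' q') (vadd x (vscale s (nvec i))) - B p' q') <= e1.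
  move=> hi; pose o := Ordinal m0.
  (* The averaged shifts with both telescoping indices zero already reach every grid point of the
     cube. *)
  pose t : {ffun 'I_N -> 'I_m} * ('I_m * 'I_m) := ([ffun l => Ordinal (hi l)], (o, o)).
  pose F (i : {ffun 'I_N -> 'I_m} * ('I_m * 'I_m)) := ndiff Lam (iter_avg m sg k n) s (dirn p' q')
         (vadd x (vscale s (nvec (fun l => i.1 l + (i.2.1 + i.2.2) * dirn p' q' l)%N))).
  have F1 i' : 1 <= F i' by exact: (ndiff_ge1 _ _ s0 hk avgK).
  have EB : B p' q' = mean F by apply: ndiff_step.
  have := gap_small_close I0 t F1 (Bm := Bm) (g := g); rewrite -EB.
  move=> /(_ (proj2 (hB p' q')) (hg p' q') g1).
  have -> : F t = ndiff Lam K s (dirn p' q') (vadd x (vscale s (nvec i))).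
    rewrite /F /ndiff EK; congr (_ + sdiff _ _ _ / _).
    by vext; rewrite /nvec /t /= ffunE /= mul0n addn0.
  move: (_ - _) => z hz; have : z * z <= e1 * e1 by apply: Rle_trans hz g2.
  by split_Rabs; nra.
have Bsym : Defs.symmetric B.
  move=> p' q'; rewrite /B; have -> : dirn p' q' = dirn q' p' => //.
  by apply: functional_extensionality => l; rewrite /dirn orbC.
have [a [d [X [hX hq2]]]] := local_quadratic L0 hk' hks s0 m8 hK hx Bsym hB e10 close.
exists (vadd q d), X; split=> // h hh.
have h0 l : Rabs (@vzero N l) <= INR m' * s / 2.
  have h1 : 0 <= INR m' * s by apply: Rmult_le_pos; lra.
  by rewrite /vzero Rabs_R0; lra.
have := hq2 _ h0; have := hq2 _ hh; rewrite -/m.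
set E := (_ * (INR m * s * _)) => b1 b2.
(* The error is counted at [h] and at 0, and the square of [m s] is 16 times that of [m' s / 2]:
   hence the factor 32 in the hypothesis on [eps]. *)
have EE : 2 * E <= eps * (INR m' * s / 2 * (INR m' * s / 2)).
  have -> : eps * (INR m' * s / 2 * (INR m' * s / 2)) = eps * ((INR m * s) * (INR m * s)) / 16.
    by rewrite mR; field.
  have -> : 2 * E = 32 * (E / (INR m * s * (INR m * s))) * ((INR m * s) * (INR m * s)) / 16.
    by field; rewrite mR; lra.
  apply: Rmult_le_compat_r; first lra.
  apply: Rmult_le_compat_r; first nra.
  apply: Rle_trans heps; apply: Req_le; rewrite /E; field; lra.
move: b1 b2; rewrite vadd0 dot0r quad0 /k' vsub_addl vsubxx dot0r dotDl.
by split_Rabs; lra.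
Qed.

Lemma nat_above r : exists n : nat, r <= INR n.
Proof. by have [n h] := INR_unbounded r; exists n; lra. Qed.

Lemma pow_INR_nat (a n : nat) : INR (a ^ n) = INR a ^ n.
Proof. by elim: n => [|n IH] //; rewrite expnS mult_INR IH. Qed.

(** Since [sg] shrinks like [1/P], the [P^N] slopes give contact points in distinct cells of a
    grid that has only about [P^N] cells in total; the energy bound then forbids all of them from
    having a large gap at all of the first [J] scales. *)
Lemma contact_quadratic N Lam R0 rho (f k : vec N -> R) :
  0 < Lam -> 0 < rho -> 0 <= R0 -> semiconvex Lam f -> semiconvex Lam k ->
  (forall p, (forall l, 0 <= p l <= rho) -> exists x0, (forall l, Rabs (x0 l) <= R0) /\
     contact (fun x => f x + k x) p x0) ->
  forall eps r0, 0 < eps -> 0 < r0 -> exists p x0 r q X,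
    (forall l, 0 <= p l <= rho) /\ contact (fun x => f x + k x) p x0 /\ 0 < r <= r0 /\
    Defs.symmetric X /\ forall h, (forall l, Rabs (h l) <= r) ->
      Rabs (k (vadd x0 h) - k x0 - dot q h - / 2 * quad X h) <= eps * (r * r).
Proof.
move=> L0 rho0 R00 hf hk hcon eps r0 eps0 r00.
set n0 := INR N; have n00 : 0 <= n0 := pos_INR N.
pose Bm := 1 + Lam * n0 + 32 * (n0 * Lam).
have Ln : 0 <= Lam * n0 by apply: Rmult_le_pos; lra.
have Bm1 : 1 <= Bm by rewrite /Bm; lra.
pose Cc := (2 + n0) * (30 * (n0 * n0) * Lam) + 6 * (n0 * n0) * (Bm + 1 + Lam * n0).
have nn0 : 0 <= n0 * n0 by nra.
have Cc0 : 0 <= Cc.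
  by apply: Rplus_le_le_0_compat; repeat apply: Rmult_le_pos; lra.
have [M1 hM1] := nat_above (64 * Cc / eps).
(* The final error is 32 times the sum of a term of order [1/m] and one of order [e1]; [m'] and [e1]
   make each at most [eps / 64]. *)
pose m' := maxn 8 M1; pose m := (2 * m')%N.
have m8 : (8 <= m')%N by apply: leq_maxl.
have mR : INR m = 2 * INR m' by rewrite /m mult_INR.
have m'R : 8 <= INR m' by have /leP/le_INR := m8; rewrite [INR 8]/=; lra.
have m0 : (0 < m)%N by rewrite /m; lia.
pose e1 := eps / (128 * (n0 * n0 + 1)).
have e10 : 0 < e1 by apply: Rdiv_lt_0_compat; lra.
have herr : 32 * (Cc / INR m + 2 * e1 * (n0 * n0)) <= eps.
  have h1 : Cc / INR m <= eps / 64.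
    have : 64 * Cc / eps <= INR m.
      have : INR M1 <= INR m' by apply: le_INR; apply/leP; apply: leq_maxr.
      lra.
    move=> h; apply: (Rmult_le_reg_r (INR m)); first lra.
    have -> : Cc / INR m * INR m = (64 * Cc / eps) * (eps / 64) by field; lra.
    rewrite (Rmult_comm (eps / 64)); apply: Rmult_le_compat_r; lra.
  have h2 : 2 * e1 * (n0 * n0) <= eps / 64.
    have -> : eps / 64 = 2 * e1 * (n0 * n0 + 1) by rewrite /e1; field; lra.
    by apply: Rmult_le_compat_l; lra.
  lra.
pose c := INR #|{: {ffun 'I_N -> 'I_m} * ('I_m * 'I_m)}|.
have I0 : (0 < #|{: {ffun 'I_N -> 'I_m} * ('I_m * 'I_m)}|)%N.
  by rewrite !card_prod !muln_gt0 card_ffun_gt0 // !card_ord m0.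
have c0 : 0 < c by apply: lt_0_INR; apply/ltP.
(* The two entries answer the two smallness conditions on the gap in [gap_small_close]. *)
pose g0 := Rmin (/ 8) (e1 * e1 / 2).
have g00 : 0 < g0 by apply: Rmin_pos; [lra|nra].
have B3 : 0 < Bm * (Bm * Bm) by apply: Rmult_lt_0_compat; nra.
pose g := g0 / (c * (Bm * (Bm * Bm))).
have gp : 0 < g by apply: Rdiv_lt_0_compat => //; apply: Rmult_lt_0_compat.
have Ecg : c * g * (Bm * (Bm * Bm)) = g0 by rewrite /g; field; lra.
have g2 : 2 * (c * g) * (Bm * (Bm * Bm)) <= e1 * e1.
  by have := Rmin_r (/ 8) (e1 * e1 / 2); rewrite -/g0; lra.
have g1 : 2 * (c * g) * Bm < 1.
  have : c * g * Bm <= g0.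
    rewrite -Ecg; apply: Rmult_le_compat_l; first by nra.
    nra.
  by have := Rmin_l (/ 8) (e1 * e1 / 2); rewrite -/g0; lra.
(* With cells of side [sg = kap / P], the slope spacing [rho / P] equals [5 (n0 + 1) Lam sg], which
   beats the bound [4 n0 Lam sg] of [contact_slope]; contact points of distinct slopes then occupy
   distinct cells. *)
pose kap := rho / (5 * (n0 + 1) * Lam).
have kap0 : 0 < kap by apply: Rdiv_lt_0_compat => //; nra.
have [Q1 hQ1] := nat_above (2 * R0 / kap).
(* About [Q1 * P] cells per axis hold the contact points; the extra 8 absorbs all grid margins,
   which total less than [7 * m ^ J]. *)
pose Q0 := (Q1 + 8)%N.
have [J0 hJ0] := nat_above (INR (N * N) * INR Q0 ^ N / g).
pose J := J0.+1.
have [P1 hP1] := nat_above (INR (m ^ J) * kap / r0).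
(* [m ^ J <= P] keeps the grid margins within a multiple of [P] independent of [J]; the bound by
   [P1] keeps the coarsest scale [m ^ J * sg] below [r0]. *)
pose P := (maxn (m ^ J) (maxn P1 1))%N.
have P_ge1 : (1 <= P)%N by rewrite /P; lia.
have P_gem : (m ^ J <= P)%N by rewrite /P; lia.
have PR : 1 <= INR P by apply: (le_INR 1); apply/leP.
pose sg := kap / INR P.
have sg0 : 0 < sg by apply: Rdiv_lt_0_compat; lra.
have EsgP : sg * INR P = kap by rewrite /sg; field; lra.
pose slope (t : {ffun 'I_N -> 'I_P}) : vec N := fun l => rho / INR P * INR (t l).
have slope_rng t l : 0 <= slope t l <= rho.
  have rp : 0 < rho / INR P by apply: Rdiv_lt_0_compat; lra.
  split; first by apply: Rmult_le_pos; [lra|exact: pos_INR].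
  have -> : rho = rho / INR P * INR P by field; lra.
  apply: Rmult_le_compat_l; first lra.
  by apply: le_INR; apply/leP; apply: ltnW.
have /choice [X0 hX0] : forall t, exists x0, (forall l, Rabs (x0 l) <= R0) /\
   contact (fun x => f x + k x) (slope t) x0 by move=> t; apply: hcon; apply: slope_rng.
have /choice [fl hfl] : forall tl : {ffun 'I_N -> 'I_P} * 'I_N, exists a : nat,
    INR a <= (X0 tl.1 tl.2 + R0) / sg < INR a + 1.
  move=> [t l]; apply: nat_floor; apply: Rmult_le_pos.
    by have := Rabs_bounds ((hX0 t).1 l) => /=; lra.
  by apply: Rlt_le; apply: Rinv_0_lt_compat.
have fl_bound t l : (fl (t, l) <= Q1 * P)%N.
  apply/leP; apply: INR_le; rewrite mult_INR.
  have [h1 _] := hfl (t, l); apply: Rle_trans h1 _ => /=.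
  apply: Rle_trans (_ : 2 * R0 / kap * INR P <= _); last by apply: Rmult_le_compat_r; lra.
  have -> : 2 * R0 / kap * INR P = 2 * R0 / sg by rewrite /sg; field; lra.
  apply: Rmult_le_compat_r; first by apply: Rlt_le; apply: Rinv_0_lt_compat.
  by have := Rabs_bounds ((hX0 t).1 l); lra.
have fl_cell t l : 0 <= X0 t l + R0 - sg * INR (fl (t, l)) <= sg.
  have := hfl (t, l) => /= -[h1 h2].
  have E : X0 t l + R0 = (X0 t l + R0) / sg * sg by field; lra.
  by rewrite E; split; nra.
have fl_inj t t' : (forall l, fl (t, l) = fl (t', l)) -> t = t'.
  move=> e; apply/ffunP => l; apply: val_inj.
  have hx l' : Rabs (X0 t' l' - X0 t l') <= sg.
    by have := fl_cell t l'; have := fl_cell t' l'; rewrite e; split_Rabs; lra.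
  have := contact_slope l hf hk L0 sg0 (hX0 t').2 (hX0 t).2 hx; rewrite -/n0 /slope.
  rewrite -Rmult_minus_distr_l Rabs_mult Rabs_pos_eq; last first.
    by apply: Rlt_le; apply: Rdiv_lt_0_compat; lra.
  move=> h; have : Rabs (INR (t l) - INR (t' l)) < 1.
    apply: (Rmult_lt_reg_l (rho / INR P)); first by apply: Rdiv_lt_0_compat; lra.
    apply: Rle_lt_trans h _; rewrite Rmult_1_r.
    have -> : rho / INR P = 5 * (n0 + 1) * Lam * sg by rewrite /sg /kap; field; lra.
    have Ls : 0 < Lam * sg by apply: Rmult_lt_0_compat.
    by rewrite !Rmult_assoc; nra.
  case: (ltngtP (t l) (t' l)) => // /leP/le_INR; rewrite S_INR; split_Rabs; lra.
(* Shifts at step [n] are at most [3 * m ^ n.+1], and the margin shrinks by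
   [6 * (m ^ n.+1 - m ^ n)], which is at least as much because [m >= 2]. *)
pose L n := (Q1 * P + 1 + m ^ J + 6 * (m ^ J - m ^ n))%N.
have mexp n : (n < J)%N -> (m' * m ^ n <= m ^ J)%N.
  move=> nJ; apply: leq_trans (_ : m ^ n.+1 <= _)%N.
    by rewrite expnS leq_mul2r /m; apply/orP; right; lia.
  by rewrite leq_exp2l // /m; lia.
(* The base point sits [m'] steps of scale [m ^ n] below the cell of the contact point, which places
   the contact point near the middle of its local grid. The offset [m ^ J], matched by the origin
   [O], keeps the subtraction exact. *)
pose idx n t l := (fl (t, l) + m ^ J - m' * m ^ n)%N.
have idx_lt n t l : (idx n t l < L n.+1)%N.
  by rewrite /idx /L; have := fl_bound t l; lia.
pose h n t : {ffun 'I_N -> 'I_(L n.+1)} := [ffun l => Ordinal (idx_lt n t l)].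
have hinj n : (n < J)%N -> injective (h n).
  move=> /mexp nJ t t' e; apply: fl_inj => l.
  have /(congr1 (fun F : {ffun 'I_N -> 'I_(L n.+1)} => val (F l))) := e.
  by rewrite /= !ffunE /= /idx; lia.
pose O : vec N := fun=> - (R0 + sg * INR (m ^ J)).
pose pt (i : 'I_N -> nat) := vadd O (vscale sg (nvec i)).
pose s n := INR (m ^ n) * sg.
have s0 n : 0 < s n.
  by apply: Rmult_lt_0_compat => //; apply: lt_0_INR; apply/ltP; rewrite expn_gt0 m0.
pose b (v : 'I_N * 'I_N) n i := ndiff Lam (iter_avg m sg k n) (s n) (dirn v.1 v.2) (pt i).
pose sh (v : 'I_N * 'I_N) n (i : {ffun 'I_N -> 'I_m} * ('I_m * 'I_m)) l :=
  (m ^ n * (i.1 l + (i.2.1 + i.2.2) * dirn v.1 v.2 l))%N.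
have pt_sh v n i x : pt (fun l => x l + sh v n i l)%N =
   vadd (pt x) (vscale (s n) (nvec (fun l => i.1 l + (i.2.1 + i.2.2) * dirn v.1 v.2 l)%N)).
  by rewrite /pt /s /sh; vext; rewrite /nvec plus_INR mult_INR; ring.
have b1 v n i : 1 <= b v n i.
  apply: (ndiff_ge1 _ _ (s0 n) hk); exact: (avg_of_iter k n m0 (Rlt_le _ _ sg0)).
have sS n : s n.+1 = INR m * s n by rewrite /s expnS mult_INR; ring.
have bS v n i : b v n.+1 i = mean (fun t => b v n (fun l => i l + sh v n t l)%N).
  rewrite /b sS (ndiff_step _ _ _ _ (s0 n) m0); apply: mean_ext => t.
  by rewrite pt_sh.
have LS v n i l : (n < J)%N -> (L n.+1 + sh v n i l <= L n)%N.
  move=> nJ; have hm : (m ^ n.+1 <= m ^ J)%N by rewrite leq_exp2l // /m; lia.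
  have h1 : (sh v n i l <= 3 * m ^ n.+1)%N.
    rewrite /sh expnS mulnA mulnC leq_mul2r; apply/orP; right.
    have := ltn_ord (i.1 l); have := ltn_ord i.2.1; have := ltn_ord i.2.2.
    by rewrite /dirn; case: (_ || _) => /=; lia.
  have h2 : (2 * m ^ n <= m ^ n.+1)%N by rewrite expnS leq_mul2r /m; apply/orP; right; lia.
  by rewrite /L; lia.
have [[n [t [nJ hgap]]]|hno] := classic (exists n t, (n < J)%N /\ forall v,
   mean (fun i => / b v n (fun l => h n t l + sh v n i l)%N) - / b v n.+1 (fun l => h n t l) < g).
  exists (slope t), (X0 t), (INR m' * s n / 2).
  have hx l : 0 <= X0 t l - (pt (fun l => h n t l) l + INR m' * s n) <= sg.
    have := fl_cell t l; rewrite /pt /vadd /vscale /nvec /h ffunE /= /idx /O /s.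
    rewrite minus_INR ?plus_INR ?mult_INR; last by apply/leP; have := mexp n nJ; lia.
    by lra.
  have s_ge : sg <= s n.
    have : 1 <= INR (m ^ n) by apply: (le_INR 1); apply/leP; rewrite expn_gt0 m0.
    by rewrite /s; nra.
  have hx' l : 0 <= X0 t l - (pt (fun l => h n t l) l + INR m' * s n) <= s n.
    by have := hx l; lra.
  have hg p q : mean (fun i : {ffun 'I_N -> 'I_m} * ('I_m * 'I_m) =>
      / ndiff Lam (iter_avg m sg k n) (s n) (dirn p q)
         (vadd (pt (fun l => h n t l)) (vscale (s n) (nvec (fun l => i.1 l + (i.2.1 + i.2.2) * dirn p q l)%N)))) -
    / ndiff Lam (iter_avg m sg k n.+1) (INR m * s n) (dirn p q) (pt (fun l => h n t l)) <= g.
    have := hgap (p, q); rewrite /b /= sS => hgp; apply: Rlt_le.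
    apply: Rle_lt_trans hgp; apply: Req_le; congr (_ - _); apply: mean_ext => i.
    by rewrite (pt_sh (p, q)).
  have [q [X [Xs hX]]] := small_gap_quadratic L0 hf hk (hX0 t).2 sg0 m8 hx' erefl (Rlt_le _ _ e10)
    g1 g2 hg herr.
  exists q, X; split; first exact: slope_rng.
  split; first exact: (hX0 t).2.
  split; last by split.
  have ms : 0 < INR m' * s n by apply: Rmult_lt_0_compat => //; lra.
  split; first lra.
  have h1 : INR m' * s n <= INR (m ^ J) * sg.
    rewrite /s -Rmult_assoc -mult_INR; apply: Rmult_le_compat_r; first lra.
    by apply: le_INR; apply/leP; apply: mexp.
  have h2 : INR (m ^ J) * sg <= r0.
    have h3 : INR (m ^ J) * kap / r0 <= INR P.
      by apply: Rle_trans hP1 _; apply: le_INR; apply/leP; rewrite /P; lia.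
    apply: (Rmult_le_reg_r (INR P)); first lra.
    rewrite Rmult_assoc EsgP.
    have -> : INR (m ^ J) * kap = INR (m ^ J) * kap / r0 * r0 by field; lra.
    by rewrite (Rmult_comm r0); apply: Rmult_le_compat_r; lra.
  lra.
exfalso.
have hgap n t : (n < J)%N -> exists v,
    g <= mean (fun i => / b v n (fun l => h n t l + sh v n i l)%N) - / b v n.+1 (fun l => h n t l).
  move=> nJ; apply: NNPP => hn; apply: hno; exists n, t; split=> // v.
  by apply: Rnot_le_lt => hv; apply: hn; exists v.
have := energy_bound I0 b1 bS LS hinj hgap.
rewrite card_prod card_ffun !card_ord pow_INR_nat.
have hL0 : (L 0%N <= Q0 * P)%N.
  have mJ : (0 < m ^ J)%N by rewrite expn_gt0 m0.
  by rewrite /L /Q0 expn0; lia.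
move=> hE.
have hL : INR (L 0%N ^ N)%N <= INR Q0 ^ N * INR P ^ N.
  rewrite -Rpow_mult_distr -mult_INR -pow_INR_nat; apply: le_INR; apply/leP.
  by case: (posnP N) => [->|N0]; rewrite ?expn0 // leq_exp2r.
have PN : 0 < INR P ^ N by apply: pow_lt; lra.
have h1 : INR J * g * INR P ^ N <= INR (N * N) * INR Q0 ^ N * INR P ^ N.
  have := Rmult_le_compat_l _ _ _ (pos_INR (N * N)) hL; lra.
have h2 := Rmult_le_reg_r _ _ _ PN h1.
have h3 : INR (N * N) * INR Q0 ^ N <= INR J0 * g.
  have -> : INR (N * N) * INR Q0 ^ N = INR (N * N) * INR Q0 ^ N / g * g by field; lra.
  by apply: Rmult_le_compat_r; lra.
by move: h2; rewrite /J S_INR; lra.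
Qed.

(** * The functions [lambda j] *)

Lemma quad_bounded N (A : mat N) : exists C, 0 <= C /\ forall v, Rabs (quad A v) <= C * dot v v.
Proof.
pose a := \big[Rplus/0]_(i < N) \big[Rplus/0]_(k < N) Rabs (A i k).
have a0 : 0 <= a by apply: sum_ge0 => i _; apply: sum_ge0 => k _; apply: Rabs_pos.
have ha i k : Rabs (A i k) <= a.
  apply: Rle_trans (term_le_sum (F := fun k => Rabs (A i k)) k _) _; first by move=> ?; apply: Rabs_pos.
  apply: (term_le_sum (F := fun i => \big[Rplus/0]_(k < N) Rabs (A i k)) i) => ?.
  by apply: sum_ge0 => ? _; apply: Rabs_pos.
exists (INR N * (INR N * a)); split.
  by have := pos_INR N => n0; repeat apply: Rmult_le_pos.
move=> v; have hv := coord_le_vnorm v.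
have -> : INR N * (INR N * a) * dot v v = INR N * (INR N * (a * vnorm v) * vnorm v).
  by rewrite -vnorm_sqr; ring.
by apply: dot_abs_le => // i; apply: dot_abs_le.
Qed.

Lemma lcomb_unit N j (b : 'I_j -> vec N) i : lcomb b (unitv i) = b i.
Proof.
apply: functional_extensionality => l; rewrite /lcomb.
exact: (dot_unitl i (fun k => b k l)).
Qed.

Lemma lcombZ N j (b : 'I_j -> vec N) a c : lcomb b (vscale a c) = vscale a (lcomb b c).
Proof.
apply: functional_extensionality => l; rewrite /lcomb /vscale -sumZ.
by apply: eq_bigr => k _; ring.
Qed.

Lemma rayleigh_sup_exists N j (A : mat N) (b : 'I_j -> vec N) : (0 < j)%N -> lin_indep b ->
  exists s, rayleigh_sup A b s.
Proof.
move=> j0 hb; have [C [_ hC]] := quad_bounded A.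
pose o := Ordinal j0.
have bn0 : 0 < vnorm (b o).
  have [h|//] := Rle_lt_or_eq_dec _ _ (vnorm_ge0 (b o)) => //; move=> h.
  have z : b o = vzero by apply: dot_eq0; rewrite -vnorm_sqr -h; ring.
  have := hb (unitv o) (fun i => ltac:(rewrite lcomb_unit z; reflexivity)) o.
  by rewrite unitvv; lra.
have [s hs] := completeness (fun r => exists c : vec j, vnorm (lcomb b c) = 1 /\ r = quad A (lcomb b c))
  ltac:(exists C => r [c [hc ->]]; by have := Rle_abs (quad A (lcomb b c)); have := hC (lcomb b c); rewrite -vnorm_sqr hc; lra)
  ltac:(exists (quad A (lcomb b (vscale (/ vnorm (b o)) (unitv o)))), (vscale (/ vnorm (b o)) (unitv o));
    split=> //; rewrite lcombZ lcomb_unit vnormZ Rabs_pos_eq;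
    [field; lra | by apply: Rlt_le; apply: Rinv_0_lt_compat]).
by exists s.
Qed.

(** As [lambda] is picked by [epsilon], it has meaning only once the infimum is shown to exist. A
    nonempty family contains a unit vector in its span, which bounds the suprema from below, and
    [j <= N] provides a competitor made of coordinate vectors. *)
Lemma lambda_spec N j (A : mat N) : (1 <= j <= N)%N -> is_lambda j A (lambda j A).
Proof.
move=> /andP[j1 jN]; apply: epsilon_spec.
have [C [_ hC]] := quad_bounded A.
pose E s := exists b : 'I_j -> vec N, lin_indep b /\ rayleigh_sup A b s.
have lower s : E s -> - C <= s.
  move=> [b [hb [hs _]]]; pose o := Ordinal j1.
  have bn0 : 0 < vnorm (b o).
    have [h|//] := Rle_lt_or_eq_dec _ _ (vnorm_ge0 (b o)) => //; move=> h.
    have z : b o = vzero by apply: dot_eq0; rewrite -vnorm_sqr -h; ring.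
    have := hb (unitv o) (fun i => ltac:(rewrite lcomb_unit z; reflexivity)) o.
    by rewrite unitvv; lra.
  have h1 : vnorm (lcomb b (vscale (/ vnorm (b o)) (unitv o))) = 1.
    rewrite lcombZ lcomb_unit vnormZ Rabs_pos_eq; first by field; lra.
    by apply: Rlt_le; apply: Rinv_0_lt_compat.
  have := hs _ (ex_intro _ _ (conj h1 erefl)); have := hC (lcomb b (vscale (/ vnorm (b o)) (unitv o))).
  by rewrite -vnorm_sqr h1 => /Rabs_bounds; lra.
have ne : exists s, E s.
  pose b (i : 'I_j) : vec N := unitv (widen_ord jN i).
  have hb : lin_indep b.
    move=> c hc k; have := hc (widen_ord jN k); rewrite /lcomb (@sum_single _ _ k).
      by rewrite /b unitvv Rmult_1_r.
    move=> i ik; rewrite /b /unitv (_ : (widen_ord jN k == widen_ord jN i) = false); first ring.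
    apply/negbTE; apply: contra ik => /eqP/(congr1 val) /= e.
    by apply/eqP; apply: val_inj; rewrite /= e.
  have [s hs] := rayleigh_sup_exists A j1 hb; by exists s, b.
have [l [hl1 hl2]] := completeness (fun r => E (- r))
  ltac:(exists C => r /lower; lra)
  ltac:(have [s hs] := ne; exists (- s); by rewrite Ropp_involutive).
exists (- l); split=> [s hs|m hm].
  have := hl1 (- s); rewrite Ropp_involutive => /(_ hs); lra.
have : l <= - m; last lra.
by apply: hl2 => r /hm; lra.
Qed.

(** All that comparison uses of [lambda j]: ellipticity, with a gain of at most [e] when [e] times
    the identity is added. The same family of vectors competes for both matrices. *)
Lemma lambda_mono N j (X Y : mat N) e : (1 <= j <= N)%N ->
  (forall v, quad X v <= quad Y v + e * dot v v) -> lambda j X <= lambda j Y + e.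
Proof.
move=> hj hXY; have [lX _] := lambda_spec X hj; have [_ gY] := lambda_spec Y hj.
have : lambda j X - e <= lambda j Y; last lra.
apply: gY => s [b [hb hs]].
have j1 : (0 < j)%N by case/andP: hj.
have [s' hs'] := rayleigh_sup_exists X j1 hb.
have h1 := lX _ (ex_intro _ b (conj hb hs')).
have : s' <= s + e; last lra.
apply: (proj2 hs') => r [c [hc ->]].
have := hXY (lcomb b c); rewrite -vnorm_sqr hc.
have := (proj1 hs) _ (ex_intro _ c (conj hc erefl)); lra.
Qed.

Lemma lin_indep_span N (b : 'I_N -> vec N) (w : vec N) : lin_indep b -> exists c, lcomb b c = w.
Proof.
move=> hb; pose M : 'M[R]_N := (\matrix_(k, i) b k i)%R.
have E (v : 'rV[R]_N) i : (v *m M)%R ord0 i = lcomb b (v ord0) i.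
  by rewrite mxE /lcomb; apply: eq_bigr => k _; rewrite mxE.
have fr : row_free M.
  apply: inj_row_free => v hv; apply/rowP => k; rewrite mxE.
  apply: (hb (v ord0)) => i; by rewrite -E hv mxE.
rewrite row_free_unit in fr.
pose v : 'rV[R]_N := ((\row_i w i) *m invmx M)%R.
exists (v ord0); apply: functional_extensionality => i.
by rewrite -E /v mulmxKV // mxE.
Qed.

(** [N] independent vectors span the whole space, so [w] takes part in every supremum. *)
Lemma lambda_top_ge N (X : mat N) w : (0 < N)%N -> vnorm w = 1 -> quad X w <= lambda N X.
Proof.
move=> N0 hw; have hj : (1 <= N <= N)%N by rewrite N0 leqnn.
have [_ g] := lambda_spec X hj; apply: g => s [b [hb hs]].
have [c hc] := lin_indep_span w hb.
by apply: (proj1 hs); exists c; rewrite hc.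
Qed.

(** * Concavity of the eigenfunction *)

Definition qpol {N} (e : vec N) (X : mat N) (h : vec N) : R := dot e h + / 2 * quad X h.

Section Qpol.
Variables (N : nat) (e a : vec N) (X : mat N).
Hypothesis Xsym : Defs.symmetric X.

Lemma qpolD h w : qpol e X (vadd h w) = qpol e X h + qpol (vadd e (mulv X h)) X w.
Proof. by rewrite /qpol quadD // dotDr dotDl; field. Qed.

Lemma qpol_shift x y : qpol e X (vsub y a) =
  qpol e X (vsub x a) + qpol (vadd e (mulv X (vsub x a))) X (vsub y x).
Proof. by rewrite -qpolD; congr qpol; vext; ring. Qed.

Lemma qpol_cont x eps : 0 < eps -> exists del, 0 < del /\ forall y, vnorm (vsub y x) < del ->
  Rabs (qpol e X (vsub y a) - qpol e X (vsub x a)) < eps.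
Proof.
move=> eps0; have [C [C0 hC]] := quad_bounded X.
set p := vadd e (mulv X (vsub x a)).
have n0 := vnorm_ge0 p.
pose del := Rmin 1 (eps / (vnorm p + C + 1)).
have d0 : 0 < eps / (vnorm p + C + 1) by apply: Rdiv_lt_0_compat; lra.
exists del; split=> [|y hy]; first by apply: Rmin_pos; lra.
have h1 : vnorm (vsub y x) < 1 by apply: Rlt_le_trans hy (Rmin_l _ _).
have h2 : vnorm (vsub y x) < eps / (vnorm p + C + 1) by apply: Rlt_le_trans hy (Rmin_r _ _).
have -> : qpol e X (vsub y a) - qpol e X (vsub x a) = qpol p X (vsub y x).
  by rewrite (qpol_shift x y) -/p; ring.
have h3 := dot_le_vnorm p (vsub y x); have h4 := hC (vsub y x).
rewrite -vnorm_sqr in h4; have h5 := vnorm_ge0 (vsub y x).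
move: h1 h2 h3 h4 h5; rewrite /qpol; set v := vnorm (vsub y x) => h1 h2 h3 h4 h5.
have E : eps / (vnorm p + C + 1) * (vnorm p + C + 1) = eps by field; lra.
have h6 : v * (vnorm p + C + 1) < eps by rewrite -E; apply: Rmult_lt_compat_r; lra.
have h7 : C * (v * v) <= C * v by apply: Rmult_le_compat_l => //; nra.
have := Rabs_bounds h3; have := Rabs_bounds h4 => h8 h9.
by apply: Rabs_def1; nra.
Qed.

Lemma qpol_closed r : vclosed (fun x => qpol e X (vsub x a) <= r).
Proof.
move=> x l hx hl; apply: le_epsilon => eps eps0.
have [del [d0 hd]] := qpol_cont l eps0; have [n0 hn] := hl _ d0.
by have /Rabs_def2 := hd _ (hn n0 (leqnn _)); have := hx n0; lra.
Qed.

Lemma qpol_open r x : qpol e X (vsub x a) < r -> exists del, 0 < del /\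
  forall y, vnorm (vsub y x) < del -> qpol e X (vsub y a) < r.
Proof.
move=> h; have e0 : 0 < r - qpol e X (vsub x a) by lra.
have [del [d0 hd]] := qpol_cont x e0; exists del; split=> // y /hd /Rabs_def2; lra.
Qed.

Definition mopp {n} (A : mat n) : mat n := fun i k => - A i k.
Lemma mopp_sym n (A : mat n) : Defs.symmetric A -> Defs.symmetric (mopp A).
Proof. by move=> h i k; rewrite /mopp h. Qed.
Lemma quad_mopp n (A : mat n) v : quad (mopp A) v = - quad A v.
Proof.
have -> : mopp A = mcomb (-1) A 0 0 vzero.
  by apply: functional_extensionality => i; apply: functional_extensionality => k;
     rewrite /mopp /mcomb; ring.
by rewrite quad_mcomb; ring.
Qed.

Lemma min_subjet (O : vec N -> Prop) u x del : 0 < del ->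
  (forall y, O y -> vnorm (vsub y x) < del ->
     u x + qpol e X (vsub x a) <= u y + qpol e X (vsub y a)) ->
  subjet O u x (vscale (-1) (vadd e (mulv X (vsub x a)))) (mopp X).
Proof.
move=> d0 h; split; first exact: mopp_sym.
move=> eps eps0; exists del; split=> // y Oy hy; have := h y Oy hy.
rewrite (qpol_shift x y) quad_mopp dotZl vnorm_pow2 /qpol.
by have := Rmult_le_pos _ _ (Rlt_le _ _ eps0) (dot_ge0 (vsub y x)); lra.
Qed.
End Qpol.

Lemma cont_on_qpol N (S : vec N -> Prop) f e X a c : Defs.symmetric X -> cont_on S f ->
  cont_on S (fun x => - (f x + c * qpol e X (vsub x a))).
Proof.
move=> hX hf x Sx eps eps0.
have e1 : 0 < eps / 2 by lra. have e2 : 0 < eps / (2 * (Rabs c + 1)).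
  by apply: Rdiv_lt_0_compat => //; have := Rabs_pos c; lra.
have [d1 [d10 h1]] := hf x Sx _ e1; have [d2 [d20 h2]] := qpol_cont e a hX x e2.
exists (Rmin d1 d2); split; first exact: Rmin_pos.
move=> y Sy hy.
have := h1 y Sy (Rlt_le_trans _ _ _ hy (Rmin_l _ _)).
have := h2 y (Rlt_le_trans _ _ _ hy (Rmin_r _ _)).
set u := qpol _ _ _; set v := qpol _ _ _ => k1 k2.
have k3 : Rabs (c * (u - v)) <= eps / 2.
  rewrite Rabs_mult; apply: Rle_trans (_ : Rabs c * (eps / (2 * (Rabs c + 1))) <= _).
    by apply: Rmult_le_compat_l; [exact: Rabs_pos|lra].
  have E : (Rabs c + 1) * (eps / (2 * (Rabs c + 1))) = eps / 2.
    by field; have := Rabs_pos c; lra.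
  lra.
have /Rabs_def2 := k2; have /Rabs_bounds := k3 => k4 k5; apply: Rabs_def1; lra.
Qed.

Definition vconvex {N} (O : vec N -> Prop) :=
  forall a b t, O a -> O b -> 0 <= t <= 1 -> O (vcomb (1 - t) t a b).

Lemma strictly_convex_vconvex N (O : vec N -> Prop) : strictly_convex O -> vconvex O.
Proof.
move=> h a b t Oa Ob [t0 t1].
have [->|ab] := classic (a = b).
  by have -> : vcomb (1 - t) t b b = b by vext; ring.
have [->|tn0] := Req_dec t 0; first by have -> : vcomb (1 - 0) 0 a b = a by vext; ring.
have [->|tn1] := Req_dec t 1; first by have -> : vcomb (1 - 1) 1 a b = b by vext; ring.
by apply: h => //; try exact: vclos_self; lra.
Qed.

Lemma ball_convex N (x0 : vec N) r : vconvex (fun y => vnorm (vsub y x0) < r).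
Proof.
move=> a b t ha hb ht.
have -> : vsub (vcomb (1 - t) t a b) x0 = vadd (vscale (1 - t) (vsub a x0)) (vscale t (vsub b x0)).
  by vext; ring.
apply: Rle_lt_trans (vnormD _ _) _; rewrite !vnormZ !Rabs_pos_eq; try lra.
have [t0|t0] := Req_dec t 0; first by rewrite t0; lra.
have : t * vnorm (vsub b x0) < t * r by apply: Rmult_lt_compat_l; lra.
have : (1 - t) * vnorm (vsub a x0) <= (1 - t) * r by apply: Rmult_le_compat_l; lra.
lra.
Qed.

Lemma ball_open N (x0 : vec N) r : vopen_set (fun y => vnorm (vsub y x0) < r).
Proof.
move=> x hx; exists (r - vnorm (vsub x x0)); split=> [|y hy]; first lra.
have := vnorm_sub_tri y x x0; lra.
Qed.

Section Supersolution.
Variables (N : nat) (Om : vec N -> Prop) (mu : R) (psi : vec N -> R).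
Hypotheses (mu0 : 0 < mu) (psi_cont : cont_on Om psi) (psi_pos : forall x, Om x -> 0 < psi x).
Hypothesis psi_super : forall x p X, Om x -> subjet Om psi x p X ->
  forall w, quad X w <= - (mu * psi x) * dot w w.

(** A chord violating the inequality is touched from below, after tilting by a small convex
    parabola along the chord and a very concave one across it, inside a thin tube around it. *)
Lemma strong_concave (O : vec N -> Prop) m0 a b t :
  vopen_set O -> vconvex O -> (forall x, O x -> Om x) -> 0 <= m0 ->
  (forall x, O x -> m0 <= psi x) -> O a -> O b -> 0 <= t <= 1 ->
  (1 - t) * psi a + t * psi b + mu * m0 / 2 * (t * (1 - t)) * dot (vsub b a) (vsub b a)
   <= psi (vcomb (1 - t) t a b).
Proof.
move=> Oo Oc Osub m00 hm Oa Ob ht; apply: Rnot_lt_le => hlt.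
pose w := vsub b a; pose l2 := dot w w; pose ka := mu * m0.
have ka0 : 0 <= ka by apply: Rmult_le_pos; lra.
rewrite -/w -/l2 -/ka in hlt.
pose d := (1 - t) * psi a + t * psi b + ka / 2 * (t * (1 - t)) * l2 - psi (vcomb (1 - t) t a b).
have d0 : 0 < d by rewrite /d; lra.
have l20 : 0 < l2.
  have [h|h] := Rle_lt_or_eq_dec 0 l2 (dot_ge0 w); first exact: h.
  have w0 := dot_eq0 (esym h); have Eb : b = a.
    apply: functional_extensionality => i; have := f_equal (fun f => f i) w0.
    by rewrite /w /vsub /vzero; lra.
  move: d0; rewrite /d -h Eb; have -> : vcomb (1 - t) t a a = a by vext; ring.
  lra.
have [ra [ra0 hra]] := Oo a Oa; have [rb [rb0 hrb]] := Oo b Ob.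
have d4 : 0 < d / 4 by lra.
have [sa [sa0 hsa]] := psi_cont (Osub _ Oa) d4; have [sb [sb0 hsb]] := psi_cont (Osub _ Ob) d4.
pose rh := Rmin (Rmin ra rb) (Rmin sa sb) / 2.
have rh0 : 0 < rh.
  by apply: Rmult_lt_0_compat; [do 2 apply: Rmin_pos => //; apply: Rmin_pos|lra].
have rh1 : rh < ra /\ rh < rb /\ rh < sa /\ rh < sb.
  have := Rmin_l (Rmin ra rb) (Rmin sa sb); have := Rmin_r (Rmin ra rb) (Rmin sa sb).
  have := Rmin_l ra rb; have := Rmin_r ra rb; have := Rmin_l sa sb; have := Rmin_r sa sb.
  by move: rh0; rewrite /rh; lra.
have pa := psi_pos (Osub _ Oa); have pb := psi_pos (Osub _ Ob).
pose M := psi a + psi b + ka / 2 * l2.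
have kl : 0 <= ka / 2 * l2 by nra.
(* Makes the transverse penalty [K * q x] equal to [M + 1] on the lateral surface of the tube, more
   than the tilt along the chord can gain there. *)
pose K := (M + 1) / (rh * rh).
have K0 : 0 < K by apply: Rdiv_lt_0_compat; rewrite /M; nra.
have EK : K * (rh * rh) = M + 1 by rewrite /K; field; lra.
pose s x := dot (vscale (/ l2) w) (vsub x a).
pose q x := dot (vsub x a) (vsub x a) - s x * s x * l2.
pose Xq : mat N := mcomb 0 mzero 2 (- (2 / l2)) w.
have Xqs : Defs.symmetric Xq by apply: mcomb_sym; apply: mzero_sym.
have qE x : q x = qpol vzero Xq (vsub x a).
  by rewrite /q /s /qpol quad_mcomb dot0l dotZl; field; lra.
have sE x : s x = qpol (vscale (/ l2) w) mzero (vsub x a).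
  by rewrite /qpol quad_mzero /s; ring.
have sE' x : - s x = qpol (vscale (- / l2) w) mzero (vsub x a).
  by rewrite /qpol quad_mzero /s !dotZl; ring.
pose X : mat N := mcomb 0 mzero (ka + 2 * K) (- (2 * d / (l2 * l2) + 2 * K / l2)) w.
have Xs : Defs.symmetric X by apply: mcomb_sym; apply: mzero_sym.
pose e : vec N := vscale ((psi a - psi b - ka / 2 * l2 + d) / l2) w.
(* Here [s] runs from 0 at [a] to 1 at [b], and [q] is the squared distance to the line. The term
   [- d (s^2 - s)] vanishes at both ends and never exceeds [d / 4], less than the deficit [d], yet
   shifts the second derivative along [w] by [2 d]; this shift is the final contradiction. *)
have PE x : qpol e X (vsub x a) = ka / 2 * dot (vsub x a) (vsub x a)
   - s x * (psi b + ka / 2 * l2 - psi a) - d * (s x * s x - s x) + K * q x.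
  by rewrite /q /s /qpol quad_mcomb /e !dotZl; field; lra.
pose perp x := vsub (vsub x a) (vscale (s x) w).
have perpE x : dot (perp x) (perp x) = q x.
  rewrite /perp /q; have : dot w (vsub x a) = s x * l2 by rewrite /s dotZl; field; lra.
  move: (vsub x a) (s x) => u r hu.
  by rewrite !dotBl !dotBr !dotZl !dotZr (dotC u w) hu -/l2; ring.
pose T x := (- s x <= 0 /\ s x <= 1) /\ q x <= rh * rh.
(* A point of the tube lies on the chord translated by [perp x], whose ends stay in [O] by the
   choice of [rh]. *)
have TO x : T x -> O x.
  move=> [[s0 s1] hq].
  have hp : vnorm (perp x) <= rh by apply: vnorm_le; [lra|rewrite perpE].
  have Oa' : O (vadd a (perp x)) by apply: hra; rewrite vsub_addl; lra.
  have Ob' : O (vadd b (perp x)) by apply: hrb; rewrite vsub_addl; lra.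
  have := Oc _ _ (s x) Oa' Ob' (ltac:(lra)).
  by have -> // : vcomb (1 - s x) (s x) (vadd a (perp x)) (vadd b (perp x)) = x;
    rewrite /perp /w; vext; ring.
have Tcl : vclosed T.
  move=> x l hx hl; split; [split|].
  - by rewrite sE'; apply: (qpol_closed mzero_sym _ hl) => n; rewrite -sE'; have [[]] := hx n.
  - by rewrite sE; apply: (qpol_closed mzero_sym _ hl) => n; rewrite -sE; have [[]] := hx n.
  by rewrite qE; apply: (qpol_closed Xqs _ hl) => n; rewrite -qE; have [] := hx n.
have Tb x : T x -> vnorm x <= vnorm a + (vnorm w + rh).
  move=> [[s0 s1] hq].
  have hp : vnorm (perp x) <= rh by apply: vnorm_le; [lra|rewrite perpE].
  have -> : x = vadd a (vadd (vscale (s x) w) (perp x)) by rewrite /perp; vext; ring.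
  apply: Rle_trans (vnormD _ _) _; apply: Rplus_le_compat_l.
  apply: Rle_trans (vnormD _ _) _; rewrite vnormZ Rabs_pos_eq; last lra.
  by have := vnorm_ge0 w; nra.
pose xt := vcomb (1 - t) t a b.
have xta : vsub xt a = vscale t w by rewrite /xt /w; vext; ring.
have sxt : s xt = t by rewrite /s xta dotZl dotZr -/l2; field; lra.
have qxt : q xt = 0 by rewrite /q sxt xta dotZl dotZr -/l2; ring.
have Txt : T xt by split; rewrite ?sxt ?qxt; [lra|nra].
have Tcont : cont_on T psi.
  move=> x /TO/Osub Ox eps eps0; have [del [d1 hd]] := psi_cont Ox eps0.
  by exists del; split=> // y /TO/Osub; apply: hd.
have [x [Tx hmax]] := cont_max Tcl Tb (ex_intro _ xt Txt) (cont_on_qpol e a 1 Xs Tcont).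
have hmin y : T y -> psi x + qpol e X (vsub x a) <= psi y + qpol e X (vsub y a).
  by move=> /hmax; lra.
have low : psi x + qpol e X (vsub x a) <= psi a - 3 / 4 * d.
  apply: Rle_trans (hmin _ Txt) _; rewrite PE sxt qxt xta dotZl dotZr -/l2.
  have : d * (t - t * t) <= d * / 4.
    by apply: Rmult_le_compat_l; [lra|have := Rle_0_sqr (t - / 2); rewrite /Rsqr; lra].
  have Ed : psi xt = (1 - t) * psi a + t * psi b + ka / 2 * (t * (1 - t)) * l2 - d.
    by rewrite /d /xt; ring.
  by rewrite Ed; lra.
have Px := psi_pos (Osub _ (TO _ Tx)).
have q0 : 0 <= q x by rewrite -perpE; apply: dot_ge0.
have Edot : dot (vsub x a) (vsub x a) = q x + s x * s x * l2 by rewrite /q; ring.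
have [[s0 s1] hq] := Tx.
rewrite PE Edot in low.
have Kq : 0 <= K * q x by apply: Rmult_le_pos; lra.
have kq : 0 <= ka / 2 * q x by apply: Rmult_le_pos; lra.
(* The drop of [3/4 d] at the minimum excludes the two ends, where continuity of [psi] allows a drop
   of at most [d / 4], and then the lateral surface, where [K * q] is too large. *)
have snz : s x <> 0.
  move=> z; rewrite z in low.
  have hx : vnorm (vsub x a) < sa.
    by apply: Rle_lt_trans (_ : rh < _); [apply: vnorm_le; [lra|rewrite Edot z; lra]|lra].
  by have /Rabs_def2 := hsa x (Osub _ (TO _ Tx)) hx; lra.
have sno : s x <> 1.
  move=> z; rewrite z in low.
  have hx : vnorm (vsub x b) < sb.
    apply: Rle_lt_trans (_ : rh < _); last lra.
    apply: vnorm_le; first lra.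
    have -> : vsub x b = perp x by rewrite /perp z /w; vext; ring.
    by rewrite perpE.
  by have /Rabs_def2 := hsb x (Osub _ (TO _ Tx)) hx; lra.
have qlt : q x < rh * rh.
  have [//|h] := Rle_lt_or_eq_dec _ _ hq; rewrite h EK in low.
  have : 0 <= d * (s x - s x * s x) by apply: Rmult_le_pos; nra.
  have : 0 <= ka / 2 * (rh * rh + s x * s x * l2) by apply: Rmult_le_pos; nra.
  have : s x * (psi b + ka / 2 * l2) <= 1 * (psi b + ka / 2 * l2) by apply: Rmult_le_compat_r; lra.
  have : 0 <= s x * psi a by apply: Rmult_le_pos; lra.
  by rewrite h in kq; rewrite /M in low *; lra.
have [d1 [d10 h1]] : exists del, 0 < del /\ forall y, vnorm (vsub y x) < del -> - s y < 0.
  have := @qpol_open _ (vscale (- / l2) w) a mzero mzero_sym 0 x; rewrite -sE'.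
  by move=> /(_ (ltac:(lra))) [del [? hd]]; exists del; split=> // y /hd; rewrite -sE'.
have [d2 [d20 h2]] : exists del, 0 < del /\ forall y, vnorm (vsub y x) < del -> s y < 1.
  have := @qpol_open _ (vscale (/ l2) w) a mzero mzero_sym 1 x; rewrite -sE.
  by move=> /(_ (ltac:(lra))) [del [? hd]]; exists del; split=> // y /hd; rewrite -sE.
have [d3 [d30 h3]] : exists del, 0 < del /\ forall y, vnorm (vsub y x) < del -> q y < rh * rh.
  have := @qpol_open _ vzero a Xq Xqs (rh * rh) x; rewrite -qE.
  by move=> /(_ qlt) [del [? hd]]; exists del; split=> // y /hd; rewrite -qE.
pose del := Rmin d1 (Rmin d2 d3).
have del0 : 0 < del by do 2 apply: Rmin_pos => //; apply: Rmin_pos.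
have hj := min_subjet (O := Om) (u := psi) (x := x) (e := e) (a := a) Xs del0 (fun y _ hy =>
  hmin y (conj (conj (Rlt_le _ _ (h1 y (Rlt_le_trans _ _ _ hy (Rmin_l _ _))))
     (Rlt_le _ _ (h2 y (Rlt_le_trans _ _ _ hy (Rle_trans _ _ _ (Rmin_r _ _) (Rmin_l _ _))))))
     (Rlt_le _ _ (h3 y (Rlt_le_trans _ _ _ hy (Rle_trans _ _ _ (Rmin_r _ _) (Rmin_r _ _))))))).
have := psi_super (Osub _ (TO _ Tx)) hj w; rewrite quad_mopp quad_mcomb quad_mzero -/l2.
have -> : - (0 * 0 + (ka + 2 * K) * l2 + - (2 * d / (l2 * l2) + 2 * K / l2) * (l2 * l2)) =
  2 * d - ka * l2 by field; lra.
have : mu * m0 * l2 <= mu * psi x * l2.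
  by apply: Rmult_le_compat_r; [lra|apply: Rmult_le_compat_l; [lra|apply: hm; apply: TO]].
rewrite -/ka; lra.
Qed.
End Supersolution.

Lemma le_of_lim a b c : 0 < c -> (forall t, 0 < t < c -> a <= b + t) -> a <= b.
Proof.
move=> c0 h; apply: le_epsilon => e e0.
have h1 := Rmin_l (e / 2) (c / 2); have h2 := Rmin_r (e / 2) (c / 2).
have h3 : 0 < Rmin (e / 2) (c / 2) by apply: Rmin_pos; lra.
have := h (Rmin (e / 2) (c / 2)); lra.
Qed.

(** * Supergradients of concave functions and the upper expansion of the eigenfunction *)

Section Supergradient.
Variables (N : nat) (x0 : vec N) (r : R) (F : vec N -> R) (M : R).
Hypotheses (r0 : 0 < r) (M0 : 0 < M).
Hypothesis F_concave : forall a b t, vnorm (vsub a x0) <= r -> vnorm (vsub b x0) <= r ->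
  0 <= t <= 1 -> (1 - t) * F a + t * F b <= F (vcomb (1 - t) t a b).
Hypothesis F_bound : forall x, vnorm (vsub x x0) <= r -> 0 <= F x.
Hypothesis F_at : F x0 <= M.
Hypothesis F_cont : cont_on (fun x => vnorm (vsub x x0) <= r) F.

(** A minimizer [x] of [F + n |y - x0|^2] is a point where a parabola of slope [q = - 2 n (x - x0)]
    touches [F] from below. Stepping from [x] slightly away from [y] and using concavity turns [q]
    into a supergradient at [x], the error being quadratic in the step. Large [n] brings [x] within
    [dl] of [x0], while the bound on [q], read off at distance [r / 2] where [F >= 0], does not
    depend on [n]. *)
Lemma approx_supergradient eps : 0 < eps -> exists q, vnorm q <= (INR N + 1) * (2 * M / r) /\
  forall y, vnorm (vsub y x0) <= r -> F y <= F x0 + dot q (vsub y x0) + eps.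
Proof.
move=> eps0.
pose Cq := (INR N + 1) * (2 * M / r).
have Cq0 : 0 < Cq.
  by apply: Rmult_lt_0_compat; [have := pos_INR N; lra|apply: Rdiv_lt_0_compat; lra].
pose dl := Rmin (r / 2) (eps / Cq).
have dl0 : 0 < dl by apply: Rmin_pos; [lra|apply: Rdiv_lt_0_compat].
pose n := M / (dl * dl) + 1.
have dd0 : 0 < dl * dl by nra.
have n0 : 0 < n by have := Rdiv_lt_0_compat _ _ M0 dd0; rewrite /n; lra.
pose X : mat N := mcomb 0 mzero (2 * n) 0 vzero.
have Xs : Defs.symmetric X by apply: mcomb_sym; apply: mzero_sym.
have XE h : qpol vzero X h = n * dot h h by rewrite /qpol quad_mcomb dot0l; field.
have Bcl : vclosed (fun x => vnorm (vsub x x0) <= r).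
  move=> x l hx hl; apply: le_epsilon => e e0; have [n1 hn] := hl e e0.
  have := vnorm_sub_tri l (x n1) x0; have := hx n1; have := hn n1 (leqnn _).
  by rewrite vnorm_subC; lra.
have Bb x : vnorm (vsub x x0) <= r -> vnorm x <= vnorm x0 + r.
  by move=> h; have := vnormD x0 (vsub x x0); rewrite vadd_subK; lra.
have Bx0 : vnorm (vsub x0 x0) <= r by rewrite vsubxx vnorm0; lra.
have [x [Bx hmax]] := cont_max Bcl Bb (ex_intro _ x0 Bx0) (cont_on_qpol vzero x0 1 Xs F_cont).
have hmin y : vnorm (vsub y x0) <= r ->
    F x + n * dot (vsub x x0) (vsub x x0) <= F y + n * dot (vsub y x0) (vsub y x0).
  by move=> /hmax; rewrite !XE; lra.
have hx0 := hmin x0 Bx0; rewrite vsubxx dot0l in hx0.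
have Fx := F_bound Bx.
have xd : vnorm (vsub x x0) < dl.
  apply: vnorm_lt => //; apply: (Rmult_lt_reg_l n) => //.
  have : n * (dl * dl) = M + dl * dl by rewrite /n; field; lra.
  lra.
have dl1 : dl <= r / 2 := Rmin_l _ _. have dl2 : dl <= eps / Cq := Rmin_r _ _.
pose q := vscale (- 2 * n) (vsub x x0).
have sup y : vnorm (vsub y x0) <= r -> F y <= F x + dot q (vsub y x).
  move=> hy; pose h := vsub y x.
  have [W [W0 hW]] : exists W, 0 < W /\ vnorm h < W by exists (vnorm h + 1); have := vnorm_ge0 h; lra.
  have dh := dot_ge0 h.
  have nW : 0 < 1 / (n * dot h h + 1) by apply: Rdiv_lt_0_compat; nra.
  have c0 : 0 < r / 2 / W by apply: Rdiv_lt_0_compat; lra.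
  apply: (@le_of_lim _ _ (r / 2 / W * (n * dot h h + 1))); first by apply: Rmult_lt_0_compat; nra.
  move=> t' [t'0 t'1]; pose t := t' / (n * dot h h + 1).
  have nd : 0 < n * dot h h + 1 by nra.
  have t0 : 0 < t by apply: Rdiv_lt_0_compat.
  have Et : t * (n * dot h h + 1) = t' by rewrite /t; field; lra.
  have t1 : t < r / 2 / W by apply: (Rmult_lt_reg_r (n * dot h h + 1)) => //; rewrite Et.
  have tW : t * W < r / 2.
    have -> : r / 2 = r / 2 / W * W by field; lra.
    exact: Rmult_lt_compat_r.
  pose z := vadd x (vscale (- t) h).
  have Bz : vnorm (vsub z x0) <= r.
    have -> : vsub z x0 = vadd (vsub x x0) (vscale (- t) h) by rewrite /z; vext; ring.
    apply: Rle_trans (vnormD _ _) _; rewrite vnormZ Rabs_Ropp Rabs_pos_eq; last lra.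
    have : t * vnorm h <= t * W by apply: Rmult_le_compat_l; lra.
    lra.
  have hz := hmin z Bz.
  have Ez : dot (vsub z x0) (vsub z x0) =
     dot (vsub x x0) (vsub x x0) - 2 * t * dot (vsub x x0) h + t * t * dot h h.
    have -> : vsub z x0 = vadd (vsub x x0) (vscale (- t) h) by rewrite /z; vext; ring.
    by move: (vsub x x0) (h) => u k; rewrite !dotDl !dotDr !dotZl !dotZr (dotC k u); ring.
  rewrite Ez in hz.
  have ht1 : 0 <= t / (1 + t) <= 1.
    split; first by apply: Rlt_le; apply: Rdiv_lt_0_compat; lra.
    by apply: (Rmult_le_reg_r (1 + t)); first lra; rewrite /Rdiv Rmult_assoc Rinv_l; lra.
  have := F_concave Bz hy ht1.
  have -> : vcomb (1 - t / (1 + t)) (t / (1 + t)) z y = x.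
    by rewrite /z /h; vext; field; lra.
  move=> hc; have hc' : F z + t * F y <= (1 + t) * F x.
    have := Rmult_le_compat_l (1 + t) _ _ (ltac:(lra)) hc.
    have -> // : (1 + t) * ((1 - t / (1 + t)) * F z + t / (1 + t) * F y) = F z + t * F y.
    by field; lra.
  have Eq : dot q h = - 2 * n * dot (vsub x x0) h by rewrite /q dotZl.
  apply: (Rmult_le_reg_l t) => //; rewrite -/h Eq -Et.
  move: hz hc'; move: (dot (vsub x x0) h) (dot h h) (dot (vsub x x0) (vsub x x0)) dh => u v w v0 hz hc'.
  have : 0 <= t * t by nra.
  nra.
have qc l : Rabs (q l) <= 2 * M / r.
  have key a : Rabs a = r / 2 -> - (a * q l) <= M.
    move=> ha; have := sup (vadd x (vscale a (unitv l))).
    rewrite vsub_addl dotZr dot_unitr => hs.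
    have B1 : vnorm (vsub (vadd x (vscale a (unitv l))) x0) <= r.
      have -> : vsub (vadd x (vscale a (unitv l))) x0 = vadd (vsub x x0) (vscale a (unitv l)) by vext; ring.
      apply: Rle_trans (vnormD _ _) _; rewrite vnormZ ha.
      have -> : vnorm (unitv l) = 1 by rewrite /vnorm dot_unitl unitvv sqrt_1.
      lra.
    have := hs B1; have := F_bound B1; have := dot_ge0 (vsub x x0).
    have : 0 <= n * dot (vsub x x0) (vsub x x0) by apply: Rmult_le_pos; [lra|exact: dot_ge0].
    lra.
  have r2 : 0 <= r / 2 by lra.
  have k1 := key (r / 2) (Rabs_pos_eq _ r2).
  have k2 := key (- (r / 2)) (eq_trans (Rabs_Ropp _) (Rabs_pos_eq _ r2)).
  apply: Rabs_le; split; apply: (Rmult_le_reg_r (r / 2)); try lra.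
    have -> : - (2 * M / r) * (r / 2) = - M by field; lra.
    lra.
  have -> : 2 * M / r * (r / 2) = M by field; lra.
  lra.
have qn : vnorm q <= Cq.
  apply: vnorm_le; first lra.
  apply: Rle_trans (dot_sup_le qc) _; rewrite /Cq.
  have := pos_INR N; have : 0 < 2 * M / r by apply: Rdiv_lt_0_compat; lra.
  move: (2 * M / r) (INR N) => u v u0 v0.
  have : 0 <= u * u by nra.
  nra.
exists q; split=> // y hy; have := sup y hy.
have -> : vsub y x = vadd (vsub y x0) (vscale (-1) (vsub x x0)) by vext; ring.
rewrite dotDr dotZr; have := dot_le_vnorm q (vsub x x0) => h1 h2.
have h3 : vnorm q * vnorm (vsub x x0) <= eps.
  have -> : eps = Cq * (eps / Cq) by field; lra.
  by apply: Rmult_le_compat; [exact: vnorm_ge0|exact: vnorm_ge0| |]; lra.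
have : 0 <= n * dot (vsub x x0) (vsub x x0) by apply: Rmult_le_pos; [lra|exact: dot_ge0].
by have := Rabs_bounds h1; lra.
Qed.

(** The approximate slopes are bounded uniformly in [eps], so a subsequence converges. *)
Lemma supergradient_exists : exists q, forall y, vnorm (vsub y x0) <= r ->
  F y <= F x0 + dot q (vsub y x0).
Proof.
have pos (n : nat) : 0 < / INR n.+1 by apply: Rinv_0_lt_compat; apply: lt_0_INR; apply/ltP.
have /choice [q hq] := fun n : nat => approx_supergradient (pos n).
have [s [l [hs hl]]] := bounded_subseq_vec (fun n => proj1 (hq n)).
exists l => y hy; apply: le_epsilon => e e0.
have W0 := vnorm_ge0 (vsub y x0).
have e1 : 0 < e / 2 / (vnorm (vsub y x0) + 1) by apply: Rdiv_lt_0_compat; lra.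
have [n1 h1] := hl _ e1; have [n2 h2] := inv_INR_lt (ltac:(lra) : 0 < e / 2).
have k1 := h1 _ (leq_maxl n1 n2).
have k2 := h2 _ (leq_trans (leq_maxr n1 n2) (incr_ge _ hs)).
have k3 := proj2 (hq (s (maxn n1 n2))) y hy.
have k4 := dot_le_vnorm (vsub (q (s (maxn n1 n2))) l) (vsub y x0).
rewrite dotBl in k4; rewrite /comp in k1.
have k5 : vnorm (vsub (q (s (maxn n1 n2))) l) * vnorm (vsub y x0) <= e / 2.
  have E : e / 2 = e / 2 / (vnorm (vsub y x0) + 1) * (vnorm (vsub y x0) + 1) by field; lra.
  by rewrite E; apply: Rmult_le_compat; [exact: vnorm_ge0|exact: vnorm_ge0|lra|lra].
have := Rabs_bounds k4; lra.
Qed.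
End Supergradient.

Section PsiUpper.
Variables (N : nat) (Om : vec N -> Prop) (mu : R) (psi : vec N -> R).
Hypotheses (Om_open : vopen_set Om).
Hypotheses (mu0 : 0 < mu) (psi_cont : cont_on Om psi) (psi_pos : forall x, Om x -> 0 < psi x).
Hypothesis psi_super : forall x p X, Om x -> subjet Om psi x p X ->
  forall w, quad X w <= - (mu * psi x) * dot w w.

(** On a small ball [psi > psi x0 - e], and [strong_concave] makes
    [psi + mu (psi x0 - e) / 2 |y - x0|^2] concave there; its supergradient at [x0] is the required
    slope. *)
Lemma eigenfunction_upper x0 e : Om x0 -> 0 < e < psi x0 -> exists q del, 0 < del /\
  forall y, vnorm (vsub y x0) < del ->
    psi y <= psi x0 + dot q (vsub y x0) - mu * (psi x0 - e) / 2 * dot (vsub y x0) (vsub y x0).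
Proof.
move=> Ox0 [e0 e1].
have [r1 [r10 hr1]] := Om_open Ox0; have [r2 [r20 hr2]] := psi_cont Ox0 e0.
pose rr := Rmin r1 r2; have rr0 : 0 < rr by apply: Rmin_pos.
pose O y := vnorm (vsub y x0) < rr.
have Osub x : O x -> Om x by move=> h; apply: hr1; apply: Rlt_le_trans h (Rmin_l _ _).
have near x : O x -> psi x0 - e < psi x < psi x0 + e.
  move=> h; have := hr2 x (Osub x h) (Rlt_le_trans _ _ _ h (Rmin_r _ _)).
  by move=> /Rabs_def2; lra.
pose ka := mu * (psi x0 - e); have ka0 : 0 < ka by apply: Rmult_lt_0_compat; lra.
pose F y := psi y + ka / 2 * dot (vsub y x0) (vsub y x0).
pose X : mat N := mcomb 0 mzero (- ka) 0 vzero.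
have Xs : Defs.symmetric X by apply: mcomb_sym; apply: mzero_sym.
have XE h : qpol vzero X h = - (ka / 2 * dot h h) by rewrite /qpol quad_mcomb dot0l; field.
have hO x : vnorm (vsub x x0) <= rr / 2 -> O x by rewrite /O; lra.
have Fx0 : F x0 = psi x0 by rewrite /F vsubxx dot0l; ring.
have [q hq] : exists q, forall y, vnorm (vsub y x0) <= rr / 2 -> F y <= F x0 + dot q (vsub y x0).
  apply: (@supergradient_exists _ x0 (rr / 2) F (psi x0)); try lra.
  - move=> a b t /hO Oa /hO Ob ht.
    have := strong_concave mu0 psi_cont psi_pos psi_super (m0 := psi x0 - e) (@ball_open _ x0 rr)
      (@ball_convex _ x0 rr) Osub (ltac:(lra)) (fun x Ox => Rlt_le _ _ (proj1 (near x Ox))) Oa Ob ht.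
    rewrite /F -/ka.
    have -> : vsub b a = vadd (vsub b x0) (vscale (-1) (vsub a x0)) by vext; ring.
    have -> : vsub (vcomb (1 - t) t a b) x0 =
       vadd (vscale (1 - t) (vsub a x0)) (vscale t (vsub b x0)) by vext; ring.
    move: (vsub b x0) (vsub a x0) => u v; rewrite !dotDl !dotDr !dotZl !dotZr (dotC v u); lra.
  - move=> x /hO Ox; rewrite /F; have := psi_pos (Osub x Ox); have := dot_ge0 (vsub x x0); nra.
  move=> x /hO Ox eps eps0.
  have c1 : cont_on O psi.
    by move=> y Oy ep ep0; have [d [d0 hd]] := psi_cont (Osub y Oy) ep0;
       exists d; split=> // z /Osub; apply: hd.
  have [d [d0 hd]] := cont_on_qpol vzero x0 (-1) Xs c1 Ox eps0.
  exists d; split=> // y /hO Oy hy; have := hd y Oy hy; rewrite !XE /F.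
  by move=> /Rabs_def2 => -[a1 a2]; apply: Rabs_def1; lra.
exists q, (rr / 2); split; first lra.
by move=> y hy; have := hq y (Rlt_le _ _ hy); rewrite Fx0 /F -/ka; lra.
Qed.
End PsiUpper.

(** * Boundary behaviour *)

(** The gradient is bounded by compactness of the closure, and convexity keeps segments inside for
    the mean value theorem. *)
Lemma C1_lipschitz N (Om : vec N -> Prop) v : vconvex Om -> vbounded Om -> C1_closure Om v ->
  exists L, 0 <= L /\ forall x y, Om x -> Om y -> Rabs (v y - v x) <= L * vnorm (vsub y x).
Proof.
move=> Oc [M0 hM0] [_ [Du [hDu hv]]].
have [[o Oo]|no] := classic (exists x, Om x); last first.
  by exists 0; split=> [|x y Ox]; [lra|case: no; exists x].
have hb k : exists m, 0 <= m /\ forall x, vclos Om x -> Rabs (Du x k) <= m.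
  have c : cont_on (vclos Om) (fun x => Rabs (Du x k)).
    move=> x hx eps eps0; have [d [d0 hd]] := hDu k x hx eps eps0; exists d; split=> // y hy hyx.
    exact: Rle_lt_trans (Rabs_triang_inv2 _ _) (hd y hy hyx).
  have [l [_ hl]] := cont_max (@vclosed_vclos _ Om) (vclos_bound hM0) (ex_intro _ o (vclos_self Oo)) c.
  by exists (Rabs (Du l k)); split=> //; exact: Rabs_pos.
have [m hm] := choice _ hb.
pose L := (INR N + 1) * \big[Rplus/0]_(k < N) m k.
have S0 : 0 <= \big[Rplus/0]_(k < N) m k by apply: sum_ge0 => k _; exact: (proj1 (hm k)).
have n0 := pos_INR N.
have DuL x : Om x -> vnorm (Du x) <= L.
  move=> Ox; apply: vnorm_le; first by apply: Rmult_le_pos; lra.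
  apply: Rle_trans (dot_sup_le (c := \big[Rplus/0]_(k < N) m k) _) _.
    move=> k; apply: Rle_trans (proj2 (hm k) x (vclos_self Ox)) _.
    by apply: term_le_sum => k'; exact: (proj1 (hm k')).
  rewrite /L; move: (bigop _ _ _) (INR N) S0 n0 => u w u0 w0.
  have : 0 <= u * u by nra.
  nra.
exists L; split=> [|x y Ox Oy]; first by apply: Rmult_le_pos; lra.
pose w := vsub y x; pose ph t := v (vadd x (vscale t w)).
have Oseg t : 0 <= t <= 1 -> Om (vadd x (vscale t w)).
  move=> ht; have := Oc _ _ _ Ox Oy ht.
  by have -> // : vcomb (1 - t) t x y = vadd x (vscale t w) by rewrite /w; vext; ring.
have w0 := vnorm_ge0 w.
have der c : 0 <= c <= 1 -> derivable_pt_lim ph c (dot (Du (vadd x (vscale c w))) w).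
  move=> hc eps eps0; set xc := vadd x (vscale c w).
  have e1 : 0 < eps / 2 / (vnorm w + 1) by apply: Rdiv_lt_0_compat; lra.
  have [d [d0 hd]] := hv _ (Oseg c hc) _ e1.
  have d1 : 0 < d / (vnorm w + 1) by apply: Rdiv_lt_0_compat; lra.
  exists (mkposreal _ d1) => h hn /= hh.
  have Eh : vsub (vadd x (vscale (c + h) w)) xc = vscale h w by rewrite /xc; vext; ring.
  have := hd (vadd x (vscale (c + h) w)); rewrite Eh vnormZ dotZr => hd'.
  have hp := Rabs_pos_lt _ hn.
  have hlt : Rabs h * vnorm w < d.
    have E : d / (vnorm w + 1) * (vnorm w + 1) = d by field; lra.
    have : Rabs h * (vnorm w + 1) < d by rewrite -E; apply: Rmult_lt_compat_r; lra.
    nra.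
  have := hd' hlt; rewrite -/(ph (c + h)) -/(ph c) => hb1.
  have -> : (ph (c + h) - ph c) / h - dot (Du xc) w = (ph (c + h) - ph c - h * dot (Du xc) w) * / h.
    by field.
  rewrite Rabs_mult Rabs_inv; apply: (Rmult_lt_reg_r (Rabs h)) => //.
  rewrite Rmult_assoc Rinv_l; last lra.
  rewrite Rmult_1_r; apply: Rle_lt_trans hb1 _.
  have E : eps / 2 / (vnorm w + 1) * (vnorm w + 1) = eps / 2 by field; lra.
  have : eps / 2 / (vnorm w + 1) * vnorm w <= eps / 2 by rewrite -{2}E; apply: Rmult_le_compat_l; lra.
  nra.
have [c [hc1 hc2]] := MVT_cor2 ph _ 0 1 Rlt_0_1 der.
have Ey : ph 1 = v y by rewrite /ph; congr v; rewrite /w; vext; ring.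
have Ex : ph 0 = v x by rewrite /ph; congr v; vext; ring.
rewrite -Ey -Ex hc1 -/w Rminus_0_r Rmult_1_r.
apply: Rle_trans (dot_le_vnorm _ _) _; apply: Rmult_le_compat_r => //.
by apply: DuL; apply: Oseg; lra.
Qed.

Lemma exit_point N (Om : vec N -> Prop) o x : vopen_set Om -> vconvex Om -> vbounded Om ->
  Om o -> Om x -> o <> x -> exists S, 1 < S /\ vboundary Om (vadd o (vscale S (vsub x o))) /\
  forall s, 0 <= s < S -> Om (vadd o (vscale s (vsub x o))).
Proof.
move=> Oo Oc [M hM] Ho Hx nox; pose w := vsub x o.
pose E s := 0 <= s /\ Om (vadd o (vscale s w)).
have wp : 0 < vnorm w.
  have [//|h] := Rle_lt_or_eq_dec _ _ (vnorm_ge0 w); case: nox.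
  have w0 : w = vzero by apply: dot_eq0; rewrite -vnorm_sqr -h; ring.
  by rewrite -(vadd_subK o x) -/w w0 vadd0.
have E1 : E 1.
  split; first lra.
  by have -> : vadd o (vscale 1 w) = x by rewrite /w; vext; ring.
have bE : bound E.
  exists ((M + vnorm o) / vnorm w) => s [s0 hs].
  apply: (Rmult_le_reg_r (vnorm w)) => //.
  have -> : (M + vnorm o) / vnorm w * vnorm w = M + vnorm o by field; lra.
  have := hM _ hs; have := vnormD (vadd o (vscale s w)) (vscale (-1) o).
  have -> : vadd (vadd o (vscale s w)) (vscale (-1) o) = vscale s w by vext; ring.
  rewrite !vnormZ (Rabs_pos_eq s) // Rabs_Ropp Rabs_R1; lra.
have [S [S1 S2]] := completeness E bE (ex_intro _ 1 E1).
have dist a b : vnorm (vsub (vadd o (vscale a w)) (vadd o (vscale b w))) = Rabs (a - b) * vnorm w.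
  by rewrite -vnormZ; congr vnorm; vext; ring.
have opn s : E s -> exists s', s < s' /\ E s'.
  move=> [s0 hs]; have [r [r0 hr]] := Oo _ hs.
  have e0 : 0 < r / 2 / vnorm w by apply: Rdiv_lt_0_compat; lra.
  exists (s + r / 2 / vnorm w); split; first lra.
  split; first lra; apply: hr; rewrite dist.
  have -> : s + r / 2 / vnorm w - s = r / 2 / vnorm w by ring.
  rewrite Rabs_pos_eq; last lra.
  have -> : r / 2 / vnorm w * vnorm w = r / 2 by field; lra.
  lra.
have seg s : 0 <= s < S -> Om (vadd o (vscale s w)).
  move=> [s0 sS]; have [s' [[s'0 hs'] ss']] : exists s', E s' /\ s < s'.
    apply: NNPP => hn; have : S <= s; last lra.
    by apply: S2 => s' hs'; apply: Rnot_lt_le => h; apply: hn; exists s'.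
  have ht : 0 <= s / s' <= 1.
    have s'p : 0 < s' by lra.
    split; apply: (Rmult_le_reg_r s') => //; rewrite /Rdiv Rmult_assoc Rinv_l; lra.
  have := Oc _ _ _ Ho hs' ht.
  by have -> // : vcomb (1 - s / s') (s / s') o (vadd o (vscale s' w)) = vadd o (vscale s w);
    vext; field; lra.
have Sgt1 : 1 < S by have [s' [h /S1]] := opn 1 E1; lra.
have S0 : 0 <= S by lra.
exists S; split=> //; split=> //; split; last first.
  move=> hS; have [s' [h /S1]] := opn S (conj S0 hS); lra.
move=> eps eps0; pose s := Rmax 0 (S - eps / 2 / vnorm w).
have ew : 0 < eps / 2 / vnorm w by apply: Rdiv_lt_0_compat; lra.
have hs : 0 <= s < S by rewrite /s; split; [exact: Rmax_l|apply: Rmax_lub_lt; lra].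
exists (vadd o (vscale s w)); split; first exact: seg.
rewrite dist.
have : Rabs (s - S) <= eps / 2 / vnorm w.
  by have := Rmax_r 0 (S - eps / 2 / vnorm w); rewrite -/s => h; rewrite Rabs_left1; lra.
have E2 : eps / 2 / vnorm w * vnorm w = eps / 2 by field; lra.
nra.
Qed.

(** Along the ray from a fixed centre through [x], concavity bounds [psi x] from below by a
    multiple of the distance from [x] to the exit point, where [d] vanishes. *)
Lemma hopf_bound N (Om : vec N -> Prop) (psi d : vec N -> R) L :
  vopen_set Om -> vconvex Om -> vbounded Om -> (exists x, Om x) ->
  (forall x, Om x -> 0 < psi x) ->
  (forall a b t, Om a -> Om b -> 0 <= t <= 1 ->
     (1 - t) * psi a + t * psi b <= psi (vcomb (1 - t) t a b)) ->
  0 <= L -> (forall x y, Om x -> Om y -> Rabs (d y - d x) <= L * vnorm (vsub y x)) ->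
  cont_on (vclos Om) d -> (forall x, vboundary Om x -> d x = 0) ->
  exists C, 0 < C /\ forall x, Om x -> Rabs (d x) <= C * psi x.
Proof.
move=> Oo Oc Ob [o Ho] ppos pconc L0 dL dc db.
have [M hM] := Ob.
have M0 : 0 <= M by apply: Rle_trans (vnorm_ge0 o) (hM o Ho).
have po := ppos o Ho.
pose C1 := Rabs (d o) / psi o; pose C2 := L * (2 * M) / psi o.
have C10 : 0 <= C1.
  apply: Rmult_le_pos; first exact: Rabs_pos.
  by apply: Rlt_le; apply: Rinv_0_lt_compat.
have C20 : 0 <= C2.
  apply: Rmult_le_pos; first by repeat apply: Rmult_le_pos; lra.
  by apply: Rlt_le; apply: Rinv_0_lt_compat.
exists (C1 + C2 + 1); split=> [|x Hx]; first lra.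
have px := ppos x Hx.
have [<-|nox] := classic (o = x).
  have -> : Rabs (d o) = C1 * psi o by rewrite /C1; field; lra.
  by apply: Rmult_le_compat_r; lra.
have [S [S1 [hb hseg]]] := exit_point Oo Oc Ob Ho Hx nox.
set w := vsub x o in hb hseg; set b := vadd o (vscale S w) in hb.
have w0 := vnorm_ge0 w.
have wS : S * vnorm w <= 2 * M.
  have bM := vclos_bound hM (proj1 hb); have oM := hM o Ho.
  have := vnormD b (vscale (-1) o).
  have -> : vadd b (vscale (-1) o) = vscale S w by rewrite /b; vext; ring.
  rewrite !vnormZ (Rabs_pos_eq S); last lra.
  by rewrite Rabs_Ropp Rabs_R1; lra.
have d1 : Rabs (d x) <= L * ((S - 1) * vnorm w).
  apply: le_epsilon => e e0.
  have e2 : 0 < e / 2 by lra.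
  have [dl [dl0 hdl]] := dc b (proj1 hb) _ e2.
  (* The Lipschitz bound holds only inside the domain, so the exit point is replaced by a point of
     the ray just before it, where continuity makes [d] small. *)
  pose eta := Rmin (S - 1) (dl / 2 / (vnorm w + 1)).
  have eta0 : 0 < eta by apply: Rmin_pos; [lra|repeat apply: Rdiv_lt_0_compat; lra].
  have etaS : eta <= S - 1 := Rmin_l _ _.
  have etad : eta * vnorm w < dl.
    have h := Rmin_r (S - 1) (dl / 2 / (vnorm w + 1)); rewrite -/eta in h.
    have E : dl / 2 / (vnorm w + 1) * (vnorm w + 1) = dl / 2 by field; lra.
    have : eta * (vnorm w + 1) <= dl / 2 by rewrite -E; apply: Rmult_le_compat_r; lra.
    nra.
  pose y := vadd o (vscale (S - eta) w).
  have Hy : Om y by apply: hseg; lra.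
  have ybn : vnorm (vsub y b) < dl.
    have -> : vsub y b = vscale (- eta) w by rewrite /y /b; vext; ring.
    by rewrite vnormZ Rabs_Ropp Rabs_pos_eq; lra.
  have h1 := hdl y (vclos_self Hy) ybn; rewrite (db b hb) in h1.
  have h2 := dL y x Hy Hx.
  have E : vnorm (vsub x y) = (S - eta - 1) * vnorm w.
    have -> : vsub x y = vscale (- (S - eta - 1)) w by rewrite /y /w; vext; ring.
    by rewrite vnormZ Rabs_Ropp Rabs_pos_eq; lra.
  rewrite E in h2.
  have h3 : L * ((S - eta - 1) * vnorm w) <= L * ((S - 1) * vnorm w).
    by apply: Rmult_le_compat_l => //; apply: Rmult_le_compat_r; lra.
  by move: h1 h2; split_Rabs; lra.
(* [x] is a convex combination of [o] and the point at parameter [s < S]; dropping the positive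
   value there and letting [s] tend to [S] gives the bound. *)
have p1 : (S - 1) * psi o <= S * psi x.
  apply: (@le_of_lim _ _ ((S - 1) * psi o)); first by apply: Rmult_lt_0_compat; lra.
  move=> t [t0 t1].
  pose s := S - t / psi o.
  have tp : 0 < t / psi o by apply: Rdiv_lt_0_compat.
  have ts : t / psi o < S - 1.
    apply: (Rmult_lt_reg_r (psi o)) => //.
    by have -> : t / psi o * psi o = t by field; lra.
  have Et : t / psi o * psi o = t by field; lra.
  have sp : 1 < s by rewrite /s; lra.
  have Hs : Om (vadd o (vscale s w)) by apply: hseg; rewrite /s; lra.
  have ht : 0 <= / s <= 1.
    split; first by apply: Rlt_le; apply: Rinv_0_lt_compat; lra.
    by rewrite -Rinv_1; apply: Rinv_le_contravar; lra.
  have := pconc _ _ _ Ho Hs ht; have ps := ppos _ Hs.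
  have -> : vcomb (1 - / s) (/ s) o (vadd o (vscale s w)) = x by rewrite /w; vext; field; lra.
  move=> h; have h1 : (1 - / s) * psi o <= psi x.
    have : 0 < / s * psi (vadd o (vscale s w)).
      by apply: Rmult_lt_0_compat => //; apply: Rinv_0_lt_compat; lra.
    lra.
  have h2 := Rmult_le_compat_l s _ _ (ltac:(lra)) h1.
  have E : s * ((1 - / s) * psi o) = (s - 1) * psi o by field; lra.
  rewrite E in h2.
  have : s * psi x <= S * psi x by apply: Rmult_le_compat_r; rewrite /s; lra.
  have : (s - 1) * psi o = (S - 1) * psi o - t by rewrite /s -{2}Et; ring.
  lra.
apply: Rle_trans d1 _.
apply: Rle_trans (_ : C2 * psi x <= _); last by apply: Rmult_le_compat_r; lra.
have h1 : (S - 1) * vnorm w * psi o <= 2 * M * psi x.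
  apply: Rle_trans (_ : S * psi x * vnorm w <= _).
    by have := Rmult_le_compat_r _ _ _ w0 p1; lra.
  have -> : S * psi x * vnorm w = S * vnorm w * psi x by ring.
  by apply: Rmult_le_compat_r; lra.
apply: (Rmult_le_reg_r (psi o)) => //.
have -> : C2 * psi x * psi o = L * (2 * M * psi x) by rewrite /C2; field; lra.
by rewrite Rmult_assoc; apply: Rmult_le_compat_l.
Qed.

(** * Comparison *)

Section Cylinder.
Variables (N : nat) (Om : vec N -> Prop) (M0 T : R).
Hypotheses (T0 : 0 < T) (Om_ne : exists x, Om x) (Om_b : forall x, vclos Om x -> vnorm x <= M0).
Implicit Types G : vec N -> R -> R.

Definition in_cyl (w : vec N * R) := vclos Om w.1 /\ 0 <= w.2 <= T.

Definition cont_cyl G := forall y t, vclos Om y -> 0 <= t <= T -> forall eps, 0 < eps ->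
  exists del, 0 < del /\ forall y' t', vclos Om y' -> 0 <= t' <= T ->
    vnorm (vsub y' y) < del -> Rabs (t' - t) < del -> Rabs (G y' t' - G y t) < eps.

Let conv (x : nat -> vec N * R) (l : vec N * R) := forall e, 0 < e -> exists n0, forall n, (n0 <= n)%N ->
  vnorm (vsub (x n).1 l.1) < e /\ Rabs ((x n).2 - l.2) < e.

Lemma compact_cyl (x : nat -> vec N * R) : (forall n, in_cyl (x n)) ->
  exists s l, incr s /\ in_cyl l /\ conv (x \o s) l.
Proof.
move=> hx; have [s [y [hs [hy ly]]]] := compact_vec (@vclosed_vclos _ Om) Om_b (fun n => proj1 (hx n)).
have tb n : Rabs ((x (s n)).2) <= T by have [_ h] := hx (s n); apply: Rabs_le; lra.
have [s' [t [hs' lt]]] := bounded_subseq tb.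
exists (s \o s'), (y, t); split; first exact: incr_comp.
split; last first.
  move=> e e0; have [n1 h1] := ly e e0; have [n2 h2] := lt e e0; exists (maxn n1 n2) => n.
  rewrite geq_max => /andP[a b]; split; last exact: h2.
  by apply: h1; apply: leq_trans a (incr_ge _ hs').
split=> //=; split; apply: le_epsilon => e /lt [n0 /(_ n0 (leqnn _)) /Rabs_def2 h];
  have [_] := hx (s (s' n0)); lra.
Qed.

Lemma cyl_max G c x : cont_cyl G -> exists w, in_cyl w /\ forall w', in_cyl w' ->
  G w'.1 w'.2 - c * dot (vsub x w'.1) (vsub x w'.1) <= G w.1 w.2 - c * dot (vsub x w.1) (vsub x w.1).
Proof.
move=> hG; pose X : mat N := mcomb 0 mzero 2 0 vzero.
have Xs : Defs.symmetric X by apply: mcomb_sym; apply: mzero_sym.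
have XE y : dot (vsub x y) (vsub x y) = qpol vzero X (vsub y x).
  by rewrite -!vnorm_sqr vnorm_subC /qpol quad_mcomb dot0l -!vnorm_sqr; field.
apply: (usc_max compact_cyl (f := fun w => G w.1 w.2 - c * dot (vsub x w.1) (vsub x w.1))).
  by case: Om_ne => o Oo; exists (o, 0); split; [exact: vclos_self|simpl; lra].
move=> s [y t] hs [hy ht] hl e e0 /=.
have e2 : 0 < e / 2 by lra.
have e3 : 0 < e / (2 * (Rabs c + 1)) by apply: Rdiv_lt_0_compat; have := Rabs_pos c; lra.
have [d1 [d10 h1]] := hG y t hy ht _ e2.
have [d2 [d20 h2]] := qpol_cont vzero x Xs y e3.
have [n0 hn] := hl _ (Rmin_pos _ _ d10 d20); exists n0 => n /hn /= [k1 k2].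
have := h1 _ _ (proj1 (hs n)) (proj2 (hs n)) (Rlt_le_trans _ _ _ k1 (Rmin_l _ _)) (Rlt_le_trans _ _ _ k2 (Rmin_l _ _)).
have := h2 _ (Rlt_le_trans _ _ _ k1 (Rmin_r _ _)); rewrite -!XE.
set u := dot (vsub x (s n).1) _; set v := dot _ _ => huv /Rabs_def2 hGG.
have : Rabs (c * (u - v)) <= e / 2.
  rewrite Rabs_mult; apply: Rle_trans (_ : Rabs c * (e / (2 * (Rabs c + 1))) <= _).
    by apply: Rmult_le_compat_l; [exact: Rabs_pos|lra].
  have E : (Rabs c + 1) * (e / (2 * (Rabs c + 1))) = e / 2.
    by field; have := Rabs_pos c; lra.
  lra.
move=> /Rabs_bounds; lra.
Qed.

Lemma cyl_bound G : cont_cyl G -> exists M, 0 <= M /\ forall y t, vclos Om y -> 0 <= t <= T -> G y t <= M.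
Proof.
move=> hG; have [w [_ hw]] := cyl_max 0 vzero hG; exists (Rabs (G w.1 w.2)); split=> [|y t hy ht].
  exact: Rabs_pos.
by have := hw (y, t) (conj hy ht); have := Rle_abs (G w.1 w.2) => /=; lra.
Qed.

Lemma cyl_unif_cont G eps : cont_cyl G -> 0 < eps -> exists del, 0 < del /\
  forall y y' t, vclos Om y -> vclos Om y' -> 0 <= t <= T -> vnorm (vsub y' y) < del ->
    Rabs (G y' t - G y t) < eps.
Proof.
move=> hG eps0; apply: NNPP => hno.
have H (n : nat) : exists a : vec N * vec N * R, vclos Om a.1.1 /\ vclos Om a.1.2 /\ 0 <= a.2 <= T /\
    vnorm (vsub a.1.2 a.1.1) < / INR n.+1 /\ eps <= Rabs (G a.1.2 a.2 - G a.1.1 a.2).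
  apply: NNPP => hn; apply: hno; exists (/ INR n.+1); split.
    by apply: Rinv_0_lt_compat; apply: lt_0_INR; apply/ltP.
  move=> y y' t hy hy' ht hd; apply: Rnot_le_lt => h; apply: hn.
  by exists (y, y', t).
have [a ha] := choice _ H.
have hS n : in_cyl ((a n).1.1, (a n).2) by have [? [? [? _]]] := ha n; split.
have [s [[y t] [hs [[hy ht] hl]]]] := compact_cyl hS.
have e2 : 0 < eps / 2 by lra.
have [d [d0 hd]] := hG y t hy ht _ e2.
have d2 : 0 < d / 2 by lra.
have [n1 h1] := hl _ d2; have [n2 h2] := inv_INR_lt d2.
pose n := maxn n1 n2.
have [/= k1 k2] := h1 n (leq_maxl _ _).
have k3 := h2 _ (leq_trans (leq_maxr n1 n2) (incr_ge _ hs)).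
have [b1 [b2 [b3 [b4 b5]]]] := ha (s n).
have c1 := hd _ _ b1 b3 (ltac:(lra)) (ltac:(lra)).
have c2 : Rabs (G (a (s n)).1.2 (a (s n)).2 - G y t) < eps / 2.
  apply: hd => //; last lra.
  have := vnorm_sub_tri (a (s n)).1.2 (a (s n)).1.1 y.
  have : / INR (s n).+1 < d / 2 := k3.
  lra.
move: c1 c2 b5; move: (G (a (s n)).1.2 _) (G (a (s n)).1.1 _) (G y t) => A B D.
by split_Rabs; lra.
Qed.

(** The maximizers [w x] are kept because touching of [f] at [x] is later moved to touching of [G]
    at [w x]. The result lives on the whole space, not only on the domain. *)
Lemma sup_convolution G Lam : cont_cyl G -> exists (f : vec N -> R) (w : vec N -> vec N * R),
  (forall x, in_cyl (w x)) /\
  (forall x, f x = G (w x).1 (w x).2 - Lam / 2 * dot (vsub x (w x).1) (vsub x (w x).1)) /\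
  forall x y t, vclos Om y -> 0 <= t <= T -> G y t - Lam / 2 * dot (vsub x y) (vsub x y) <= f x.
Proof.
move=> hG; have [w hw] := choice _ (fun x => cyl_max (Lam / 2) x hG).
exists (fun x => G (w x).1 (w x).2 - Lam / 2 * dot (vsub x (w x).1) (vsub x (w x).1)), w.
split=> [x|]; first exact: (proj1 (hw x)).
by split=> // x y t hy ht; exact: (proj2 (hw x) (y, t) (conj hy ht)).
Qed.

Section SupConv.
Variables (G : vec N -> R -> R) (Lam : R) (f : vec N -> R) (w : vec N -> vec N * R).
Hypotheses (Lam0 : 0 < Lam) (w_in : forall x, in_cyl (w x))
  (fE : forall x, f x = G (w x).1 (w x).2 - Lam / 2 * dot (vsub x (w x).1) (vsub x (w x).1))
  (f_ge : forall x y t, vclos Om y -> 0 <= t <= T ->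
     G y t - Lam / 2 * dot (vsub x y) (vsub x y) <= f x).

(** The maximizer for [x] competes at [x + h], which gives an explicit supporting parabola. *)
Lemma sup_conv_lower x h :
  f x + dot (vscale Lam (vsub (w x).1 x)) h - Lam / 2 * dot h h <= f (vadd x h).
Proof.
have [hy ht] := w_in x; have := f_ge (vadd x h) hy ht; rewrite (fE x).
have [d Ed] : exists d, d = vsub x (w x).1 by eexists.
have -> : vsub (vadd x h) (w x).1 = vadd d h by rewrite Ed; vext; ring.
have -> : vsub (w x).1 x = vscale (-1) d by rewrite Ed; vext; ring.
rewrite -Ed !dotDl !dotDr !dotZl (dotC h d); lra.
Qed.

Lemma sup_conv_semiconvex : semiconvex Lam f.
Proof. by move=> x; eexists => h; exact: sup_conv_lower. Qed.

Lemma sup_conv_lipschitz R1 x x' : vnorm x <= R1 -> vnorm x' <= R1 ->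
  Rabs (f x' - f x) <= Lam * (M0 + 2 * R1) * vnorm (vsub x' x).
Proof.
have half a b : vnorm a <= R1 -> vnorm b <= R1 ->
    f a - Lam * (M0 + 2 * R1) * vnorm (vsub b a) <= f b.
  move=> ha hb; have := sup_conv_lower a (vsub b a); rewrite vadd_subK.
  have h1 := dot_le_vnorm (vscale Lam (vsub (w a).1 a)) (vsub b a).
  have h2 : vnorm (vscale Lam (vsub (w a).1 a)) <= Lam * (M0 + R1).
    rewrite vnormZ Rabs_pos_eq; last lra.
    apply: Rmult_le_compat_l; first lra.
    rewrite vsubE; apply: Rle_trans (vnormD _ _) _.
    by rewrite vnormZ Rabs_Ropp Rabs_R1; have := Om_b (proj1 (w_in a)); lra.
  have h3 : vnorm (vsub b a) <= 2 * R1.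
    by rewrite vsubE; apply: Rle_trans (vnormD _ _) _; rewrite vnormZ Rabs_Ropp Rabs_R1; lra.
  have v0 := vnorm_ge0 (vsub b a); rewrite -vnorm_sqr.
  have h4 := Rmult_le_compat_r _ _ _ v0 h2.
  have h5 : Lam / 2 * (vnorm (vsub b a) * vnorm (vsub b a)) <= Lam * R1 * vnorm (vsub b a).
    have -> : Lam * R1 * vnorm (vsub b a) = Lam / 2 * (2 * R1 * vnorm (vsub b a)) by field.
    by apply: Rmult_le_compat_l; [lra|apply: Rmult_le_compat_r].
  have := Rabs_bounds h1; lra.
move=> hx hx'; have h1 := half _ _ hx hx'; have := half _ _ hx' hx.
by rewrite vnorm_subC => h2; apply: Rabs_le; lra.
Qed.
End SupConv.
End Cylinder.

Definition degenerate_mono {N} (F : mat N -> R) := forall X Y e,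
  (forall v, quad X v <= quad Y v + e * dot v v) -> F X <= F Y + e.

(** A one-scale approximate second-order expansion is enough to find a genuine touching point:
    adding [2 eps |x - x0|^2] moves the maximum to the interior of the ball. *)
Lemma touch_from_expansion N (f : vec N -> R) x0 r e (Y : mat N) eps :
  0 < r -> 0 < eps -> Defs.symmetric Y -> cont_on (fun x => vnorm (vsub x x0) <= r) f ->
  (forall h, vnorm h <= r -> f (vadd x0 h) <= f x0 + qpol e Y h + eps * (r * r)) ->
  let Y' := mcomb 1 Y (4 * eps) 0 vzero in
  exists x, vnorm (vsub x x0) < r /\ forall y, vnorm (vsub y x0) <= r ->
    f y - qpol e Y' (vsub y x0) <= f x - qpol e Y' (vsub x x0).
Proof.
move=> r0 eps0 hY hf hexp Y'.
have Ys : Defs.symmetric Y' by apply: mcomb_sym.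
have Y'E h : qpol e Y' h = qpol e Y h + 2 * eps * dot h h.
  by rewrite /qpol quad_mcomb; field.
have Bcl : vclosed (fun x => vnorm (vsub x x0) <= r).
  move=> x l hx hl; apply: le_epsilon => d d0; have [n1 hn] := hl d d0.
  have := vnorm_sub_tri l (x n1) x0; have := hx n1; have := hn n1 (leqnn _).
  by rewrite vnorm_subC; lra.
have Bb x : vnorm (vsub x x0) <= r -> vnorm x <= vnorm x0 + r.
  by move=> h; have := vnormD x0 (vsub x x0); rewrite vadd_subK; lra.
have Bx0 : vnorm (vsub x0 x0) <= r by rewrite vsubxx vnorm0; lra.
have hf' : cont_on (fun x => vnorm (vsub x x0) <= r) (fun x => - f x).
  move=> x hx d d0; have [s [s0 hs]] := hf x hx d d0; exists s; split=> // y hy hyx.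
  by have := hs y hy hyx; split_Rabs; lra.
have [x [Bx hmax]] := cont_max Bcl Bb (ex_intro _ x0 Bx0) (cont_on_qpol e x0 1 Ys hf').
have hm y : vnorm (vsub y x0) <= r -> f y - qpol e Y' (vsub y x0) <= f x - qpol e Y' (vsub x x0).
  by move=> /hmax; lra.
exists x; split=> //.
have [//|h] := Rle_lt_or_eq_dec _ _ Bx; exfalso.
have := hm x0 Bx0; have := hexp (vsub x x0) Bx; rewrite vadd_subK !Y'E vsubxx dot0l -vnorm_sqr h.
have -> : qpol e Y vzero = 0 by rewrite /qpol dot0r quad0; ring.
have : 0 < eps * (r * r) by apply: Rmult_lt_0_compat => //; nra.
lra.
Qed.

Lemma exp_affine_deriv A c d t :
  derivable_pt_lim (fun t => A * exp (c * t + d)) t (A * c * exp (c * t + d)).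
Proof.
have h1 : derivable_pt_lim (fun t => c * t + d) t c.
  have := derivable_pt_lim_plus (fun t => c * t) (fun _ => d) t c 0.
  rewrite Rplus_0_r; apply; last exact: derivable_pt_lim_const.
  have := derivable_pt_lim_scal id c t 1; rewrite Rmult_1_r; apply; exact: derivable_pt_lim_id.
have h2 := derivable_pt_lim_comp _ exp t _ _ h1 (derivable_pt_lim_exp _).
have := derivable_pt_lim_scal _ A t _ h2.
by have -> : A * (exp (c * t + d) * c) = A * c * exp (c * t + d) by ring.
Qed.

Lemma derivable_linear_bound (f : R -> R) t l e : derivable_pt_lim f t l -> 0 < e ->
  exists del, 0 < del /\ forall s, Rabs (s - t) < del ->
    Rabs (f s - f t - l * (s - t)) <= e * Rabs (s - t).
Proof.
move=> h e0; have [[d d0] hd] := h e e0; exists d; split=> // s hs.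
have [->|st] := Req_dec s t.
  have -> : f t - f t - l * (t - t) = 0 by ring.
  by rewrite Rabs_R0; have := Rabs_pos (t - t); nra.
have hn : s - t <> 0 by lra.
have := hd (s - t) hn hs; have -> : t + (s - t) = s by ring.
have hp := Rabs_pos_lt _ hn; move=> h1.
have -> : f s - f t - l * (s - t) = ((f s - f t) / (s - t) - l) * (s - t) by field.
by rewrite Rabs_mult; apply: Rmult_le_compat_r; lra.
Qed.

(** * Parabolic jets of the penalized subsolution *)

Section Parabolic.
Variables (N : nat) (Om : vec N -> Prop) (F : mat N -> R) (u : vec N -> R -> R) (psi : vec N -> R).
Variables (mu C T : R) (pen : R -> R) (dpen : R).
Hypotheses (mu0 : 0 < mu) (C0 : 0 < C) (F_mono : degenerate_mono F).
Hypothesis u_sub : forall x t a p X, Om x -> 0 < t -> psuperjet Om u x t a p X -> a <= F X.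
Hypothesis psi_upper : forall x0 e, Om x0 -> 0 < e < psi x0 -> exists q del, 0 < del /\
  forall y, vnorm (vsub y x0) < del ->
    psi y <= psi x0 + dot q (vsub y x0) - mu * (psi x0 - e) / 2 * dot (vsub y x0) (vsub y x0).
Hypothesis psi_pos : forall x, Om x -> 0 < psi x.
Let U y t := u y t - C * exp (- mu * t) * psi y - pen t.

(** The curvature of [psi] at the touching point cancels the time derivative of [exp (- mu t)]. *)
Lemma penalized_subsolution y0 t0 e Y r : Om y0 -> 0 < t0 < T -> Defs.symmetric Y -> 0 < r ->
  derivable_pt_lim pen t0 dpen ->
  (forall y t, Om y -> vnorm (vsub y y0) < r -> 0 <= t <= T ->
     U y t <= U y0 t0 + qpol e Y (vsub y y0)) ->
  dpen <= F Y.
Proof.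
move=> Oy [t00 t0T] Ys r0 hpen hU.
set E := fun t => exp (- mu * t); set E0 := E t0.
have E00 : 0 < E0 by apply: exp_pos.
have E01 : E0 <= 1 by rewrite /E0 /E -exp_0; apply: Rlt_le; apply: exp_increasing; nra.
have p0 := psi_pos Oy.
have hE : derivable_pt_lim E t0 (- mu * E0).
  have := exp_affine_deriv 1 (- mu) 0 t0.
  have -> : 1 * - mu * exp (- mu * t0 + 0) = - mu * E0 by rewrite /E0 /E Rplus_0_r; ring.
  by have -> // : (fun t => 1 * exp (- mu * t + 0)) = E; vext; rewrite /E Rplus_0_r; ring.
apply: (@le_of_lim _ _ (C * mu * psi y0)); first by repeat apply: Rmult_lt_0_compat.
(* Using [psi_upper] with loss [e1] leaves, after the cancellation, an error
   [C * mu * E0 * e1 <= t'], and [t'] is arbitrarily small. *)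
move=> t' [t'0 t'1]; pose e1 := t' / (C * mu).
have Cmu : 0 < C * mu by nra.
have Ee1 : C * mu * e1 = t' by rewrite /e1; field; lra.
have e10 : 0 < e1 < psi y0.
  by split; [apply: Rdiv_lt_0_compat|apply: (Rmult_lt_reg_l (C * mu)) => //; lra].
have [q [r1 [r10 hq]]] := psi_upper Oy e10.
set ka := mu * (psi y0 - e1) in hq.
have ka0 : 0 < ka by apply: Rmult_lt_0_compat; lra.
pose X := mcomb 1 Y (- (C * E0 * ka)) 0 vzero.
have jet : psuperjet Om u y0 t0 (- mu * C * E0 * psi y0 + dpen) (vadd e (vscale (C * E0) q)) X.
  split; first exact: mcomb_sym.
  move=> eps eps0.
  pose c1 := C * psi y0 + 1; have c10 : 0 < c1 by rewrite /c1; nra.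
  have ep1 : 0 < eps / 3 / c1 by repeat apply: Rdiv_lt_0_compat; lra.
  have ep2 : 0 < eps / 3 by lra.
  have [d1 [d10 h1]] := derivable_linear_bound hE ep1.
  have [d2 [d20 h2]] := derivable_linear_bound hpen ep2.
  have [d3 [d30 h3]] := derivable_linear_bound hE Rlt_0_1.
  (* Governs the product of the time increment of [E] and the upper estimate of the space increment
     of [psi]: it is at most [c2 * d4 * |s|], which the choice of [d4] hides in the error term. *)
  pose c2 := C * (mu + 1) * (vnorm q + ka / 2).
  have q0 := vnorm_ge0 q.
  have c20 : 0 < c2 by repeat apply: Rmult_lt_0_compat; lra.
  pose d4 := Rmin 1 (eps / 3 / c2).
  have d40 : 0 < d4 by apply: Rmin_pos; [lra|repeat apply: Rdiv_lt_0_compat; lra].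
  pose d5 := Rmin t0 (T - t0); have d50 : 0 < d5 by apply: Rmin_pos; lra.
  pose del := Rmin (Rmin (Rmin d1 d2) (Rmin d3 d4)) (Rmin d5 (Rmin r r1)).
  have del0 : 0 < del.
    apply: Rmin_pos; first by apply: Rmin_pos; apply: Rmin_pos.
    by apply: Rmin_pos => //; apply: Rmin_pos.
  have hdel : del <= d1 /\ del <= d2 /\ del <= d3 /\ del <= d4 /\ del <= d5 /\ del <= r /\ del <= r1.
    have a1 := Rmin_l (Rmin (Rmin d1 d2) (Rmin d3 d4)) (Rmin d5 (Rmin r r1)).
    have a2 := Rmin_r (Rmin (Rmin d1 d2) (Rmin d3 d4)) (Rmin d5 (Rmin r r1)).
    have a3 := Rmin_l (Rmin d1 d2) (Rmin d3 d4). have a4 := Rmin_r (Rmin d1 d2) (Rmin d3 d4).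
    have a5 := Rmin_l d1 d2. have a6 := Rmin_r d1 d2.
    have a7 := Rmin_l d3 d4. have a8 := Rmin_r d3 d4.
    have a9 := Rmin_l d5 (Rmin r r1). have a10 := Rmin_r d5 (Rmin r r1).
    have a11 := Rmin_l r r1. have a12 := Rmin_r r r1.
    by rewrite /del; lra.
  have dd5 : d5 <= t0 /\ d5 <= T - t0 by split; [exact: Rmin_l|exact: Rmin_r].
  have dd4 : d4 <= 1 /\ d4 <= eps / 3 / c2 by split; [exact: Rmin_l|exact: Rmin_r].
  exists del; split=> // y t Hy t_0 hy ht.
  set h := vsub y y0 in hy *; set s := t - t0 in ht *.
  have ts := Rabs_def2 _ _ ht.
  have tT : 0 <= t <= T by rewrite /s in ts; lra.
  have hy1 : vnorm h < r by lra. have hy2 : vnorm h < r1 by lra.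
  have ht1 : Rabs s < d1 by lra. have ht2 : Rabs s < d2 by lra. have ht3 : Rabs s < d3 by lra.
  have hUy := hU y t Hy hy1 tT; rewrite -/h in hUy.
  have hqy := hq y hy2; rewrite -/h in hqy.
  have k1 := h1 t ht1; have k2 := h2 t ht2; have k3 := h3 t ht3; rewrite -/s -/E0 in k1 k2 k3.
  have Et0 : 0 < E t by apply: exp_pos.
  have v0 := vnorm_ge0 h; have as0 := Rabs_pos s.
  have kE : Rabs (E t - E0) <= (mu + 1) * Rabs s.
    have -> : E t - E0 = (E t - E0 - - mu * E0 * s) + (- mu * E0 * s) by ring.
    apply: Rle_trans (Rabs_triang _ _) _.
    have : Rabs (- mu * E0 * s) <= mu * Rabs s.
      rewrite !Rabs_mult Rabs_Ropp (Rabs_pos_eq mu) ?(Rabs_pos_eq E0); try lra.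
      apply: Rmult_le_compat_r => //; nra.
    lra.
  have kP : Rabs (dot q h - ka / 2 * dot h h) <= (vnorm q + ka / 2) * d4.
    have b1 := dot_le_vnorm q h; rewrite -vnorm_sqr.
    have b2 : vnorm q * vnorm h <= vnorm q * d4 by apply: Rmult_le_compat_l; lra.
    have b3 : ka / 2 * (vnorm h * vnorm h) <= ka / 2 * d4 by apply: Rmult_le_compat_l; [lra|nra].
    have b4 : 0 <= ka / 2 * (vnorm h * vnorm h) by apply: Rmult_le_pos; nra.
    by have := Rabs_bounds b1 => b5; apply: Rabs_le; lra.
  have kEP : C * ((E t - E0) * (dot q h - ka / 2 * dot h h)) <= eps / 3 * Rabs s.
    apply: Rle_trans (Rle_abs _) _; rewrite !Rabs_mult (Rabs_pos_eq C); last lra.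
    have b1 : Rabs (E t - E0) * Rabs (dot q h - ka / 2 * dot h h) <=
       ((mu + 1) * Rabs s) * ((vnorm q + ka / 2) * d4).
      by apply: Rmult_le_compat => //; exact: Rabs_pos.
    have b2 := Rmult_le_compat_l C _ _ (Rlt_le _ _ C0) b1.
    apply: Rle_trans b2 _.
    have -> : C * ((mu + 1) * Rabs s * ((vnorm q + ka / 2) * d4)) = (c2 * d4) * Rabs s.
      by rewrite /c2; ring.
    apply: Rmult_le_compat_r => //.
    have -> : eps / 3 = c2 * (eps / 3 / c2) by field; lra.
    by apply: Rmult_le_compat_l; lra.
  have kE1 : C * psi y0 * (E t - E0 - - mu * E0 * s) <= eps / 3 * Rabs s.
    apply: Rle_trans (Rle_abs _) _; rewrite Rabs_mult Rabs_pos_eq; last nra.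
    apply: Rle_trans (_ : C * psi y0 * (eps / 3 / c1 * Rabs s) <= _).
      by apply: Rmult_le_compat_l; [nra|exact: k1].
    have -> : C * psi y0 * (eps / 3 / c1 * Rabs s) = (C * psi y0) * (eps / 3 / c1) * Rabs s by ring.
    apply: Rmult_le_compat_r => //.
    have E3 : c1 * (eps / 3 / c1) = eps / 3 by field; lra.
    apply: Rle_trans (_ : c1 * (eps / 3 / c1) <= _); last lra.
    by apply: Rmult_le_compat_r; [lra|rewrite /c1; lra].
  have kpen := Rabs_bounds k2.
  have kpsi : C * E t * psi y <= C * E t * (psi y0 + dot q h - ka / 2 * dot h h).
    by apply: Rmult_le_compat_l; [apply: Rlt_le; apply: Rmult_lt_0_compat|exact: hqy].
  have Eu : u y t = U y t + C * E t * psi y + pen t by rewrite /U /E; ring.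
  have Eu0 : U y0 t0 = u y0 t0 - C * E0 * psi y0 - pen t0 by [].
  rewrite Eu; rewrite Eu0 /qpol in hUy.
  rewrite dotDl dotZl /X quad_mcomb dot0l vnorm_pow2.
  have : 0 <= eps * dot h h by apply: Rmult_le_pos; [lra|exact: dot_ge0].
  by move: kE1 kEP kpsi hUy kpen; lra.
have := u_sub Oy t00 jet.
have : F X <= F Y + - (C * E0 * ka).
  by apply: F_mono => v; rewrite /X quad_mcomb dot0l; lra.
have : C * E0 * (mu * e1) <= t'.
  rewrite -Ee1; have : 0 <= C * mu * e1 by lra.
  nra.
by rewrite /ka; lra.
Qed.
End Parabolic.

(** * Comparison with the stationary supersolution *)

Section Doubling.
Variables (N : nat) (Om : vec N -> Prop) (F : mat N -> R) (U : vec N -> R -> R) (z : vec N -> R).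
Variables (T M0 th eta : R).
Hypotheses (Om_ne : exists x, Om x)
  (Om_b : forall x, vclos Om x -> vnorm x <= M0) (T0 : 0 < T) (F_mono : degenerate_mono F).
Hypotheses (U_cont : cont_cyl Om T U) (z_cont : cont_on (vclos Om) z).
Hypothesis z_super : forall x p X, Om x -> subjet Om z x p X -> F X <= 0.
Hypothesis U_sub : forall y0 t0 e Y r, Om y0 -> 0 < t0 < T -> Defs.symmetric Y -> 0 < r ->
  (forall y t, Om y -> vnorm (vsub y y0) < r -> 0 <= t <= T ->
     U y t <= U y0 t0 + qpol e Y (vsub y y0)) -> eta <= F Y.
Hypothesis eta0 : 0 < eta.
Hypothesis U_bdry : forall y t, vclos Om y -> 0 <= t <= T ->
  ~ (Om y /\ 0 < t < T) -> U y t <= z y.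

(** If [U] exceeded [z], then [F] would have to be both at least [eta] and nearly nonpositive on
    the two Hessians produced by [contact_quadratic] for the convolutions of [U] and [- z]. *)
Lemma penalized_comparison x1 t1 : Om x1 -> 0 <= t1 <= T -> 0 < th -> U x1 t1 - z x1 < th.
Proof.
move=> Ox1 ht1 th0; apply: Rnot_le_lt => hth.
have cx1 := vclos_self Ox1.
have M00 : 0 <= M0 by apply: Rle_trans (vnorm_ge0 x1) (Om_b cx1).
pose G (y : vec N) (_ : R) := - z y.
have G_cont : cont_cyl Om T G.
  move=> y t hy _ e e0; have [d [d0 hd]] := z_cont hy e0; exists d; split=> // y' t' hy' _ hyy _.
  by have := hd y' hy' hyy; rewrite /G; split_Rabs; lra.
have [MU [MU0 hMU]] := cyl_bound T0 Om_ne Om_b U_cont.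
have [Mz [Mz0 hMz]] := cyl_bound T0 Om_ne Om_b G_cont.
have th8 : 0 < th / 8 by lra.
have [dU [dU0 hdU]] := cyl_unif_cont T0 Om_b U_cont th8.
have [dz [dz0 hdz]] := cyl_unif_cont T0 Om_b G_cont th8.
pose dl := Rmin dU dz; have dl0 : 0 < dl by apply: Rmin_pos.
pose M1 := MU + Mz; have M10 : 0 <= M1 by rewrite /M1; lra.
(* The entry 4 gives the decay in [D_far]; the other puts both maximizers within [dl / 2] of [x]
   wherever [D] is positive. *)
pose Lam := Rmax 4 (8 * M1 / (dl * dl) + 1).
have Lam4 : 4 <= Lam := Rmax_l _ _.
have Lam0 : 0 < Lam by lra.
have LamM : 2 * M1 < Lam * ((dl / 2) * (dl / 2)).
  have h : 8 * M1 / (dl * dl) + 1 <= Lam := Rmax_r _ _.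
  have dd : 0 < dl * dl by nra.
  have E : 8 * M1 / (dl * dl) * (dl * dl) = 8 * M1 by field; lra.
  have := Rmult_le_compat_r _ _ _ (Rlt_le _ _ dd) h; lra.
have [f [w [w_in [fE f_ge]]]] := sup_convolution T0 Om_ne Om_b Lam U_cont.
have [k [v [v_in [kE k_ge]]]] := sup_convolution T0 Om_ne Om_b Lam G_cont.
have f_sc := sup_conv_semiconvex w_in fE f_ge.
have k_sc := sup_conv_semiconvex v_in kE k_ge.
pose D x := f x + k x.
have D_x1 : th <= D x1.
  have := f_ge x1 x1 t1 cx1 ht1; have := k_ge x1 x1 t1 cx1 ht1.
  by rewrite vsubxx dot0l /G /D; lra.
(* The space parts of the two maximizers are less than [dl] apart. If either lay where [U <= z] is
   known, moving [z] or [U] over this distance would give [D x < th / 8]. *)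
have interior x : th / 4 <= D x -> (Om (w x).1 /\ 0 < (w x).2 < T) /\ Om (v x).1.
  rewrite /D fE kE => hD.
  have [hw1 hw2] := w_in x; have [hv1 hv2] := v_in x.
  have b1 := hMU _ _ hw1 hw2; have b2 := hMz _ _ hv1 hv2.
  have s1 := dot_ge0 (vsub x (w x).1); have s2 := dot_ge0 (vsub x (v x).1).
  have L2 : 0 < Lam / 2 by lra.
  have s1' : 0 <= Lam / 2 * dot (vsub x (w x).1) (vsub x (w x).1) by apply: Rmult_le_pos; lra.
  have s2' : 0 <= Lam / 2 * dot (vsub x (v x).1) (vsub x (v x).1) by apply: Rmult_le_pos; lra.
  have c1 : vnorm (vsub x (w x).1) < dl / 2.
    apply: vnorm_lt; first lra.
    by apply: (Rmult_lt_reg_l Lam) => //; rewrite /M1 in LamM; lra.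
  have c2 : vnorm (vsub x (v x).1) < dl / 2.
    apply: vnorm_lt; first lra.
    by apply: (Rmult_lt_reg_l Lam) => //; rewrite /M1 in LamM; lra.
  have c3 : vnorm (vsub (v x).1 (w x).1) < dl.
    by have := vnorm_sub_tri (v x).1 x (w x).1; rewrite (vnorm_subC (v x).1 x); lra.
  have dlU : dl <= dU := Rmin_l _ _. have dlz : dl <= dz := Rmin_r _ _.
  have e1 := hdU _ _ _ hw1 hv1 hw2 (Rlt_le_trans _ _ _ c3 dlU).
  have e2 := hdz _ _ (w x).2 hw1 hv1 hw2 (Rlt_le_trans _ _ _ c3 dlz).
  have e1' := Rabs_def2 _ _ e1; have e2' := Rabs_def2 _ _ e2; rewrite /G in e2' hD.
  split.
    by apply: NNPP => hn; have := U_bdry hw1 hw2 hn; lra.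
  apply: NNPP => hn; have hn' : ~ (Om (v x).1 /\ 0 < (w x).2 < T) by case.
  by have := U_bdry hv1 hw2 hn'; lra.
(* Beyond [2 * M0] the distance to the closure is at least [|x| / 2]; beyond [M1 + M0 + 1] the
   resulting quadratic decay beats linear perturbations of slope at most 1. *)
pose R1 := Rmax (2 * M0) (M1 + M0 + 1) + 1.
have R1a : 2 * M0 + 1 <= R1 by rewrite /R1; have := Rmax_l (2 * M0) (M1 + M0 + 1); lra.
have R1b : M1 + M0 + 2 <= R1 by rewrite /R1; have := Rmax_r (2 * M0) (M1 + M0 + 1); lra.
have D_far x : R1 < vnorm x -> D x <= M1 - vnorm x * vnorm x.
  move=> hx.
  have far (a : vec N) : vnorm a <= M0 -> vnorm x * vnorm x / 4 <= dot (vsub x a) (vsub x a).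
    move=> ha; rewrite -vnorm_sqr; have := vnormD (vsub x a) a.
    have -> : vadd (vsub x a) a = x by vext; ring.
    by move=> h; have : vnorm x / 2 <= vnorm (vsub x a); [lra|nra].
  have [hw1 hw2] := w_in x; have [hv1 hv2] := v_in x.
  have b1 := hMU _ _ hw1 hw2; have b2 := hMz _ _ hv1 hv2.
  have c1 := far _ (Om_b hw1); have c2 := far _ (Om_b hv1).
  have nx : 0 <= vnorm x * vnorm x by have := vnorm_ge0 x; nra.
  rewrite /D fE kE /M1.
  have : 2 * (vnorm x * vnorm x / 4) <= Lam / 2 * dot (vsub x (w x).1) (vsub x (w x).1).
    by apply: Rmult_le_compat; lra.
  have : 2 * (vnorm x * vnorm x / 4) <= Lam / 2 * dot (vsub x (v x).1) (vsub x (v x).1).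
    by apply: Rmult_le_compat; lra.
  lra.
(* Slopes with entries up to [rho] have norm at most 1 and shift the comparison of [D] with its
   value at [x1] by at most [th / 2]. *)
pose rho := Rmin 1 (th / 2 / (R1 + M0)) / (INR N + 1).
have n0 := pos_INR N.
have rho0 : 0 < rho by apply: Rdiv_lt_0_compat; [apply: Rmin_pos; [lra|repeat apply: Rdiv_lt_0_compat; lra]|lra].
have p_small (p : vec N) : (forall l, 0 <= p l <= rho) -> vnorm p <= 1 /\ vnorm p * (R1 + M0) <= th / 2.
  move=> hp; have h : vnorm p <= Rmin 1 (th / 2 / (R1 + M0)).
    have -> : Rmin 1 (th / 2 / (R1 + M0)) = rho * (INR N + 1) by rewrite /rho; field; lra.
    apply: vnorm_le; first by apply: Rmult_le_pos; lra.
    have hp' l : Rabs (p l) <= rho by rewrite Rabs_pos_eq; have := hp l; lra.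
    apply: Rle_trans (dot_sup_le hp') _.
    have -> : rho * (INR N + 1) * (rho * (INR N + 1)) = (INR N + 1) * (INR N + 1) * (rho * rho) by ring.
    apply: Rmult_le_compat_r; first exact: Rle_0_sqr.
    by have := Rle_0_sqr (INR N); rewrite /Rsqr; lra.
  split; first by apply: Rle_trans h (Rmin_l _ _).
  have -> : th / 2 = th / 2 / (R1 + M0) * (R1 + M0) by field; lra.
  by apply: Rmult_le_compat_r; [lra|apply: Rle_trans h (Rmin_r _ _)].
have near_max p x : (forall l, 0 <= p l <= rho) -> D x1 - dot p x1 <= D x - dot p x ->
    vnorm x <= R1 /\ th / 2 <= D x.
  move=> hp hx; have [p1 p2] := p_small p hp.
  have nx1 := Om_b cx1; have nx0 := vnorm_ge0 x; have np := vnorm_ge0 p.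
  have a1 := Rabs_bounds (dot_le_vnorm p x1); have a2 := Rabs_bounds (dot_le_vnorm p x).
  have a3 : vnorm p * vnorm x1 <= vnorm p * M0 by apply: Rmult_le_compat_l.
  have hR : vnorm x <= R1.
    apply: Rnot_lt_le => far; have := D_far x far.
    have : vnorm p * vnorm x <= 1 * vnorm x by apply: Rmult_le_compat_r.
    have : vnorm p * M0 <= 1 * M0 by apply: Rmult_le_compat_r.
    nra.
  split=> //.
  have : vnorm p * vnorm x <= vnorm p * R1 by apply: Rmult_le_compat_l.
  lra.
pose Lp := Lam * (M0 + 2 * (R1 + 1)).
have Lp0 : 0 < Lp by apply: Rmult_lt_0_compat; lra.
have f_lip x x' : vnorm x <= R1 + 1 -> vnorm x' <= R1 + 1 -> Rabs (f x' - f x) <= Lp * vnorm (vsub x' x).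
  by move=> hx hx'; apply: (sup_conv_lipschitz Om_b Lam0 w_in fE f_ge).
have k_lip x x' : vnorm x <= R1 + 1 -> vnorm x' <= R1 + 1 -> Rabs (k x' - k x) <= Lp * vnorm (vsub x' x).
  by move=> hx hx'; apply: (sup_conv_lipschitz Om_b Lam0 v_in kE k_ge).
have lip_cont (S : vec N -> Prop) h L : 0 < L ->
    (forall x x', S x -> S x' -> Rabs (h x' - h x) <= L * vnorm (vsub x' x)) -> cont_on S h.
  move=> L0 hL x Sx e e0; exists (e / L); split=> [|y Sy hy]; first exact: Rdiv_lt_0_compat.
  apply: Rle_lt_trans (hL x y Sx Sy) _.
  have -> : e = L * (e / L) by field; lra.
  by apply: Rmult_lt_compat_l.
have hcon p : (forall l, 0 <= p l <= rho) -> exists x0, (forall l, Rabs (x0 l) <= R1) /\ contact D p x0.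
  move=> hp; have [p1 p2] := p_small p hp.
  have Bcl : vclosed (fun x : vec N => vnorm x <= R1).
    move=> x l hx hl; apply: le_epsilon => e e0; have [n1 hn] := hl e e0.
    have := vnormD (x n1) (vsub l (x n1)); rewrite vadd_subK.
    by have := hx n1; have := hn n1 (leqnn _); rewrite vnorm_subC; lra.
  have Bx1 : vnorm x1 <= R1 by have := Om_b cx1; lra.
  have c : cont_on (fun x : vec N => vnorm x <= R1) (fun x => D x - dot p x).
    apply: (lip_cont _ _ (2 * Lp + 1)); first lra.
    move=> x x' hx hx'.
    have a1 := Rabs_bounds (f_lip x x' (ltac:(lra)) (ltac:(lra))).
    have a2 := Rabs_bounds (k_lip x x' (ltac:(lra)) (ltac:(lra))).
    have a3 := Rabs_bounds (dot_le_vnorm p (vsub x' x)); rewrite dotBr in a3.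
    have a4 : vnorm p * vnorm (vsub x' x) <= 1 * vnorm (vsub x' x).
      by apply: Rmult_le_compat_r => //; exact: vnorm_ge0.
    by rewrite /D; apply: Rabs_le; lra.
  have [x0 [Bx0 hmax]] := cont_max Bcl (fun x h => h) (ex_intro _ x1 Bx1) c.
  exists x0; split=> [l|x]; first by apply: Rle_trans (coord_le_vnorm _ _) Bx0.
  have [|hfar] := Rle_lt_dec (D x1 - dot p x1) (D x - dot p x).
    by move=> /(near_max p x hp) [hx _]; exact: hmax.
  by have := hmax x1 Bx1; lra.
pose ep := eta / 32; have ep0 : 0 < ep by rewrite /ep; lra.
(* On a ball of this radius [D] varies by at most [th / 8], so it stays above the level [th / 4]
   that [interior] needs; [1 / 2] keeps the ball where the Lipschitz bounds hold. *)
pose r0 := Rmin (1 / 2) (th / 8 / (2 * Lp)).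
have r00 : 0 < r0 by apply: Rmin_pos; [lra|repeat apply: Rdiv_lt_0_compat; lra].
have [p [x0 [r [q [X [hp [hc [[rp rr0] [Xs hX]]]]]]]]] :=
  contact_quadratic Lam0 rho0 (ltac:(lra) : 0 <= R1) f_sc k_sc hcon ep0 r00.
have r1 : r <= 1 / 2 by apply: Rle_trans rr0 (Rmin_l _ _).
have r2 : 2 * Lp * r <= th / 8.
  have -> : th / 8 = 2 * Lp * (th / 8 / (2 * Lp)) by field; lra.
  by apply: Rmult_le_compat_l; [lra|apply: Rle_trans rr0 (Rmin_r _ _)].
have [x0R x0D] := near_max p x0 hp (hc x1).
have ballR x : vnorm (vsub x x0) <= r -> vnorm x <= R1 + 1.
  by move=> h; have := vnormD x0 (vsub x x0); rewrite vadd_subK; lra.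
have x0R1 : vnorm x0 <= R1 + 1 by lra.
have ballD x : vnorm (vsub x x0) <= r -> th / 4 <= D x.
  move=> h; have a1 := Rabs_bounds (f_lip x0 x x0R1 (ballR x h)).
  have a2 := Rabs_bounds (k_lip x0 x x0R1 (ballR x h)).
  have : Lp * vnorm (vsub x x0) <= Lp * r by apply: Rmult_le_compat_l; lra.
  by move: x0D; rewrite /D; lra.
have f_cont : cont_on (fun x => vnorm (vsub x x0) <= r) f.
  by apply: (lip_cont _ _ Lp) => // x x' /ballR hx /ballR hx'; exact: f_lip.
have k_cont : cont_on (fun x => vnorm (vsub x x0) <= r) k.
  by apply: (lip_cont _ _ Lp) => // x x' /ballR hx /ballR hx'; exact: k_lip.
have hX' h : vnorm h <= r -> Rabs (k (vadd x0 h) - k x0 - dot q h - / 2 * quad X h) <= ep * (r * r).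
  by move=> hh; apply: hX => l; apply: Rle_trans (coord_le_vnorm _ _) hh.
have k_exp h : vnorm h <= r -> k (vadd x0 h) <= k x0 + qpol q X h + ep * (r * r).
  by move=> /hX' /Rabs_bounds; rewrite /qpol; lra.
have Xns : Defs.symmetric (mopp X) by apply: mopp_sym.
(* Only [k] is known to be nearly quadratic; maximality at the contact point passes the upper
   expansion on to [f] with the opposite Hessian. *)
have f_exp h : vnorm h <= r ->
    f (vadd x0 h) <= f x0 + qpol (vadd p (vscale (-1) q)) (mopp X) h + ep * (r * r).
  move=> /hX' /Rabs_bounds; rewrite /qpol quad_mopp dotDl dotZl.
  by have := hc (vadd x0 h); rewrite dotDr; lra.
have [xf [xfr hxf]] := touch_from_expansion rp ep0 Xns f_cont f_exp.
have [xk [xkr hxk]] := touch_from_expansion rp ep0 Xs k_cont k_exp.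
set Yf := mcomb 1 (mopp X) (4 * ep) 0 vzero in hxf.
set Yk := mcomb 1 X (4 * ep) 0 vzero in hxk.
have Yfs : Defs.symmetric Yf by apply: mcomb_sym.
have Yks : Defs.symmetric Yk by apply: mcomb_sym.
(* A touching point of the convolution transfers, by translation, to its maximizer. *)
have transfer (H : vec N -> R -> R) (h : vec N -> R) (m : vec N -> vec N * R) x e (Y : mat N) y t :
    (forall x, h x = H (m x).1 (m x).2 - Lam / 2 * dot (vsub x (m x).1) (vsub x (m x).1)) ->
    (forall x y t, vclos Om y -> 0 <= t <= T -> H y t - Lam / 2 * dot (vsub x y) (vsub x y) <= h x) ->
    Defs.symmetric Y -> vnorm (vsub x x0) < r ->
    (forall y, vnorm (vsub y x0) <= r ->
      h y - qpol e Y (vsub y x0) <= h x - qpol e Y (vsub x x0)) ->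
    vclos Om y -> 0 <= t <= T -> vnorm (vsub y (m x).1) < r - vnorm (vsub x x0) ->
    H y t <= H (m x).1 (m x).2 + qpol (vadd e (mulv Y (vsub x x0))) Y (vsub y (m x).1).
  move=> hE hge hY hx hmax hy ht hyr.
  pose x' := vadd x (vsub y (m x).1).
  have Ex : vsub x' x = vsub y (m x).1 by rewrite /x' vsub_addl.
  have hx' : vnorm (vsub x' x0) <= r.
    by have := vnorm_sub_tri x' x x0; rewrite Ex; lra.
  have := hmax x' hx'; have := hge x' y t hy ht; rewrite (hE x) (qpol_shift e x0 hY x x') Ex.
  have -> : vsub x' y = vsub x (m x).1 by rewrite /x'; vext; ring.
  lra.
have [[Of htf] _] := interior xf (ballD xf (Rlt_le _ _ xfr)).
have [_ Ok] := interior xk (ballD xk (Rlt_le _ _ xkr)).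
have F1 : eta <= F Yf.
  apply: (U_sub Of htf Yfs (r := r - vnorm (vsub xf x0))); first lra.
  move=> y t Oy hy ht.
  exact: (transfer U f w xf _ Yf y t fE f_ge Yfs xfr hxf (vclos_self Oy) ht hy).
have F2 : F (mopp Yk) <= 0.
  have d0 : 0 < r - vnorm (vsub xk x0) by lra.
  apply: (z_super Ok); apply: (min_subjet (e := vadd q (mulv Yk (vsub xk x0))) (a := (v xk).1) Yks d0).
  move=> y Oy hy.
  have := transfer G k v xk _ Yk y (v xk).2 kE k_ge Yks xkr hxk (vclos_self Oy) (proj2 (v_in xk)) hy.
  by rewrite /G vsubxx {2}/qpol dot0r quad0; lra.
(* The two Hessians are [-X] plus and minus [4 ep] times the identity, and [8 ep = eta / 4] is less
   than [eta]. *)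
have : F Yf <= F (mopp Yk) + 8 * ep.
  by apply: F_mono => h; rewrite /Yf quad_mopp !quad_mcomb quad_mopp dot0l; lra.
rewrite /ep in F1 *; lra.
Qed.
End Doubling.

(** * Continuity on the cylinder and the one-sided decay estimate *)

Section ContCyl.
Variables (N : nat) (Om : vec N -> Prop) (T : R).

Lemma cont_cylB (G H : vec N -> R -> R) : cont_cyl Om T G -> cont_cyl Om T H ->
  cont_cyl Om T (fun y t => G y t - H y t).
Proof.
move=> hG hH y t hy ht e e0; have e2 : 0 < e / 2 by lra.
have [d1 [d10 h1]] := hG y t hy ht _ e2; have [d2 [d20 h2]] := hH y t hy ht _ e2.
exists (Rmin d1 d2); split; first exact: Rmin_pos.
move=> y' t' hy' ht' a b.
have /Rabs_def2 := h1 y' t' hy' ht' (Rlt_le_trans _ _ _ a (Rmin_l _ _)) (Rlt_le_trans _ _ _ b (Rmin_l _ _)).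
have /Rabs_def2 := h2 y' t' hy' ht' (Rlt_le_trans _ _ _ a (Rmin_r _ _)) (Rlt_le_trans _ _ _ b (Rmin_r _ _)).
by move=> ? ?; apply: Rabs_def1; lra.
Qed.

Lemma cont_cyl_space (g : vec N -> R) : cont_on (vclos Om) g -> cont_cyl Om T (fun y _ => g y).
Proof.
move=> hg y t hy _ e e0; have [d [d0 hd]] := hg y hy e e0.
by exists d; split=> // y' t' hy' _ a _; apply: hd.
Qed.

Lemma exp_affine_cont A c d t e : 0 < e -> exists del, 0 < del /\ forall s, Rabs (s - t) < del ->
  Rabs (A * exp (c * s + d) - A * exp (c * t + d)) < e.
Proof.
move=> e0; have := exp_affine_deriv A c d t; set l := A * c * _ => hd.
have [d1 [d10 h1]] := derivable_linear_bound hd Rlt_0_1; have l0 := Rabs_pos l.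
have d20 : 0 < e / (Rabs l + 1) by apply: Rdiv_lt_0_compat; lra.
exists (Rmin d1 (e / (Rabs l + 1))); split=> [|s hs]; first exact: Rmin_pos.
have := h1 s (Rlt_le_trans _ _ _ hs (Rmin_l _ _)); have hs2 := Rlt_le_trans _ _ _ hs (Rmin_r _ _).
set g := A * exp _ - _ => hg.
have -> : g = (g - l * (s - t)) + l * (s - t) by ring.
apply: Rle_lt_trans (Rabs_triang _ _) _; rewrite Rabs_mult.
have E : e / (Rabs l + 1) * (Rabs l + 1) = e by field; lra.
have : Rabs (s - t) * (Rabs l + 1) < e by rewrite -E; apply: Rmult_lt_compat_r; lra.
lra.
Qed.

Lemma cont_cyl_exp_mul A c d (g : vec N -> R) : cont_on (vclos Om) g ->
  cont_cyl Om T (fun y t => A * exp (c * t + d) * g y).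
Proof.
move=> hg y t hy ht e e0.
set E := fun t => A * exp (c * t + d).
have gy := Rabs_pos (g y); have Et := Rabs_pos (E t).
have e1 : 0 < e / 2 / (Rabs (E t) + 1) by repeat apply: Rdiv_lt_0_compat; lra.
have e2 : 0 < Rmin 1 (e / 2 / (Rabs (g y) + 1)) by apply: Rmin_pos; [lra|repeat apply: Rdiv_lt_0_compat; lra].
have [d1 [d10 h1]] := hg y hy _ e1; have [d2 [d20 h2]] := exp_affine_cont A c d t e2.
exists (Rmin d1 d2); split; first exact: Rmin_pos.
move=> y' t' hy' ht' a b.
have k1 := h1 y' hy' (Rlt_le_trans _ _ _ a (Rmin_l _ _)).
have k2 := h2 t' (Rlt_le_trans _ _ _ b (Rmin_r _ _)); rewrite -/(E t) -/(E t') in k2 *.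
have k3 := Rlt_le_trans _ _ _ k2 (Rmin_l _ _). have k4 := Rlt_le_trans _ _ _ k2 (Rmin_r _ _).
have -> : E t' * g y' - E t * g y = E t' * (g y' - g y) + (E t' - E t) * g y by ring.
apply: Rle_lt_trans (Rabs_triang _ _) _.
rewrite (Rabs_mult (E t')) (Rabs_mult (E t' - E t)).
have hE : Rabs (E t') <= Rabs (E t) + 1 by move: k3; split_Rabs; lra.
have F1 : e / 2 / (Rabs (E t) + 1) * (Rabs (E t) + 1) = e / 2 by field; lra.
have F2 : e / 2 / (Rabs (g y) + 1) * (Rabs (g y) + 1) = e / 2 by field; lra.
have p1 : Rabs (E t') * Rabs (g y' - g y) <= (Rabs (E t) + 1) * Rabs (g y' - g y).
  by apply: Rmult_le_compat_r => //; exact: Rabs_pos.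
have p2 : (Rabs (E t) + 1) * Rabs (g y' - g y) < (Rabs (E t) + 1) * (e / 2 / (Rabs (E t) + 1)).
  by apply: Rmult_lt_compat_l; lra.
have p3 : Rabs (E t' - E t) * Rabs (g y) <= e / 2 / (Rabs (g y) + 1) * Rabs (g y).
  by apply: Rmult_le_compat_r; lra.
have p4 : e / 2 / (Rabs (g y) + 1) * Rabs (g y) <= e / 2 / (Rabs (g y) + 1) * (Rabs (g y) + 1).
  by apply: Rmult_le_compat_l; [apply: Rlt_le; repeat apply: Rdiv_lt_0_compat; lra|lra].
lra.
Qed.
End ContCyl.

(** Suppose the bound fails by [th] at [(x1, t1)]. The penalized function lies below [z] initially
    and laterally by the data, and at the final time [t1 + 1] by the penalty; comparison then
    contradicts the half of [th] that the penalty leaves at [t1]. *)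
Lemma decay_upper_bound N (Om : vec N -> Prop) (F : mat N -> R) (u : vec N -> R -> R)
    (z psi : vec N -> R) mu C :
  (exists x, Om x) -> vbounded Om -> degenerate_mono F -> 0 < mu -> 0 < C ->
  cont_on (vclos Om) z -> (forall x p X, Om x -> subjet Om z x p X -> F X <= 0) ->
  cont_on_cyl Om u ->
  (forall x t a p X, Om x -> 0 < t -> psuperjet Om u x t a p X -> a <= F X) ->
  cont_on (vclos Om) psi -> (forall x, Om x -> 0 < psi x) ->
  (forall x, vboundary Om x -> psi x = 0) ->
  (forall x0 e, Om x0 -> 0 < e < psi x0 -> exists q del, 0 < del /\
    forall y, vnorm (vsub y x0) < del ->
      psi y <= psi x0 + dot q (vsub y x0) - mu * (psi x0 - e) / 2 * dot (vsub y x0) (vsub y x0)) ->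
  (forall y t, vboundary Om y -> 0 < t -> u y t = z y) ->
  (forall y, vclos Om y -> u y 0 <= z y + C * psi y) ->
  forall x t, Om x -> 0 < t -> u x t <= z x + C * exp (- mu * t) * psi x.
Proof.
move=> One [M0 hM0] Fm mu0 C0 zc zs uc us pc ppos pb pup ub ui x1 t1 Ox1 t10.
apply: Rnot_lt_le => hlt.
pose th := u x1 t1 - (z x1 + C * exp (- mu * t1) * psi x1).
have th0 : 0 < th by rewrite /th; lra.
pose T := t1 + 1; have T0 : 0 < T by rewrite /T; lra.
have Ob := vclos_bound hM0.
have uc' : cont_cyl Om T u.
  move=> y t hy [ht0 _] e e0; have [d [d0 hd]] := uc y t hy ht0 e e0.
  by exists d; split=> // y' t' hy' [ht' _]; apply: hd.
have [M [MM hM]] := cyl_bound T0 One Ob (cont_cylB uc' (cont_cyl_space (T := T) zc)).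
(* Chosen so that [th / 2 * (1 + K) = M + th]; as [exp K >= 1 + K], the penalty at [T] exceeds the
   bound [M] on [u - z]. *)
pose K := 2 * M / th + 1.
have K0 : 0 < K.
  have : 0 <= 2 * M / th; last by rewrite /K; lra.
  by apply: Rmult_le_pos; [lra|apply: Rlt_le; apply: Rinv_0_lt_compat].
pose pen t := th / 2 * exp (K * t + - (K * t1)).
have pen0 t : 0 < pen t by apply: Rmult_lt_0_compat; [lra|exact: exp_pos].
have pent1 : pen t1 = th / 2 by rewrite /pen Rplus_opp_r exp_0; ring.
have penT : M <= pen T.
  rewrite /pen /T; have -> : K * (t1 + 1) + - (K * t1) = K by ring.
  have := exp_ineq1_le K => hK; have : th / 2 * (1 + K) <= th / 2 * exp K by apply: Rmult_le_compat_l; lra.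
  have -> : th / 2 * (1 + K) = M + th by rewrite /K; field; lra.
  lra.
pose U y t := u y t - C * exp (- mu * t) * psi y - pen t.
have psi0 y : vclos Om y -> 0 <= psi y.
  move=> hy; have [/ppos|hn] := classic (Om y); first lra.
  by rewrite (pb y (conj hy hn)); lra.
have Uc : cont_cyl Om T U.
  apply: cont_cylB.
    apply: cont_cylB => //.
    move=> y t hy ht e e0; have [d [d0 hd]] := cont_cyl_exp_mul C (- mu) 0 pc hy ht e0.
    by exists d; split=> // y' t' hy' ht' a b; have := hd y' t' hy' ht' a b; rewrite !Rplus_0_r.
  move=> y t hy ht e e0; have [d [d0 hd]] := exp_affine_cont (th / 2) K (- (K * t1)) t e0.
  by exists d; split=> // y' t' _ _ _; apply: hd.
(* The derivative of [pen] at time 0, where it is smallest on the cylinder. *)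
pose eta := th / 2 * K * exp (- (K * t1)).
have eta0 : 0 < eta.
  by apply: Rmult_lt_0_compat; [apply: Rmult_lt_0_compat; lra|exact: exp_pos].
have Us y0 t0 e Y r : Om y0 -> 0 < t0 < T -> Defs.symmetric Y -> 0 < r ->
    (forall y t, Om y -> vnorm (vsub y y0) < r -> 0 <= t <= T ->
      U y t <= U y0 t0 + qpol e Y (vsub y y0)) -> eta <= F Y.
  move=> Oy ht Ys r0 hU.
  have := penalized_subsolution mu0 C0 Fm us pup ppos Oy ht Ys r0
    (exp_affine_deriv (th / 2) K (- (K * t1)) t0) hU.
  apply: Rle_trans; apply: Rmult_le_compat_l; first by apply: Rmult_le_pos; lra.
  apply: Rlt_le; apply: exp_increasing; have : 0 < K * t0 by apply: Rmult_lt_0_compat; lra.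
  lra.
have Ubd y t : vclos Om y -> 0 <= t <= T -> ~ (Om y /\ 0 < t < T) -> U y t <= z y.
  move=> hy ht hn; have pt := pen0 t; have py := psi0 y hy.
  have ep : 0 <= C * exp (- mu * t) * psi y.
    by apply: Rmult_le_pos => //; apply: Rmult_le_pos; [lra|apply: Rlt_le; exact: exp_pos].
  rewrite /U; have [t0|t0] := Req_dec t 0.
    have := ui y hy; move: ep pt; rewrite t0 Rmult_0_r exp_0; lra.
  have [tT|tT] := Req_dec t T.
    by have := hM y t hy ht; move: pt ep; rewrite tT; lra.
  have hb : vboundary Om y by split=> // Oy; apply: hn; split=> //; lra.
  have := ub y t hb (ltac:(lra)); lra.
have th2 : 0 < th / 2 by lra.
have ht1 : 0 <= t1 <= T by rewrite /T; lra.
have := penalized_comparison One Ob T0 Fm Uc zc zs Us eta0 Ubd Ox1 ht1 th2.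
by rewrite /U pent1; rewrite /th; lra.
Qed.

(** * Change of sign and conclusion *)

Definition vopp_fun {A : Type} (f : A -> R) : A -> R := fun x => - f x.

Lemma cont_on_opp N (S : vec N -> Prop) f : cont_on S f -> cont_on S (vopp_fun f).
Proof.
move=> hf x Sx e e0; have [d [d0 hd]] := hf x Sx e e0; exists d; split=> // y Sy hy.
by have := hd y Sy hy; rewrite /vopp_fun; split_Rabs; lra.
Qed.

Lemma subjet_opp N (Om : vec N -> Prop) z x p X : subjet Om (vopp_fun z) x p X ->
  superjet Om z x (vscale (-1) p) (mopp X).
Proof.
move=> [Xs h]; split; first exact: mopp_sym.
move=> e e0; have [d [d0 hd]] := h e e0; exists d; split=> // y Oy hy.
by have := hd y Oy hy; rewrite /vopp_fun dotZl quad_mopp; lra.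
Qed.

Lemma psuperjet_opp N (Om : vec N -> Prop) u x t a p X :
  psuperjet Om (fun y => vopp_fun (u y)) x t a p X -> psubjet Om u x t (- a) (vscale (-1) p) (mopp X).
Proof.
move=> [Xs h]; split; first exact: mopp_sym.
move=> e e0; have [d [d0 hd]] := h e e0; exists d; split=> // y s Oy s0 hy hs.
by have := hd y s Oy s0 hy hs; rewrite /vopp_fun dotZl quad_mopp; lra.
Qed.

Theorem theorem3p4 (N : nat) (Omega : vec N -> Prop) (j : nat)
  (g z u0 psi1 : vec N -> R) (mu1 : R) (u : vec N -> R -> R) :
  (* Omega: vbounded strictly convex domain with interior tangent balls *)
  vopen_set Omega -> (exists x, Omega x) -> vbounded Omega ->
  strictly_convex Omega -> interior_ball_condition Omega ->
  le 1 j -> le j N ->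
  (* z: viscosity solution of lambda_j(D^2 z) = 0 in Omega, z = g on vboundary,
     and z in C^1(vclos Omega) *)
  cont_on (vclos Omega) z ->
  visc_sol Omega (fun _ _ X => - lambda j X) z ->
  (forall x, vboundary Omega x -> z x = g x) ->
  C1_closure Omega z ->
  (* initial datum *)
  C1_closure Omega u0 ->
  (forall x, vboundary Omega x -> u0 x = g x) ->
  (* principal eigenpair: -lambda_N(D^2 psi1) = mu1 psi1 *)
  0 < mu1 ->
  cont_on (vclos Omega) psi1 ->
  (forall x, Omega x -> 0 < psi1 x) ->
  (forall x, vboundary Omega x -> psi1 x = 0) ->
  visc_sol Omega (fun _ r X => - lambda N X - mu1 * r) psi1 ->
  (* u: viscosity solution of the parabolic problem *)
  cont_on_cyl Omega u ->
  visc_sol_heat_lambda j Omega u ->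
  (forall x t, vboundary Omega x -> 0 < t -> u x t = g x) ->
  (forall x, vclos Omega x -> u x 0 = u0 x) ->
  exists C1 C2 : R, 0 < C1 /\ 0 < C2 /\
    forall x t, Omega x -> 0 < t ->
      z x + C1 * exp (- mu1 * t) * (- psi1 x) <= u x t /\
      u x t <= z x + C2 * exp (- mu1 * t) * psi1 x.
Proof.
move=> Oo One Ob Osc _ /leP j1 /leP jN zc [zsub zsup] zb zC1 uC1 u0b mu0 pc ppos pb [_ psup] uc
  [usub usup] ub ui.
have hj : (1 <= j <= N)%N by rewrite j1.
have N0 : (0 < N)%N := leq_trans j1 jN.
have Oc := strictly_convex_vconvex Osc.
have pc' : cont_on Omega psi1.
  move=> x Ox e e0; have [d [d0 hd]] := pc x (vclos_self Ox) e e0.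
  by exists d; split=> // y Oy; apply: hd; exact: vclos_self.
(* The top eigenvalue dominates the Rayleigh quotient of every unit vector, so the scalar equation
   becomes a curvature bound in all directions. *)
have psi_super x p X : Omega x -> subjet Omega psi1 x p X ->
    forall w, quad X w <= - (mu1 * psi1 x) * dot w w.
  move=> Ox hX w; have := psup x p X Ox hX => hl.
  have [h|h] := Rle_lt_or_eq_dec _ _ (vnorm_ge0 w); last first.
    have -> : w = vzero by apply: dot_eq0; rewrite -vnorm_sqr -h; ring.
    by rewrite quad0 dot0l; lra.
  have w1 : vnorm (vscale (/ vnorm w) w) = 1.
    by rewrite vnormZ Rabs_pos_eq; [field; lra|apply: Rlt_le; apply: Rinv_0_lt_compat].
  have := lambda_top_ge X N0 w1; rewrite quadZ => hq.
  have ww : 0 < vnorm w * vnorm w by nra.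
  rewrite -vnorm_sqr.
  have E : quad X w = (/ vnorm w * / vnorm w * quad X w) * (vnorm w * vnorm w) by field; lra.
  by rewrite E; apply: Rmult_le_compat_r; lra.
have pup := eigenfunction_upper Oo mu0 pc' ppos psi_super.
(* On all of [Omega] the lower bound [m0] must be 0, since [psi1] vanishes on the boundary; plain
   concavity is what remains, and it is what [hopf_bound] asks for. *)
have pconc a b t : Omega a -> Omega b -> 0 <= t <= 1 ->
    (1 - t) * psi1 a + t * psi1 b <= psi1 (vcomb (1 - t) t a b).
  move=> Oa Ob' ht; have := strong_concave mu0 pc' ppos psi_super Oo Oc (fun x h => h) (Rle_refl 0)
    (fun x Ox => Rlt_le _ _ (ppos x Ox)) Oa Ob' ht; lra.
have [L1 [L10 hL1]] := C1_lipschitz Oc Ob uC1; have [L2 [L20 hL2]] := C1_lipschitz Oc Ob zC1.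
pose d x := u0 x - z x.
have [C [C0 hC]] : exists C, 0 < C /\ forall x, Omega x -> Rabs (d x) <= C * psi1 x.
  apply: (hopf_bound (L := L1 + L2)) => //; first lra.
  - move=> x y Ox Oy; have /Rabs_bounds := hL1 x y Ox Oy; have /Rabs_bounds := hL2 x y Ox Oy.
    by move=> ? ?; rewrite /d; apply: Rabs_le; lra.
  - move=> x hx e e0; have e2 : 0 < e / 2 by lra.
    have [d1 [d10 h1]] := (proj1 uC1) x hx _ e2; have [d2 [d20 h2]] := zc x hx _ e2.
    exists (Rmin d1 d2); split=> [|y hy hyx]; first exact: Rmin_pos.
    have /Rabs_def2 := h1 y hy (Rlt_le_trans _ _ _ hyx (Rmin_l _ _)).
    have /Rabs_def2 := h2 y hy (Rlt_le_trans _ _ _ hyx (Rmin_r _ _)).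
    by move=> ? ?; rewrite /d; apply: Rabs_def1; lra.
  by move=> x hx; rewrite /d u0b // zb //; ring.
have dcl x : vclos Omega x -> - (C * psi1 x) <= u x 0 - z x <= C * psi1 x.
  move=> hx; rewrite ui //; have [/hC/Rabs_bounds //|hn] := classic (Omega x).
  have hb : vboundary Omega x by [].
  by rewrite u0b // zb // pb //; lra.
exists C, C; do 2 split=> //; split.
  have Fm : degenerate_mono (fun X : mat N => - lambda j (mopp X)).
    move=> X Y e h; have := @lambda_mono N j (mopp Y) (mopp X) e hj.
    by move=> /(_ (fun v => ltac:(rewrite !quad_mopp; have := h v; lra))); lra.
  have := @decay_upper_bound N Omega _ (fun y => vopp_fun (u y)) (vopp_fun z) psi1 mu1 C One Ob Fm mu0 C0
    (cont_on_opp zc).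
  move=> hub; suff : vopp_fun (u x) t <= vopp_fun z x + C * exp (- mu1 * t) * psi1 x by rewrite /vopp_fun; lra.
  apply: hub => //.
  - by move=> y p X Oy /subjet_opp hX; have := zsub _ _ _ Oy hX; lra.
  - move=> y s hy hs e e0; have [r [r0 hr]] := uc y s hy hs e e0; exists r; split=> // y' s' hy' hs' a b.
    by have := hr y' s' hy' hs' a b; rewrite /vopp_fun; split_Rabs; lra.
  - by move=> y s a p X Oy s0 /psuperjet_opp hX; have := usup _ _ _ _ _ Oy s0 hX; lra.
  - by move=> y s hy hs; rewrite /vopp_fun ub // zb.
  by move=> y hy; have := dcl y hy; rewrite /vopp_fun; lra.
have Fm : degenerate_mono (fun X : mat N => lambda j X) by move=> X Y e h; apply: lambda_mono.
apply: (decay_upper_bound One Ob Fm mu0 C0 zc) => //.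
- by move=> y p X Oy hX; have := zsup _ _ _ Oy hX; lra.
- by move=> y s a p X Oy s0 hX; have := usub _ _ _ _ _ Oy s0 hX; lra.
- by move=> y s hy hs; rewrite ub // zb.
by move=> y hy; have := dcl y hy; lra.
Qed.
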